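(* Let $1\le p\le\infty$, $1/p+1/q=1$, $s>0$, $\delta\in(0,1/2)$. For every $j\in\mathbb{N}$ let $\widetilde\varphi_j\in\mathcal{D}'$ and $\varphi_j\in\mathcal{T}_{M^j}$ be such that $$\sup_j\bigg\|\bigg\{\frac{|M^{-j}k|^s}{1-\widehat{\varphi_j}(k)\widehat{\widetilde\varphi_j}(k)}\,v_{1/\delta}(M^{-j}k)\bigg\}_k\bigg\|_{\mathcal{M}_p}<\infty$$ (this condition is understood to include that $1-\widehat{\varphi_j}(k)\widehat{\widetilde\varphi_j}(k)\neq0$ for all $k\ne0$ with $v_{1/\delta}(M^{-j}k)\ne0$, the entry of the sequence being taken to be $0$ at $k=0$ and wherever $v_{1/\delta}(M^{-j}k)=0$). Then, for any $j\in\mathbb{N}$ and any $f\in B_{\widetilde\varphi_j,p}$, $$\mathcal{K}_s^\Delta(f,M^{-j})_p\le C\Big(\|f-Q_j(f,\varphi_j,\widetilde\varphi_j)\|_p+E_{\frac12M^j}(f)_p+K_{\varphi_j,q}\,\widetilde E_{\frac12M^j}(\widetilde\varphi_j*f)_p\Big).$$ If, additionally, $\widetilde\varphi_j\in L_q$, then for any $f\in L_p$, $$\mathcal{K}_s^\Delta(f,M^{-j})_p\le C\big(1+K_{\varphi_j,q}\|\widetilde\varphi_j\|_{\mathcal{L}_{q,j}}\big)\|f-Q_j(f,\varphi_j,\widetilde\varphi_j)\|_p.$$ Here the constant $C>0$ does not depend on $f$ and $j$.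
   Context: $\mathbb{T}^d=\mathbb{R}^d/\mathbb{Z}^d$, identified with $[-1/2,1/2)^d$ where needed. $L_p=L_p(\mathbb{T}^d)$ with norm $\|\cdot\|_p$; for $p=\infty$ the space of approximated functions $L_\infty$ is replaced by $C(\mathbb{T}^d)$. $B$ is the space of bounded measurable functions on $\mathbb{T}^d$. $\widehat f(k)=\int_{\mathbb{T}^d}f(x)e^{-2\pi i(k,x)}dx$. $\mathcal{D}'$ is the space of periodic distributions (continuous linear functionals on $C^\infty(\mathbb{T}^d)$), with Fourier coefficients $\widehat{\widetilde\varphi}(k)=\langle e^{-2\pi i(k,\cdot)},\widetilde\varphi\rangle$. $|\cdot|$ is the Euclidean norm on $\mathbb{R}^d$. $M=\mathrm{diag}(m_1,\dots,m_d)$ is a fixed diagonal matrix with integers $m_i$, $|m_i|>1$, and $m=|\det M|$. For a real diagonal matrix $A$ (such as $M^j$ or $\frac12M^j$): $D(A)=(A[-1/2,1/2)^d)\cap\mathbb{Z}^d$; $\mathcal{T}_A$ is the set of trigonometric polynomials with frequencies in $D(A)$; $E_A(f)_p=\inf\{\|f-T\|_p:T\in\mathcal{T}_A\}$; for $g\in B$, $\widetilde E_A(g)_p=\inf\{\|t-T\|_p: t,T\in\mathcal{T}_A,\ t(x)\le g(x)\le T(x)\ \forall x\in\mathbb{T}^d\}$ (inequalities between real-valued functions). For $\widetilde\varphi\in\mathcal{D}'$, $B_{\widetilde\varphi,p}$ is the class of $f\in L_p$ such that $\sum_{\ell\in\mathbb{Z}^d}\widehat{\widetilde\varphi}(\ell)\widehat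 f(\ell)e^{2\pi i(\ell,x)}$ is the Fourier series of a bounded function, which is denoted $\widetilde\varphi*f$. If $\widetilde\varphi\in L_q$, $1/p+1/q=1$, then $B_{\widetilde\varphi,p}=L_p$. The quasi-interpolation operator is $$Q_j(f,\varphi_j,\widetilde\varphi_j)(x)=\frac1{m^j}\sum_{k\in D(M^j)}(\widetilde\varphi_j*f)(M^{-j}k)\,\varphi_j(x-M^{-j}k).$$ For a trigonometric polynomial $\varphi$, $K_{\varphi,q}=\sup_{\|f\|_q\le1}\|\varphi*f\|_q$ (convolution on $\mathbb{T}^d$). For $\widetilde\varphi_j\in L_q$, $$\|\widetilde\varphi_j\|_{\mathcal{L}_{q,j}}=\Big(m^j\int_{M^{-j}\mathbb{T}^d}\Big(\frac1{m^j}\sum_{k\in D(M^j)}|\widetilde\varphi_j(x-M^{-j}k)|\Big)^q dx\Big)^{1/q}\ (1\le q<\infty),$$ $$\|\widetilde\varphi_j\|_{\mathcal{L}_{\infty,j}}=\frac1{m^j}\sup_{x\in\mathbb{R}^d}\sum_{k\in D(M^j)}|\widetilde\varphi_j(x-M^{-j}k)|,$$ with $M^{-j}\mathbb{T}^d=M^{-j}[-1/2,1/2)^d$. In the hypothesis $\widetilde\varphi_j\in L_q$ with $q=\infty$, $L_\infty$ is the usual space of essentially bounded functions. $K$-functional: $\mathcal{K}_s^\Delta(f,M^{-j})_p=\inf_g\{\|f-g\|_p+\|(-\Delta_{M^{-j}})^{s/2}g\|_p\}$, where $(-\Delta_{M^{-j}})^{s/2}g$ is the function with Fourier series $\sum_{k\in\mathbb{Z}^d}|M^{-j}k|^s\,\widehat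 g(k)e^{2\pi i(k,x)}$ and the infimum is over $g\in L_p$ for which this is the Fourier series of a function in $L_p$. Fourier multipliers: a sequence $\Lambda=\{\lambda_k\}_{k\in\mathbb{Z}^d}$ is a Fourier multiplier in $L_p$ if for every $f\in L_p$ the series $\sum_k\lambda_k\widehat f(k)e^{2\pi i(k,x)}$ is the Fourier series of some $\Lambda f\in L_p$; $\|\{\lambda_k\}_k\|_{\mathcal{M}_p}=\sup_{\|f\|_p\le1}\|\Lambda f\|_p$. The function $v\in C^\infty(\mathbb{R}^d)$ is fixed with $v(\xi)=1$ for $\xi\in[-1/4,1/4)^d$ and $v(\xi)=0$ for $\xi\notin[-3/8,3/8)^d$; $v_\delta(\xi)=v(\delta^{-1}\xi)$, so $v_{1/\delta}(\xi)=v(\delta\xi)$. *)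

(* Defs.v *)
From HB Require Import structures.
From mathcomp Require Import all_boot all_order all_algebra.
From mathcomp Require Import all_classical all_reals all_analysis.
From mathcomp Require Import complex lra.

Set Implicit Arguments.
Unset Strict Implicit.
Unset Printing Implicit Defensive.

Import Order.TTheory GRing.Theory Num.Theory.
Import numFieldNormedType.Exports.
Import Normc.

Local Open Scope classical_set_scope.
Local Open Scope ring_scope.
Local Open Scope complex_scope.

(** Measurable structure on column vectors: the product sigma-algebra. *)

Definition measure_cV_display : measure_display -> measure_display.
Proof. exact. Qed.

Section measurable_cV.
Context {disp} {T : sigmaRingType disp}.
Variable n : nat.

Let entry (i : 'I_n) (x : 'cV[T]_n) : T := x i 0.

Let cV_set0 : g_sigma_preimage entry set0.
Proof. exact: sigma_algebra0. Qed.

Let cV_setC A : g_sigma_preimage entry A -> g_sigma_preimage entry (~` A).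
Proof. exact: sigma_algebraC. Qed.

Let cV_bigcup (F : _^nat) : (forall i, g_sigma_preimage entry (F i)) ->
  g_sigma_preimage entry (\bigcup_i (F i)).
Proof. exact: sigma_algebra_bigcup. Qed.

HB.instance Definition _ := @isMeasurable.Build (measure_cV_display disp)
  'cV[T]_n (g_sigma_preimage entry) cV_set0 cV_setC cV_bigcup.

End measurable_cV.

Lemma measurable_entry disp (T : sigmaRingType disp) n (i : 'I_n) :
  measurable_fun [set: 'cV[T]_n] (fun x => x i 0).
Proof.
move=> _ Y mY; rewrite setTI; apply: sub_sigma_algebra => /=.
rewrite -bigcup_seq/=; exists i => /=; first by rewrite mem_index_enum.
by exists Y => //; rewrite setTI.
Qed.

(** [pushforward m f] with its measure structure; the generic instance takes the
    measurability proof as an argument that is not inferred. *)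
Definition image_measure d1 d2 (T1 : measurableType d1) (T2 : measurableType d2)
    (R : realType) (m : {measure set T1 -> \bar R}) (f : T1 -> T2)
    (mf : measurable_fun [set: T1] f) : {measure set T2 -> \bar R} :=
  measure_function_pushforward__canonical__measure_function_Measure m mf.

Section lebesgue_cV.
Context {R : realType}.

Definition cons_cV n (p : R * 'cV[R]_n) : 'cV[R]_n.+1 :=
  \col_i if unlift ord0 i is Some j then p.2 j 0 else p.1.

Lemma measurable_cons_cV n : measurable_fun [set: R * 'cV[R]_n] (@cons_cV n).
Proof.
suff H : g_sigma_preimage (fun (i : 'I_n.+1) (x : 'cV[R]_n.+1) => x i 0) `<=`
    [set A | measurable (@cons_cV n @^-1` A)].
  by move=> _ A /H mA; rewrite setTI.
apply: smallest_sub.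
  split.
  - by rewrite /= preimage_set0.
  - by move=> A /= mA; rewrite setTD; exact: measurableC.
  - by move=> F mF; rewrite /= preimage_bigcup; exact: bigcupT_measurable.
rewrite -bigcup_seq => A [i _ [B mB <-]] /=; rewrite setTI -comp_preimage.
suff mi : measurable_fun [set: R * 'cV[R]_n] (fun p => @cons_cV n p i 0).
  by rewrite -[X in measurable X]setTI; exact: mi.
case: (unliftP ord0 i) => [j ->|->].
- rewrite (_ : (fun _ => _) = (fun x : 'cV[R]_n => x j 0) \o snd).
    by apply: measurableT_comp; [exact: measurable_entry|exact: measurable_snd].
  by apply/funext => p /=; rewrite mxE liftK.
- rewrite (_ : (fun _ => _) = fst); first exact: measurable_fst.
  by apply/funext => p /=; rewrite mxE unlift_none.
Qed.

Fixpoint lebesgue_cV n : {measure set 'cV[R]_n -> \bar R} :=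
  if n is n'.+1 then
    image_measure (@lebesgue_measure R \x^ lebesgue_cV n')%E
      (@measurable_cons_cV n')
  else \d_ (0 : 'cV[R]_0).

Definition box n (r : R) : set 'cV[R]_n :=
  [set x | forall i, - r <= x i 0 < r].

Lemma measurable_box n r : measurable (@box n r).
Proof.
rewrite (_ : box r = \big[setI/setT]_(i < n)
    ([set: 'cV[R]_n] `&` (fun x : 'cV[R]_n => x i 0) @^-1` `[- r, r[%classic)).
  by apply: bigsetI_measurable => i _; exact: measurable_entry.
rewrite -bigcap_seq; apply/seteqP; split=> x /= h i.
  by move=> _; split=> //; rewrite /= in_itv /=.
by have [|_ /=] := h i; [rewrite /= mem_index_enum|rewrite in_itv].
Qed.

Lemma lebesgue_cV_box n (r : R) : 0 <= r ->
  lebesgue_cV n (box r) = ((r *+ 2) ^+ n)%:E.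
Proof.
move=> r0; elim: n => [|n IH] /=.
  by rewrite diracE expr0 mem_set // => -[].
rewrite /pushforward (_ : _ @^-1` _ = `[- r, r[%classic `*` box r).
  rewrite [LHS]product_measure2E; [|exact: measurable_itv|exact: measurable_box].
  rewrite [X in (_ * X)%E]IH /= lebesgue_measure_itv /= lte_fin.
  case: ltP => [_|h].
    by rewrite opprK -EFinM exprS mulr2n.
  have -> : r = 0 by lra.
  by rewrite mul0e mul0rn exprS mul0r.
apply/seteqP; split=> [[a x] h|[a x] [/= h1 h2] i]; rewrite /box /=.
  split; first by have := h ord0; rewrite !mxE unlift_none /= in_itv.
  by move=> i; have := h (lift ord0 i); rewrite !mxE liftK.
rewrite !mxE; case: (unliftP ord0 i) => [j _|_]; first exact: h2.
by move: h1; rewrite /= in_itv.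
Qed.
End lebesgue_cV.

(* Real and imaginary parts valued in [R], not the operations of numClosedFieldType *)
Local Notation Re := complex.Re.
Local Notation Im := complex.Im.

Section torus.
Context {R : realType} {d : nat}.
Implicit Types (f g h : 'cV[R]_d -> R[i]) (k : 'cV[int]_d) (x y : 'cV[R]_d).
Implicit Types (A : 'M[R]_d) (p q : \bar R) (j : nat).

Definition intvec k : 'cV[R]_d := map_mx intr k.

Definition euclidean_norm x : R := Num.sqrt (\sum_i x i 0 ^+ 2).

(** Functions on the torus are the functions on [R^d] of period 1 in each
    coordinate; integrals are taken over the cell [[-1/2, 1/2)^d]. *)
Definition periodic f := forall k x, f (x + intvec k) = f x.

Definition cell : set 'cV[R]_d := box 2^-1.

Definition torus_measure : {measure set 'cV[R]_d -> \bar R} :=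
  mrestr (lebesgue_cV d) (measurable_box 2^-1).

Definition cmeasurable f :=
  measurable_fun [set: 'cV[R]_d] (fun x => Re (f x)) /\
  measurable_fun [set: 'cV[R]_d] (fun x => Im (f x)).

Definition ccontinuous f :=
  continuous (fun x => Re (f x)) /\ continuous (fun x => Im (f x)).

Definition cintegral f : R[i] :=
  (\int[torus_measure]_x Re (f x)) +i* (\int[torus_measure]_x Im (f x)).

Definition Lp_norm p f : \bar R :=
  'N[torus_measure]_p[(fun x => (normc (f x))%:E)].

Definition Lebesgue_space p : set ('cV[R]_d -> R[i]) :=
  [set f | [/\ cmeasurable f, periodic f & (Lp_norm p f < +oo)%E]].

(** The space of approximated functions: [C(T^d)] replaces [L_oo]. *)
Definition approx_space p : set ('cV[R]_d -> R[i]) :=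
  if p == +oo%E then [set f | ccontinuous f /\ periodic f]
  else Lebesgue_space p.

Definition bounded_space : set ('cV[R]_d -> R[i]) :=
  [set f | [/\ cmeasurable f, periodic f &
               exists c : R, forall x, normc (f x) <= c]].

(** The character [exp (2 pi i (k, x))]. *)
Definition character k x : R[i] :=
  let t := 2 * pi * (\sum_i (k i 0)%:~R * x i 0) in
  (cos t) +i* (sin t).

Definition fourier f k : R[i] := cintegral (fun x => f x * character (- k) x).

Definition convolution f g x : R[i] := cintegral (fun y => f (x - y) * g y).

(** Iterated partial derivatives, indexed by the list of directions. *)
Definition partials (s : seq 'I_d) (u : 'cV[R]_d -> R) : 'cV[R]_d -> R :=
  foldr (fun i w x => 'D_(delta_mx i 0) w x) u s.

Definition smooth (u : 'cV[R]_d -> R) := forall s : seq 'I_d,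
  continuous (partials s u) /\
  forall i x, derivable (partials s u) x (delta_mx i 0).

Definition csmooth f :=
  smooth (fun x => Re (f x)) /\ smooth (fun x => Im (f x)).

Definition cpartials (s : seq 'I_d) f x : R[i] :=
  partials s (fun y => Re (f y)) x +i* partials s (fun y => Im (f y)) x.

Definition test_function f := csmooth f /\ periodic f.

(** Periodic distributions; [pairing] is only meaningful on test functions.
    Continuity is for the topology of [C^oo(T^d)]: uniform convergence of all
    partial derivatives. *)
Record periodic_distribution := PeriodicDistribution {
  pairing :> ('cV[R]_d -> R[i]) -> R[i];
  distribution_linear : forall (a : R[i]) f g,
    test_function f -> test_function g ->
    pairing (fun x => a * f x + g x) = a * pairing f + pairing g;
  distribution_continuous : forall f, test_function f ->
    forall e : R, 0 < e -> exists N (eta : R), 0 < eta /\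
    forall g, test_function g ->
      (forall s, (size s <= N)%N -> forall x,
        normc (cpartials s (fun y => g y - f y) x) < eta) ->
      normc (pairing g - pairing f) < e }.

Implicit Type phit : periodic_distribution.

Definition dist_fourier phit k : R[i] := phit (character (- k)).

(** The distribution [phit] is given by the function [h] of [L_q]. *)
Definition dist_Lq phit q h := Lebesgue_space q h /\
  forall f, test_function f -> phit f = cintegral (fun x => f x * h x).

(** [f] is in the class [B_(phit, p)] and the bounded function [g] is a version
    of [phit * f], which its Fourier series determines almost everywhere only. *)
Definition dist_convolution phit p f g :=
  [/\ approx_space p f, bounded_space g &
      forall k, fourier g k = dist_fourier phit k * fourier f k].

Definition frequencies A : set 'cV[int]_d :=
  [set k | exists2 u, cell u & intvec k = A *m u].

Definition trig_poly A : set ('cV[R]_d -> R[i]) :=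
  [set t | exists c : 'cV[int]_d -> R[i],
    forall x, t x = \sum_(k \in frequencies A) c k * character k x].

Definition best_approx A p f : \bar R :=
  ereal_inf [set Lp_norm p (fun x => f x - t x) | t in trig_poly A].

Definition real_le f g := forall x,
  [/\ Im (f x) = 0, Im (g x) = 0 & Re (f x) <= Re (g x)].

(** For a bounded [g] that is not real-valued this is the infimum of the empty
    set, [+oo]. *)
Definition onesided_approx A p g : \bar R :=
  ereal_inf [set e | exists t T, [/\ trig_poly A t, trig_poly A T,
    real_le t g, real_le g T & e = Lp_norm p (fun x => t x - T x)]].

Definition dilation (m : 'rV[int]_d) : 'M[R]_d := diag_mx (map_mx intr m).

Section fixed_dilation.
Variable M : 'M[R]_d.

Definition mdet j : R := `|\det M| ^+ j.

Definition scaled j x : 'cV[R]_d := invmx (M ^+ j) *m x.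

Definition node j k : 'cV[R]_d := scaled j (intvec k).

(** [Q_j(f, phi, phit)], where [g] is the function [phit * f]. *)
Definition quasi_interp j phi g x : R[i] :=
  ((mdet j)^-1)%:C *
  \sum_(k \in frequencies (M ^+ j)) g (node j k) * phi (x - node j k).

Definition shift_sum j h x : R :=
  (mdet j)^-1 * \sum_(k \in frequencies (M ^+ j)) normc (h (x - node j k)).

(** The norm of [\mathcal{L}_{q, j}]; exponents are at least 1, and the case
    [-oo] is irrelevant. *)
Definition Lqj_norm q j h : \bar R :=
  match q with
  | r%:E => (((mdet j)%:E *
      \int[lebesgue_cV d]_(x in scaled j @` cell) ((shift_sum j h x) `^ r)%:E)
      `^ r^-1)%E
  | +oo%E => ereal_sup [set (shift_sum j h x)%:E | x in [set: 'cV[R]_d]]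
  | -oo%E => 0%E
  end.

(** The K-functional; [h] is [(- Delta_(M^-j))^(s/2) g]. *)
Definition K_functional (s : R) j p f : \bar R :=
  ereal_inf [set e | exists g h, [/\ approx_space p g, approx_space p h,
    forall k, fourier h k = ((euclidean_norm (node j k)) `^ s)%:C * fourier g k
    & e = (Lp_norm p (fun x => (f x - g x)%R) + Lp_norm p h)%E]].

(** At [k = 0] and where the cut-off vanishes the entry is 0. *)
Definition symbol (s delta : R) (v phi : 'cV[R]_d -> R[i]) phit j k : R[i] :=
  let w := v (delta *: node j k) in
  if (k == 0) || (w == 0) then 0 else
  ((euclidean_norm (node j k)) `^ s)%:C /
    (1 - fourier phi k * dist_fourier phit k) * w.

End fixed_dilation.

Definition convolution_norm phi q : \bar R :=
  ereal_sup [set Lp_norm q (convolution phi f) |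
    f in [set f | Lebesgue_space q f /\ (Lp_norm q f <= 1)%E]].

Definition multiplier_image p (lam : 'cV[int]_d -> R[i]) f h :=
  approx_space p h /\ forall k, fourier h k = lam k * fourier f k.

Definition fourier_multiplier p (lam : 'cV[int]_d -> R[i]) :=
  forall f, approx_space p f -> exists h, multiplier_image p lam f h.

Definition multiplier_norm p (lam : 'cV[int]_d -> R[i]) : \bar R :=
  ereal_sup [set Lp_norm p h | h in [set h | exists f,
    [/\ approx_space p f, (Lp_norm p f <= 1)%E & multiplier_image p lam f h]]].

End torus.
Arguments periodic_distribution : clear implicits.

(* Main.v *)
(** The multiplier hypothesis is applied to trigonometric polynomials only. If T has its
    spectrum in D(M^j), then (-Delta_(M^-j))^(s/2) T is the image under the multiplier of
    X = T - phi_j * (phit_j * T), because v_(1/delta) is 1 on D(M^j); hence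
    K(f) <= |f - T|_p + S |X|_p, where S is the supremum in the hypothesis.

    First estimate: T = V * f, where V is a de la Vallee-Poussin kernel with Fourier
    coefficients 1 on D(M^j / 2) and 0 off D(M^j). If t <= g <= T' are the one-sided
    approximants of g = phit_j * f, then Q_j t = phi_j * t, and Q_j f - phi_j * (V * g) =
    Q_j (g - t) - phi_j * (V * (g - t)) is controlled by T' - t.

    Second estimate: T = Q_j f and X = Q_j (f - T).

    Both rest on a bound for Q_j. As phi_j has its spectrum in D(M^j), Q_j f = phi_j * U,
    where U is built from the same samples with a kernel V' in place of phi_j, V' having
    Fourier coefficients 1 on D(M^j). On one side |phi_j * U|_p <= C K_(phi_j, q) |U|_p
    by duality. On the other |U| is dominated by an integral operator whose kernel K(x, y)
    is the average over the nodes x_k of Phi(x - x_k) |h(x_k - y)|, where Phi is a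
    Fejer-type majorant of V' and h = phit_j (h = V' in the first estimate); a Schur test
    with weight the node average of |h(x_k - .)| bounds its norm on L_p by the L_q norm of
    that weight, which is at most the norm of h in L_(q, j). *)
Require Import Defs.
From HB Require Import structures.
From mathcomp Require Import all_boot all_order all_algebra.
From mathcomp Require Import all_classical all_reals all_analysis.
From mathcomp Require Import measurable_realfun ess_sup_inf.
From mathcomp Require Import complex lra ring.

Set Implicit Arguments.
Unset Strict Implicit.
Unset Printing Implicit Defensive.

Import Order.TTheory GRing.Theory Num.Theory.
Import numFieldNormedType.Exports.
Import Normc.

Local Open Scope classical_set_scope.
Local Open Scope ring_scope.

(** * One-dimensional periodic integrals *)

(** The two kernels have different duties. [half_kernel] gives V, which must vanish off D(M^j) so
    that V * f is an admissible competitor; it can then be 1 only on D(M^j / 2). [full_kernel] gives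
    V', which must be 1 on all of D(M^j), but may have a larger spectrum, since phi_j or a
    polynomial with spectrum in D(M^j) cuts it off. In exchange its majorant is a multiple of a
    Fejer kernel, whose sum over the nodes is exactly constant.

    V' is there because K_(phi_j, q) controls convolution with phi_j, not sums of its translates.
    The weight in the Schur test is there because the trivial weight would bring in the supremum of
    the node average; its L_q norm suffices because the node average is invariant under translation
    by nodes.

    An L_p norm of g - t does not control the samples of g - t; the bracketing 0 <= g - t <= T' - t
    does, through the samples of a trigonometric polynomial.

    In the constants, 3^d counts translates by -1, 0, 1 in each coordinate, and the factors 2 come
    from estimating real and imaginary parts separately. *)

Section lebesgue_line.
Context {R : realType}.
Local Open Scope ereal_scope.
Implicit Types (f : R -> \bar R) (a b c : R).

Let mu := @lebesgue_measure R.

Lemma measurable_affine a b : measurable_fun [set: R] (fun x : R => a + b * x)%R.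
Proof. by apply: measurable_funD => //; exact: measurable_funM. Qed.

Lemma lebesgue_measure_shift a (A : set R) : measurable A ->
  pushforward mu (fun x : measurableTypeR R => (a + x)%R : measurableTypeR R) A = mu A.
Proof.
have mf : measurable_fun [set: measurableTypeR R]
    (fun x : measurableTypeR R => (a + x)%R : measurableTypeR R).
  exact: measurable_funD.
move=> mA; apply/esym.
apply: (@lebesgue_measure_unique _ (image_measure mu mf)) => //= _ [[x y]] _ <-.
rewrite /pushforward (_ : _ @^-1` _ = `](x - a)%R, (y - a)%R]%classic); last first.
  apply/seteqP; split => z /=; rewrite !in_itv/= => /andP[h1 h2];
    apply/andP; split; lra.
rewrite !lebesgue_measure_itv/= !lte_fin.
have -> : ((x - a < y - a) = (x < y))%R by rewrite ltrD2r.
by case: ifP => // _; congr (_%:E); lra.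
Qed.

(** Translations and reflections are the only changes of variable that convolutions require, whence
    the restriction to slopes 1 and -1. *)
Lemma ge0_integral_affine a b f : measurable_fun [set: R] f -> (forall x, 0 <= f x) ->
  (b = 1 \/ b = -1)%R -> \int[mu]_x f (a + b * x)%R = \int[mu]_x f x.
Proof.
have shift g : measurable_fun [set: R] g -> (forall x, 0 <= g x) ->
    \int[mu]_x g (a + x)%R = \int[mu]_x g x.
  move=> mg g0.
  have mf : measurable_fun [set: measurableTypeR R]
    (fun x : measurableTypeR R => (a + x)%R : measurableTypeR R).
    exact: measurable_funD.
  have := @ge0_integral_pushforward _ _ _ _ R _ mf mu setT g measurableT mg (fun x _ => g0 x).
  rewrite preimage_setT => <-.
  by apply: eq_measure_integral => A mA _; exact: lebesgue_measure_shift.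
have opp g : measurable_fun [set: R] g -> (forall x, 0 <= g x) ->
    \int[mu]_x g (- x)%R = \int[mu]_x g x.
  move=> mg g0.
  have mf : measurable_fun [set: measurableTypeR R]
    (fun x : measurableTypeR R => (- x)%R : measurableTypeR R).
    exact: oppr_measurable.
  have := @ge0_integral_pushforward _ _ _ _ R _ mf mu setT g measurableT mg (fun x _ => g0 x).
  rewrite preimage_setT => <-.
  by apply: eq_measure_integral => A mA _; exact: lebesgue_measureN.
move=> mf f0 [->|->].
  by rewrite -[RHS]shift//; apply: eq_integral => x _; rewrite mul1r.
rewrite -[RHS]shift// -[RHS]opp//; first by apply: eq_integral => x _; rewrite mulN1r.
have -> : (fun x : R => f (a + x)%R) = f \o (fun x => a + 1 * x)%R.
  by apply/funext => x /=; rewrite mul1r.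
by apply: (measurableT_comp mf); exact: measurable_affine.
Qed.

Lemma ge0_integral_preimage_affine a b f (A : set R) : measurable A ->
  measurable_fun [set: R] f -> (forall x, 0 <= f x) ->
  (b = 1 \/ b = -1)%R ->
  \int[mu]_(x in [set x | A (a + b * x)%R]) f (a + b * x)%R = \int[mu]_(x in A) f x.
Proof.
move=> mA mf f0 hb.
rewrite integral_mkcond [RHS]integral_mkcond -[RHS](@ge0_integral_affine a b)//.
- by apply/(measurable_restrictT f mA); exact: measurable_funS mf.
- by move=> x; apply: erestrict_ge0 => y _.
Qed.

Lemma ge0_integral_itv_split f a b c : measurable_fun [set: R] f ->
  (forall x, 0 <= f x) -> (a <= b)%R -> (b <= c)%R ->
  \int[mu]_(x in `[a, c[) f x = \int[mu]_(x in `[a, b[) f x + \int[mu]_(x in `[b, c[) f x.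
Proof.
move=> mf f0 ab bc.
rewrite (_ : `[a, c[%classic = `[a, b[%classic `|` `[b, c[%classic).
  rewrite ge0_integral_setU//; first exact: measurable_funS mf.
  apply/disj_setPS => x [] /=; rewrite !in_itv/=; lra.
apply/seteqP; split => x /=; rewrite !in_itv/=.
  by case: (ltP x b) => h /andP[h1 h2]; [left|right]; apply/andP; split => //; lra.
by case=> /andP[h1 h2]; apply/andP; split => //; lra.
Qed.

Lemma ge0_integral_period f c : measurable_fun [set: R] f -> (forall x, 0 <= f x) ->
  (0 < c)%R -> (forall x, f (x + c)%R = f x) -> forall a b,
  \int[mu]_(x in `[a, (a + c)%R[) f x = \int[mu]_(x in `[b, (b + c)%R[) f x.
Proof.
move=> mf f0 c0 fc.
have fcn n x : f (x + n%:R * c)%R = f x.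
  elim: n x => [|n IH] x; first by rewrite mul0r addr0.
  by rewrite -natr1 mulrDl mul1r addrA fc IH.
have fcz (n : int) x : f (x + n%:~R * c)%R = f x.
  case: n => n; first by rewrite fcn.
  by rewrite -[LHS](fcn n.+1) NegzE rmorphN/= mulNr pmulrn subrK.
have sh u v (n : int) : \int[mu]_(x in `[(u + n%:~R * c)%R, (v + n%:~R * c)%R[) f x
    = \int[mu]_(x in `[u, v[) f x.
  rewrite -(@ge0_integral_preimage_affine (n%:~R * c)%R 1%R f)//; last by left.
  have -> : [set x | `[(u + n%:~R * c)%R, (v + n%:~R * c)%R[%classic
      (n%:~R * c + 1 * x)%R] = `[u, v[%classic.
    by apply/seteqP; split => x /=; rewrite !in_itv/= => /andP[h1 h2];
      apply/andP; split; lra.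
  by apply: eq_integral => x _; rewrite mul1r addrC fcz.
move=> a b.
(* Moving the first window by n periods brings its left end a' to a' <= b < a' + c. The two windows
   then overlap on [b, a' + c), and the leftover pieces [a', b) and [a' + c, b + c) differ by one
   period. *)
pose n := Num.floor ((b - a) / c)%R.
rewrite -(sh _ _ n).
have -> : (a + c + n%:~R * c = a + n%:~R * c + c)%R by ring.
set a' := (a + n%:~R * c)%R.
have h1 : (a' <= b)%R.
  have := floor_le ((b - a) / c)%R; rewrite ler_pdivlMr// -/n /a'; lra.
have h2 : (b < a' + c)%R.
  have := floorD1_gt ((b - a) / c)%R.
  rewrite ltr_pdivrMr// -/n intrD mulrDl mul1r /a'; lra.
rewrite (@ge0_integral_itv_split _ a' b)//; last by lra.
rewrite (@ge0_integral_itv_split _ b (a' + c)%R (b + c)%R)//; [|lra|lra].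
rewrite addeC; congr (_ + _).
by have := sh a' b 1%:Z; rewrite mul1r => ->.
Qed.

(** A reflection or a negative dilation exchanges the closed and the open end of an interval; this
    puts them back. *)
Lemma integral_itvco_itvoc f a b : measurable_fun [set: R] f ->
  \int[mu]_(x in `[a, b[) f x = \int[mu]_(x in `]a, b]) f x.
Proof.
move=> mf; rewrite integral_itv_bndo_bndc; last exact: measurable_funS mf.
by rewrite [RHS]integral_itv_obnd_cbnd//; exact: measurable_funS mf.
Qed.

Lemma ge0_integral_unit_affine f a b : measurable_fun [set: R] f ->
  (forall x, 0 <= f x) -> (forall x, f (x + 1)%R = f x) -> (b = 1 \/ b = -1)%R ->
  \int[mu]_(x in `[(- 2^-1)%R, 2^-1%R[) f (a + b * x)%R =
  \int[mu]_(x in `[(- 2^-1)%R, 2^-1%R[) f x.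
Proof.
move=> mf f0 fp hb; have P := ge0_integral_period mf f0 ltr01 fp.
have e : (- 2^-1 + 1 = 2^-1 :> R)%R by lra.
have /= := P (- 2^-1)%R (a - 2^-1)%R; rewrite e => ->.
case: (hb) => hb'; rewrite hb'.
- rewrite -[RHS](@ge0_integral_preimage_affine a 1%R)//; last by left.
  congr (integral _ _ _); apply/seteqP; split => x /=; rewrite !in_itv/=;
    move=> /andP[h1 h2]; apply/andP; split; lra.
- rewrite integral_itvco_itvoc; last exact: measurableT_comp mf (measurable_affine _ _).
  rewrite -[RHS](@ge0_integral_preimage_affine a (-1)%R)//; last by right.
  congr (integral _ _ _); apply/seteqP; split => x /=; rewrite !in_itv/=;
    move=> /andP[h1 h2]; apply/andP; split; lra.
Qed.

(** The set on the right is an interval of length 1/|c|, a single period of f, and |c| is an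
    integer, so |c| periods fill the unit interval. For negative c the interval is open on the left
    and closed on the right. *)
Lemma ge0_integral_tiling f (c : R) : measurable_fun [set: R] f ->
  (forall x, 0 <= f x) -> (exists k : nat, c = k.+1%:R \/ c = - k.+1%:R)%R ->
  (forall x, f (x + `|c|^-1)%R = f x) ->
  \int[mu]_(x in `[(- 2^-1)%R, 2^-1%R[) f x =
  `|c|%:E * \int[mu]_(x in [set x | (- 2^-1 <= c * x < 2^-1)%R]) f x.
Proof.
move=> mf f0 [k ck] fp.
have kc : (`|c| = k.+1%:R)%R by case: ck => ->; rewrite ?normrN normr_nat.
rewrite !kc in fp *.
have k0 : (0 < k.+1%:R^-1 :> R)%R by rewrite invr_gt0.
have P := ge0_integral_period mf f0 k0 fp.
have many (n : nat) a : \int[mu]_(x in `[a, (a + n%:R * k.+1%:R^-1)%R[) f x =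
    n%:R%:E * \int[mu]_(x in `[0%R, k.+1%:R^-1%R[) f x.
  elim: n => [|n IH].
    by rewrite mul0r addr0 set_itvco0 integral_set0 mul0e.
  rewrite (@ge0_integral_itv_split _ a (a + n%:R * k.+1%:R^-1)%R)//; last 2 first.
  - by rewrite lerDl mulr_ge0// ltW.
  - by rewrite lerD2l ler_wpM2r ?ler_nat// ltW.
  rewrite IH -(natr1 n) mulrDl mul1r (addrA a) (P _ 0%R) add0r.
  rewrite EFinD ge0_muleDl ?lee_fin// mul1e//.
have e : (- 2^-1 + k.+1%:R * k.+1%:R^-1 = 2^-1 :> R)%R.
  by rewrite divff ?pnatr_eq0//; lra.
have := many k.+1 (- 2^-1)%R; rewrite e => ->; congr (_ * _).
have -> : \int[mu]_(x in `[0%R, k.+1%:R^-1%R[) f x =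
    \int[mu]_(x in `[(- 2^-1 * k.+1%:R^-1)%R, (2^-1 * k.+1%:R^-1)%R[) f x.
  have := P 0%R (- 2^-1 * k.+1%:R^-1)%R; rewrite add0r => ->.
  have -> // : (- 2^-1 * k.+1%:R^-1 + k.+1%:R^-1 = 2^-1 * k.+1%:R^-1 :> R)%R.
  by rewrite -[X in (_ + X)%R]mul1r -mulrDl; congr (_ * _)%R; lra.
have kk : (k.+1%:R * k.+1%:R^-1 = 1 :> R)%R by rewrite divff.
have hd : (- 2^-1 + k.+1%:R * k.+1%:R^-1 = 2^-1 :> R)%R by rewrite kk; lra.
case: ck => ->.
  congr (integral _ _ _); apply/seteqP; split => x /=; rewrite in_itv/= ?hd//.
    by rewrite ler_pdivrMr// ltr_pdivlMr// mulrC.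
  by rewrite ler_pdivrMr// ltr_pdivlMr// mulrC.
rewrite integral_itvco_itvoc//.
congr (integral _ _ _); apply/seteqP; split => x /=; rewrite in_itv/= ?hd//.
  by rewrite ltr_pdivrMr// ler_pdivlMr// => /andP[h1 h2]; apply/andP; split; lra.
by rewrite ltr_pdivrMr// ler_pdivlMr// => /andP[h1 h2]; apply/andP; split; lra.
Qed.

End lebesgue_line.

Lemma ge0_integral_image_measure d1 d2 (T1 : measurableType d1)
    (T2 : measurableType d2) (R : realType) (m : {measure set T1 -> \bar R})
    (f : T1 -> T2) (mf : measurable_fun [set: T1] f) (F : T2 -> \bar R) :
  measurable_fun [set: T2] F -> (forall x, (0 <= F x)%E) ->
  (\int[image_measure m mf]_x F x = \int[m]_x F (f x))%E.
Proof.
move=> mF F0.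
have := ge0_integral_pushforward mf m measurableT mF (fun x _ => F0 x).
by rewrite preimage_setT.
Qed.

Section lebesgue_cV_tonelli.
Context {R : realType}.

Lemma measurable_fun_cV d (T : measurableType d) n (f : T -> 'cV[R]_n) :
  (forall i, measurable_fun [set: T] (fun x => f x i 0)) -> measurable_fun [set: T] f.
Proof.
move=> mf.
suff H : g_sigma_preimage (fun (i : 'I_n) (x : 'cV[R]_n) => x i 0) `<=`
    [set A | measurable (f @^-1` A)].
  by move=> _ A /H mA; rewrite setTI.
apply: smallest_sub.
  split.
  - by rewrite /= preimage_set0.
  - by move=> A /= mA; rewrite setTD; exact: measurableC.
  - by move=> F mF; rewrite /= preimage_bigcup; exact: bigcupT_measurable.
rewrite -bigcup_seq => A [i _ [B mB <-]] /=; rewrite setTI -comp_preimage.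
by rewrite -[X in measurable X]setTI; exact: mf.
Qed.

Lemma sigma_finite_lebesgue_cV n : sigma_finite [set: 'cV[R]_n] (lebesgue_cV n).
Proof.
exists (fun k : nat => box k%:R).
  apply/seteqP; split=> // x _.
  pose r := \sum_i `|x i 0|.
  exists (Num.truncn r).+1 => // i.
  have h : `|x i 0| < (Num.truncn r).+1%:R.
    apply: (@le_lt_trans _ _ r); last exact: truncnS_gt.
    by rewrite /r (bigD1 i)//= lerDl sumr_ge0.
  by move: h; rewrite ltr_norml => /andP[h1 h2]; rewrite h2 andbT ltW.
by move=> k; split; [exact: measurable_box|rewrite lebesgue_cV_box// ltry].
Qed.

(** A copy of [lebesgue_cV] that carries the sigma-finite structure on which Tonelli's theorem is
    stated. *)
Definition lebesgue_cV_sigma n : set 'cV[R]_n -> \bar R := lebesgue_cV n.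

HB.instance Definition _ (n : nat) := isMeasure.Build _ _ _ (@lebesgue_cV_sigma n)
  (measure0 (lebesgue_cV n)) (measure_ge0 (lebesgue_cV n))
  (@measure_semi_sigma_additive _ _ _ (lebesgue_cV n)).

HB.instance Definition _ (n : nat) := Measure_isSigmaFinite.Build _ _ _
  (@lebesgue_cV_sigma n) (sigma_finite_lebesgue_cV n).

Local Open Scope ereal_scope.

Lemma ge0_integral_cVS n (F : 'cV[R]_n.+1 -> \bar R) :
  measurable_fun [set: 'cV[R]_n.+1] F -> (forall x, 0 <= F x) ->
  \int[lebesgue_cV n.+1]_x F x =
  \int[@lebesgue_measure R]_a \int[lebesgue_cV n]_y F (cons_cV (a, y)).
Proof.
move=> mF F0.
rewrite [X in integral X]/= ge0_integral_image_measure//; last exact: measurable_cons_cV.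
have mFc : measurable_fun [set: R * 'cV[R]_n] (F \o @cons_cV R n).
  exact: (measurableT_comp mF (@measurable_cons_cV R n)).
have h := @fubini_tonelli1 _ _ _ _ R (@lebesgue_measure R)
  (@lebesgue_cV_sigma n) (F \o @cons_cV R n) mFc (fun x => F0 _).
(* [lebesgue_cV] is built with the product [\x^], whereas Tonelli's theorem speaks of [\x]; the two
   agree on rectangles, hence everywhere. *)
transitivity (\int[(@lebesgue_measure R \x @lebesgue_cV_sigma n)%E]_x (F \o @cons_cV R n) x).
  apply: eq_measure_integral => A mA _; apply/esym.
  apply: product_measure_unique => //.
  by move=> A1 A2 mA1 mA2; exact: product_measure2E.
rewrite [LHS]h.
apply: eq_integral => a _; rewrite /fubini_F; exact: eq_measure_integral.
Qed.
Lemma measurable_ge0_integral_cV d (T : measurableType d) n (F : T * 'cV[R]_n -> \bar R) :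
  measurable_fun [set: T * 'cV[R]_n] F -> (forall x, 0 <= F x) ->
  measurable_fun [set: T] (fun a => \int[lebesgue_cV n]_y F (a, y)).
Proof.
move=> mF F0.
have := measurable_fun_fubini_tonelli_F (m2 := @lebesgue_cV_sigma n) F mF F0.
by congr measurable_fun; apply/funext => a; exact: eq_measure_integral.
Qed.

End lebesgue_cV_tonelli.

(** * Lebesgue measure on column vectors *)

Section integral_boxes.
Context {R : realType}.
Local Open Scope ereal_scope.

Definition product_set n (I : 'I_n -> set R) : set 'cV[R]_n :=
  [set x : 'cV[R]_n | forall i, I i (x i 0%R)].

Lemma measurable_product_set n (I : 'I_n -> set R) :
  (forall i, measurable (I i)) -> measurable (product_set I).
Proof.
move=> mI; rewrite (_ : product_set I = \big[setI/setT]_(i < n)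
    ([set: 'cV[R]_n] `&` (fun x : 'cV[R]_n => x i 0%R) @^-1` I i)).
  by apply: bigsetI_measurable => i _; exact: measurable_entry.
rewrite -bigcap_seq; apply/seteqP; split=> x /= h i.
  by move=> _; split=> //; exact: h.
by have [|_ /=] := h i; [rewrite /= mem_index_enum|].
Qed.

Lemma product_set_cons n (I : 'I_n.+1 -> set R) a (y : 'cV[R]_n) :
  product_set I (cons_cV (a, y)) <->
  I ord0 a /\ product_set (fun i => I (lift ord0 i)) y.
Proof.
split=> [h|[h0 h] i].
  split; first by have := h ord0; rewrite mxE unlift_none.
  by move=> i; have := h (lift ord0 i); rewrite mxE liftK.
by rewrite mxE; case: (unliftP ord0 i) => [j ->|->].
Qed.

Definition map_cV n (sig : 'I_n -> R -> R) (x : 'cV[R]_n) : 'cV[R]_n :=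
  \col_i sig i (x i 0%R).

Lemma map_cV_cons n (sig : 'I_n.+1 -> R -> R) a (y : 'cV[R]_n) :
  map_cV sig (cons_cV (a, y)) =
  cons_cV (sig ord0 a, map_cV (fun i => sig (lift ord0 i)) y).
Proof.
apply/colP => i; rewrite !mxE /=.
by case: (unliftP ord0 i) => [j ->|->]//=; rewrite mxE.
Qed.

Lemma measurable_map_cV n (sig : 'I_n -> R -> R) :
  (forall i, measurable_fun [set: R] (sig i)) ->
  measurable_fun [set: 'cV[R]_n] (map_cV sig).
Proof.
move=> ms; apply: measurable_fun_cV => i.
rewrite (_ : (fun _ => _) = sig i \o (fun x : 'cV[R]_n => x i 0%R)).
  by apply: (measurableT_comp (ms i)); exact: measurable_entry.
by apply/funext => x /=; rewrite mxE.
Qed.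

Lemma measurable_cons_cVr n a : measurable_fun [set: 'cV[R]_n] (fun y => cons_cV (a, y)).
Proof. by apply: (measurableT_comp (@measurable_cons_cV R n)). Qed.

Lemma ge0_integral_product_setS n (I : 'I_n.+1 -> set R) (F : 'cV[R]_n.+1 -> \bar R) :
  (forall i, measurable (I i)) -> measurable_fun [set: 'cV[R]_n.+1] F ->
  (forall x, 0 <= F x) ->
  \int[lebesgue_cV n.+1]_(x in product_set I) F x =
  \int[@lebesgue_measure R]_(a in I ord0)
    \int[lebesgue_cV n]_(y in product_set (fun i => I (lift ord0 i))) F (cons_cV (a, y)).
Proof.
move=> mI mF F0; have mS := measurable_product_set mI.
rewrite integral_mkcond ge0_integral_cVS.
- rewrite [RHS]integral_mkcond; apply: eq_integral => a _.
  rewrite patchE; case: ifPn => [/set_mem Ia|/negP Ia].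
    rewrite [RHS]integral_mkcond; apply: eq_integral => y _; rewrite !patchE.
    have [/set_mem yI|yI] := boolP (y \in product_set _).
      by rewrite mem_set//; apply/product_set_cons.
    rewrite memNset// => /product_set_cons[_ h].
    by move/negP: yI; apply; rewrite inE.
  apply: integral0_eq => y _; rewrite patchE.
  rewrite memNset// => /product_set_cons[h _].
  by apply: Ia; rewrite inE.
- by apply/(measurable_restrictT F mS); exact: measurable_funS mF.
- by move=> x; apply: erestrict_ge0 => z _.
Qed.

(** A change of variable valid in each coordinate for periodic integrands passes to the product by
    induction on the dimension, Tonelli's theorem splitting off the first coordinate. It is used
    twice: for affine maps of the torus (c = P = 1), and for the tiling by small cells (identity
    maps, P = 1/|c|). *)
Lemma ge0_integral_product_set n (I J : 'I_n -> set R) (c P : 'I_n -> R)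
    (sig : 'I_n -> R -> R) :
  (forall i, measurable (I i)) -> (forall i, measurable (J i)) ->
  (forall i, 0 <= c i)%R -> (forall i, measurable_fun [set: R] (sig i)) ->
  (forall i (G : R -> \bar R), measurable_fun [set: R] G -> (forall x, 0 <= G x) ->
    (forall x, G (x + P i)%R = G x) ->
    \int[@lebesgue_measure R]_(x in I i) G (sig i x) =
    (c i)%:E * \int[@lebesgue_measure R]_(x in J i) G x) ->
  forall F : 'cV[R]_n -> \bar R, measurable_fun [set: 'cV[R]_n] F ->
  (forall x, 0 <= F x) ->
  (forall i x, F (x + P i *: delta_mx i 0%R)%R = F x) ->
  \int[lebesgue_cV n]_(x in product_set I) F (map_cV sig x) =
  (\prod_i c i)%:E * \int[lebesgue_cV n]_(x in product_set J) F x.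
Proof.
elim: n I J c P sig => [|n IH] I J c P sig mI mJ c0 ms H F mF F0 FP.
  rewrite big_ord0 mul1e.
  have e (I' : 'I_0 -> set R) : product_set I' = setT.
    by apply/seteqP; split => // x _ [].
  rewrite !e; apply: eq_integral => x _; congr F.
  by apply/colP => -[].
have mFs : measurable_fun [set: 'cV[R]_n.+1] (F \o map_cV sig).
  by apply: (measurableT_comp mF); exact: measurable_map_cV.
rewrite (ge0_integral_product_setS mI mFs)//.
rewrite [in RHS](ge0_integral_product_setS mJ mF)//.
pose G a := (\prod_(i < n) c (lift ord0 i))%:E *
  \int[lebesgue_cV n]_(y in product_set (fun i => J (lift ord0 i))) F (cons_cV (a, y)).
have mG1 : measurable_fun [set: R] (fun a => \int[lebesgue_cV n]_(y in
    product_set (fun i => J (lift ord0 i))) F (cons_cV (a, y))).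
  have mJ' := @measurable_product_set n (fun i => J (lift ord0 i)) (fun i => mJ _).
  pose F' := (fun p : R * 'cV[R]_n => (F \o @cons_cV R n) p * (\1_(setT `*` product_set (fun i => J (lift ord0 i))) p)%:E).
  rewrite (_ : (fun _ => _) = (fun a => \int[lebesgue_cV n]_y F' (a, y))); last first.
    apply/funext => a; rewrite integral_mkcond.
    apply: eq_integral => y _; rewrite /F' patchE indicE /=.
    rewrite in_setX/= in_setT/=; case: ifPn => _; rewrite ?mule1 ?mule0//.
  apply: measurable_ge0_integral_cV.
    apply: emeasurable_funM.
      exact: (measurableT_comp mF (@measurable_cons_cV R n)).
    apply/measurable_EFinP; apply: measurable_indic.
    exact: measurableX.
  by move=> p; rewrite /F' mule_ge0//= lee_fin.
have prod0 : (0 <= \prod_(i < n) c (lift ord0 i))%R by apply: prodr_ge0.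
have mG : measurable_fun [set: R] G by exact: measurable_funeM.
have G0 a : 0 <= G a by rewrite mule_ge0 ?lee_fin//; exact: integral_ge0.
have cons_shift a y : cons_cV ((a + P ord0)%R, y) =
    (cons_cV (a, y) + P ord0 *: delta_mx ord0 0%R)%R :> 'cV[R]_n.+1.
  apply/colP => i; rewrite !mxE; case: (unliftP ord0 i) => [j ->|->]/=.
    by rewrite mulr0 addr0.
  by rewrite mulr1.
have cons_shiftr a (y : 'cV[R]_n) i : cons_cV (a, y + P (lift ord0 i) *: delta_mx i 0%R)%R =
    (cons_cV (a, y) + P (lift ord0 i) *: delta_mx (lift ord0 i) 0%R)%R :> 'cV[R]_n.+1.
  apply/colP => k; rewrite !mxE; case: (unliftP ord0 k) => [j ->|->]/=.
    by rewrite !mxE (inj_eq lift_inj).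
  by rewrite mulr0 addr0.
transitivity (\int[@lebesgue_measure R]_(a in I ord0) G (sig ord0 a)).
  apply: eq_integral => a _; rewrite /G.
  under eq_integral do rewrite /= map_cV_cons.
  apply: (IH (fun i => I (lift ord0 i)) (fun i => J (lift ord0 i))
    (fun i => c (lift ord0 i)) (fun i => P (lift ord0 i)) (fun i => sig (lift ord0 i))
    _ _ _ _ _ (fun y => F (cons_cV (sig ord0 a, y)))) => //.
  - by move=> i; exact: H.
  - by apply: (measurableT_comp mF); exact: measurable_cons_cVr.
  - by move=> i x; rewrite cons_shiftr.
rewrite (H ord0)//; last first.
  by move=> a; rewrite /G; congr (_ * _); apply: eq_integral => y _; rewrite cons_shift.
rewrite big_ord_recl EFinM -muleA; congr (_ * _).
rewrite /G ge0_integralZl//.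
- exact: mJ.
- exact: measurable_funS mG1.
- by move=> a _; exact: integral_ge0.
- by move=> x; exact: F0.
Qed.

End integral_boxes.

Lemma ge0_integral_mrestr d (T : measurableType d) (R : realType)
    (m : {measure set T -> \bar R}) (D : set T) (mD : measurable D) (f : T -> \bar R) :
  measurable_fun [set: T] f -> (forall x, (0 <= f x)%E) ->
  (\int[mrestr m mD]_x f x = \int[m]_(x in D) f x)%E.
Proof.
move=> mf f0; have mDC := measurableC mD.
rewrite -(setUv D) ge0_integral_setU ?setUv//; last first.
  by apply/disj_setPS => x [].
rewrite [X in (_ + X)%E]null_set_integral//; last 2 first.
- exact: measurable_funS mf.
- by transitivity (m (~` D `&` D)) => //; rewrite setICl measure0.
rewrite adde0; apply: eq_measure_integral => A mA AD.
by transitivity (m (A `&` D)) => //; rewrite setIidl.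
Qed.

(** * Translation, reflection and tiling invariance of the torus integral *)

Section torus_invariance.
Context {R : realType} {d : nat}.
Local Open Scope ereal_scope.
Implicit Types (F : 'cV[R]_d -> \bar R).

Notation torus := (@torus_measure R d).

Lemma torus_measureT : torus setT = 1.
Proof.
rewrite /torus_measure/= /mrestr setTI lebesgue_cV_box// ?invr_ge0//.
by rewrite (_ : 2^-1 *+ 2 = 1)%R ?expr1n// mulr2n; lra.
Qed.

Lemma ge0_integral_torusE F : measurable_fun [set: 'cV[R]_d] F -> (forall x, 0 <= F x) ->
  \int[torus]_x F x =
  \int[lebesgue_cV d]_(x in product_set (fun=> `[(- 2^-1)%R, 2^-1%R[%classic)) F x.
Proof.
by move=> mF F0; rewrite /torus_measure ge0_integral_mrestr.
Qed.

Lemma intvec_delta (i : 'I_d) : intvec (delta_mx i 0%R) = delta_mx i 0%R :> 'cV[R]_d.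
Proof. by apply/colP => j; rewrite !mxE; case: (_ && _). Qed.

Lemma measurable_affine_cV (a : 'cV[R]_d) (b : R) :
  measurable_fun [set: 'cV[R]_d] (fun x : 'cV[R]_d => a + b *: x)%R.
Proof.
have -> : (fun x : 'cV[R]_d => a + b *: x)%R = map_cV (fun i t => a i 0%R + b * t)%R.
  by apply/funext => x; apply/colP => i; rewrite !mxE.
by apply: measurable_map_cV => i; exact: measurable_affine.
Qed.

Lemma ge0_integral_torus_affine F (a : 'cV[R]_d) (b : R) :
  measurable_fun [set: 'cV[R]_d] F -> (forall x, 0 <= F x) ->
  (forall k x, F (x + intvec k)%R = F x) -> (b = 1 \/ b = -1)%R ->
  \int[torus]_x F (a + b *: x)%R = \int[torus]_x F x.
Proof.
move=> mF F0 FP hb.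
have e x : (a + b *: x)%R = map_cV (fun i t => a i 0%R + b * t)%R x.
  by apply/colP => i; rewrite !mxE.
have ms i : measurable_fun [set: R] (fun t : R => a i 0%R + b * t)%R by exact: measurable_affine.
rewrite ge0_integral_torusE//; last first.
  exact: (measurableT_comp mF (measurable_affine_cV a b)).
rewrite [RHS]ge0_integral_torusE//.
under eq_integral do rewrite e.
rewrite (@ge0_integral_product_set R d _ (fun=> `[(- 2^-1)%R, 2^-1%R[%classic)
  (fun=> 1%R) (fun=> 1%R))//.
- by rewrite big1// mul1e.
- by move=> i G mG G0 GP; rewrite mul1e ge0_integral_unit_affine.
- by move=> i x; rewrite scale1r -intvec_delta FP.
Qed.

(** Turns the integral over the small cell M^(-j) T^d, which appears in the norm of L_(q, j), into
    an integral over the torus. *)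
Lemma ge0_integral_torus_tiling F (c : 'I_d -> R) :
  measurable_fun [set: 'cV[R]_d] F -> (forall x, 0 <= F x) ->
  (forall i, exists k : nat, c i = k.+1%:R \/ c i = - k.+1%:R)%R ->
  (forall i x, F (x + `|c i|^-1 *: delta_mx i 0%R)%R = F x) ->
  \int[torus]_x F x = (\prod_i `|c i|)%:E *
    \int[lebesgue_cV d]_(x in
      [set x : 'cV[R]_d | forall i, (- 2^-1 <= c i * x i 0%R < 2^-1)%R]) F x.
Proof.
move=> mF F0 hc FP; rewrite ge0_integral_torusE//.
have mJ i : measurable [set x : R | (- 2^-1 <= c i * x < 2^-1)%R].
  rewrite (_ : [set x | _] = (fun x => c i * x)%R @^-1` `[(- 2^-1)%R, 2^-1%R[%classic).
    rewrite -[X in measurable X]setTI.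
    have mc : measurable_fun [set: R] (fun x : R => c i * x)%R by exact: measurable_funM.
    by apply: mc => //; exact: measurable_itv.
  by apply/seteqP; split => x /=; rewrite in_itv.
have := @ge0_integral_product_set R d (fun=> `[(- 2^-1)%R, 2^-1%R[%classic)
  (fun i => [set x : R | (- 2^-1 <= c i * x < 2^-1)%R]) (fun i => `|c i|%R)
  (fun i => `|c i|^-1%R) (fun=> idfun) (fun=> measurable_itv _) mJ (fun i => normr_ge0 _)
  (fun i => @measurable_id _ _ _) _ F mF F0 FP.
move=> <-.
  by apply: eq_integral => x _; congr F; apply/colP => i; rewrite mxE.
by move=> i G mG G0 GP; apply: ge0_integral_tiling.
Qed.

End torus_invariance.

(** * Complex-valued functions and characters *)

Local Notation Re := complex.Re.
Local Notation Im := complex.Im.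

Section complex_parts.
Context {R : realType}.
Implicit Types (z w : R[i]).

Lemma complex_ReM z w : Re (z * w) = Re z * Re w - Im z * Im w.
Proof. by case: z w => [a b] [c e]. Qed.

Lemma complex_ImM z w : Im (z * w) = Re z * Im w + Im z * Re w.
Proof. by case: z w => [a b] [c e]. Qed.

Lemma complex_ReD z w : Re (z + w) = Re z + Re w.
Proof. by case: z w => [a b] [c e]. Qed.

Lemma complex_ImD z w : Im (z + w) = Im z + Im w.
Proof. by case: z w => [a b] [c e]. Qed.

Lemma complex_ReN z : Re (- z) = - Re z.
Proof. by case: z. Qed.

Lemma complex_ImN z : Im (- z) = - Im z.
Proof. by case: z. Qed.

Lemma normc_ge0 z : 0 <= normc z.
Proof. by case: z => a b; exact: sqrtr_ge0. Qed.

Lemma normc_Re z : `|Re z| <= normc z.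
Proof.
case: z => a b /=; rewrite -sqrtr_sqr ler_wsqrtr// lerDl sqr_ge0//.
Qed.

Lemma normc_Im z : `|Im z| <= normc z.
Proof.
case: z => a b /=; rewrite -sqrtr_sqr ler_wsqrtr// lerDr sqr_ge0//.
Qed.

Lemma normc_le_ReIm z : normc z <= `|Re z| + `|Im z|.
Proof.
case: z => a b /=; rewrite -(@ler_pXn2r _ 2)// ?nnegrE ?sqrtr_ge0 ?addr_ge0//.
rewrite sqr_sqrtr ?addr_ge0 ?sqr_ge0// sqrrD !real_normK ?num_real//.
by rewrite addrAC lerDl mulrn_wge0// mulr_ge0.
Qed.

Lemma normcE2 z : normc z ^+ 2 = Re z ^+ 2 + Im z ^+ 2.
Proof. by case: z => a b /=; rewrite sqr_sqrtr ?addr_ge0 ?sqr_ge0. Qed.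

Lemma normc_real (a : R) : normc (a%:C)%C = `|a|.
Proof. by rewrite /= expr0n addr0 sqrtr_sqr. Qed.

Lemma normcJ' z : normc (conjc z) = normc z.
Proof. by case: z => a b /=; rewrite sqrrN. Qed.

Lemma normc_sum (I : Type) (r : seq I) (P : pred I) (F : I -> R[i]) :
  normc (\sum_(i <- r | P i) F i) <= \sum_(i <- r | P i) normc (F i).
Proof.
elim/big_ind2: _ => [|x a y b xa yb|//]; first by rewrite normc0.
by rewrite (le_trans (le_normcD _ _))// lerD.
Qed.

End complex_parts.

Section complex_measurable.
Context d (T : measurableType d) {R : realType}.
Implicit Types (f g : T -> R[i]).

Definition measurable_cfun f := measurable_fun [set: T] (fun x => Re (f x)) /\
  measurable_fun [set: T] (fun x => Im (f x)).

Lemma measurable_cfunD f g : measurable_cfun f -> measurable_cfun g ->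
  measurable_cfun (fun x => f x + g x).
Proof.
move=> [f1 f2] [g1 g2]; split.
  under eq_fun do rewrite complex_ReD; exact: measurable_funD.
under eq_fun do rewrite complex_ImD; exact: measurable_funD.
Qed.

Lemma measurable_cfunM f g : measurable_cfun f -> measurable_cfun g ->
  measurable_cfun (fun x => f x * g x).
Proof.
move=> [f1 f2] [g1 g2]; split.
  under eq_fun do rewrite complex_ReM.
  by apply: measurable_funB; exact: measurable_funM.
under eq_fun do rewrite complex_ImM.
by apply: measurable_funD; exact: measurable_funM.
Qed.

Lemma measurable_cfun_cst (c : R[i]) : measurable_cfun (fun=> c).
Proof. by split; exact: measurable_cst. Qed.

Lemma measurable_cfunB f g : measurable_cfun f -> measurable_cfun g ->
  measurable_cfun (fun x => f x - g x).
Proof.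
move=> mf mg; under eq_fun do rewrite -mulN1r.
by apply: measurable_cfunD => //; exact: (measurable_cfunM (measurable_cfun_cst _)).
Qed.

Lemma measurable_cfun_sum (I : Type) (r : seq I) (F : I -> T -> R[i]) :
  (forall i, measurable_cfun (F i)) -> measurable_cfun (fun x => \sum_(i <- r) F i x).
Proof.
move=> mF; elim: r => [|i r IH].
  under eq_fun do rewrite big_nil; exact: measurable_cfun_cst.
by under eq_fun do rewrite big_cons; exact: measurable_cfunD.
Qed.

Lemma measurable_conjc f : measurable_cfun f -> measurable_cfun (fun x => conjc (f x)).
Proof.
move=> [f1 f2]; split.
  by apply: eq_measurable_fun f1 => x _; case: (f x).
by apply: eq_measurable_fun (measurable_funN f2) => x _ /=; case: (f x).
Qed.

Lemma measurable_normc f : measurable_cfun f -> measurable_fun [set: T] (fun x => normc (f x)).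
Proof.
move=> [f1 f2].
rewrite (_ : (fun _ => _) = @Num.sqrt R \o (fun x => Re (f x) ^+ 2 + Im (f x) ^+ 2)).
  apply: measurableT_comp.
    by apply: continuous_measurable_fun; exact: sqrt_continuous.
  by apply: measurable_funD; exact: measurable_funX.
by apply/funext => x /=; case: (f x).
Qed.

Lemma measurable_EFin_normc f : measurable_cfun f ->
  measurable_fun [set: T] (fun x => (normc (f x))%:E).
Proof. by move=> mf; apply/measurable_EFinP; exact: measurable_normc. Qed.

End complex_measurable.

(** * Integrals of complex-valued functions on the torus *)

Section complex_integral.
Context {R : realType} {d : nat}.
Notation torus := (@torus_measure R d).
Implicit Types (f g : 'cV[R]_d -> R[i]).

Definition cintegrable f := torus.-integrable setT (fun x => (Re (f x))%:E) /\
  torus.-integrable setT (fun x => (Im (f x))%:E).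

Lemma cintegrableP f : cmeasurable f ->
  (\int[torus]_x (normc (f x))%:E < +oo)%E -> cintegrable f.
Proof.
move=> [f1 f2] fi; have mn := measurable_EFin_normc (conj f1 f2).
have ni : torus.-integrable setT (fun x => (normc (f x))%:E).
  apply/integrableP; split => //; under eq_integral do rewrite gee0_abs ?lee_fin ?normc_ge0//.
  exact: fi.
split; apply: le_integrable ni => //.
- exact/measurable_EFinP.
- by move=> x _; rewrite /= lee_fin (ger0_norm (normc_ge0 _)) normc_Re.
- exact/measurable_EFinP.
- by move=> x _; rewrite /= lee_fin (ger0_norm (normc_ge0 _)) normc_Im.
Qed.

Lemma cintegrableZD (a : R[i]) f g : cintegrable f -> cintegrable g ->
  cintegrable (fun x => a * f x + g x).
Proof.
move=> [f1 f2] [g1 g2]; split.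
- under eq_fun do rewrite complex_ReD complex_ReM EFinD EFinB !EFinM.
  apply: (integrableD measurableT) => //.
  by apply: (integrableB measurableT); exact: integrableZl.
- under eq_fun do rewrite complex_ImD complex_ImM EFinD EFinD !EFinM.
  apply: (integrableD measurableT) => //.
  by apply: (integrableD measurableT); exact: integrableZl.
Qed.

Lemma cintegralZD (a : R[i]) f g : cintegrable f -> cintegrable g ->
  cintegral (fun x => a * f x + g x) = a * cintegral f + cintegral g.
Proof.
move=> [f1 f2] [g1 g2].
have Zi (b : R) (u : 'cV[R]_d -> R) : torus.-integrable setT (EFin \o u) ->
    torus.-integrable setT (EFin \o (fun x => b * u x)).
  by move=> iu; rewrite /comp; under eq_fun do rewrite EFinM; exact: integrableZl.
have Di (u w : 'cV[R]_d -> R) : torus.-integrable setT (EFin \o u) ->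
    torus.-integrable setT (EFin \o w) -> torus.-integrable setT (EFin \o (fun x => u x + w x)).
  by move=> iu iw; rewrite /comp; under eq_fun do rewrite EFinD; exact: integrableD.
have Bi (u w : 'cV[R]_d -> R) : torus.-integrable setT (EFin \o u) ->
    torus.-integrable setT (EFin \o w) -> torus.-integrable setT (EFin \o (fun x => u x - w x)).
  by move=> iu iw; rewrite /comp; under eq_fun do rewrite EFinB; exact: integrableB.
apply/eqP; rewrite eq_complex; apply/andP; split; apply/eqP.
  rewrite complex_ReD complex_ReM /=.
  under eq_Rintegral do rewrite complex_ReD complex_ReM.
  rewrite RintegralD//; last by apply: Bi; exact: Zi.
  by rewrite RintegralB ?RintegralZl//; exact: Zi.
rewrite complex_ImD complex_ImM /=.
under eq_Rintegral do rewrite complex_ImD complex_ImM.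
rewrite RintegralD//; last by apply: Di; exact: Zi.
by rewrite RintegralD ?RintegralZl//; exact: Zi.
Qed.

Lemma cintegrable0 : cintegrable (fun=> 0).
Proof. by split; exact: integrable0. Qed.

Lemma cintegral0 : @cintegral R d (fun=> 0) = 0.
Proof. by rewrite /cintegral /= !Rintegral_cst// !mul0r. Qed.

Lemma cintegrableZ (a : R[i]) f : cintegrable f -> cintegrable (fun x => a * f x).
Proof.
move=> fi; have := cintegrableZD a fi cintegrable0.
by under eq_fun do rewrite addr0.
Qed.

Lemma cintegralZ (a : R[i]) f : cintegrable f ->
  cintegral (fun x => a * f x) = a * cintegral f.
Proof.
move=> fi; have := cintegralZD a fi cintegrable0.
by under eq_fun do rewrite addr0; rewrite cintegral0 addr0.
Qed.

Lemma cintegrableD f g : cintegrable f -> cintegrable g -> cintegrable (fun x => f x + g x).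
Proof.
move=> fi gi; have := cintegrableZD 1 fi gi.
by under eq_fun do rewrite mul1r.
Qed.

Lemma cintegralD f g : cintegrable f -> cintegrable g ->
  cintegral (fun x => f x + g x) = cintegral f + cintegral g.
Proof.
move=> fi gi; have := cintegralZD 1 fi gi.
by under eq_fun do rewrite mul1r; rewrite mul1r.
Qed.

Lemma cintegralB f g : cintegrable f -> cintegrable g ->
  cintegral (fun x => f x - g x) = cintegral f - cintegral g.
Proof.
move=> fi gi; have := cintegralZD (-1) gi fi.
by under eq_fun do rewrite mulN1r addrC; rewrite mulN1r addrC.
Qed.

Lemma cintegrable_sum (I : Type) (r : seq I) (F : I -> 'cV[R]_d -> R[i]) :
  (forall i, cintegrable (F i)) -> cintegrable (fun x => \sum_(i <- r) F i x).
Proof.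
move=> Fi; elim: r => [|i r IH].
  by under eq_fun do rewrite big_nil; exact: cintegrable0.
by under eq_fun do rewrite big_cons; exact: cintegrableD.
Qed.

Lemma cintegral_sum (I : Type) (r : seq I) (F : I -> 'cV[R]_d -> R[i]) :
  (forall i, cintegrable (F i)) ->
  cintegral (fun x => \sum_(i <- r) F i x) = \sum_(i <- r) cintegral (F i).
Proof.
move=> Fi; elim: r => [|i r IH].
  by under eq_fun do rewrite big_nil; rewrite cintegral0 big_nil.
under eq_fun do rewrite big_cons.
by rewrite cintegralD// ?IH ?big_cons//; exact: cintegrable_sum.
Qed.

(** Real and imaginary parts are each bounded by the integral of the modulus; this is the origin of
    the factors 2 in the operator bounds below. *)
Lemma normc_cintegral_le f : cmeasurable f ->
  ((normc (cintegral f))%:E <= 2%:E * \int[torus]_x (normc (f x))%:E)%E.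
Proof.
move=> mf; have mn := measurable_EFin_normc mf.
have [fi|] := ltP (\int[torus]_x (normc (f x))%:E)%E +oo%E; last first.
  by rewrite leye_eq => /eqP ->; rewrite gt0_muley ?lte_fin// leey.
have [i1 i2] := cintegrableP mf fi.
have part (u : 'cV[R]_d -> R) : (forall x, `|u x| <= normc (f x)) ->
    torus.-integrable setT (fun x => (u x)%:E) ->
    ((`|\int[torus]_x u x|)%:E <= \int[torus]_x (normc (f x))%:E)%E.
  move=> uf iu; rewrite EFin_normr_Rintegral//.
  have mu := measurable_int _ iu.
  apply: (le_trans (le_abse_integral _ measurableT mu)).
  apply: ge0_le_integral => //.
  - exact: measurableT_comp.
  - by move=> x _; rewrite /= lee_fin.
apply: (@le_trans _ _ ((`|Re (cintegral f)| + `|Im (cintegral f)|)%:E)).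
  by rewrite lee_fin normc_le_ReIm.
rewrite mule_natl mule2n EFinD leeD//; apply: part => //= x.
  exact: normc_Re.
exact: normc_Im.
Qed.

Lemma eq_cintegral f g : f =1 g -> cintegral f = cintegral g.
Proof. by move=> fg; congr cintegral; exact/funext. Qed.

Lemma cintegral_affine f (a : 'cV[R]_d) (b : R) : cmeasurable f -> Defs.periodic f ->
  b = 1 \/ b = -1 -> cintegral (fun x => f (a + b *: x)) = cintegral f.
Proof.
move=> [f1 f2] pf hb.
have aux (u : 'cV[R]_d -> R) : measurable_fun setT u ->
    (forall k x, u (x + intvec k) = u x) ->
    \int[torus]_x u (a + b *: x) = \int[torus]_x u x.
  (* No integrability is assumed: the integrals of the positive and negative parts are invariant
     separately, even when they are infinite. *)
  move=> mu pu; rewrite /Rintegral integralE [in RHS]integralE.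
  have mE : measurable_fun setT (EFin \o u) by exact/measurable_EFinP.
  have e1 x : (fun x => (u (a + b *: x))%:E)^\+%E x = (EFin \o u)^\+%E (a + b *: x).
    by rewrite !funeposE.
  have e2 x : (fun x => (u (a + b *: x))%:E)^\-%E x = (EFin \o u)^\-%E (a + b *: x).
    by rewrite !funenegE.
  under eq_integral do rewrite e1.
  under [in X in (_ - X)%E]eq_integral do rewrite e2.
  rewrite !ge0_integral_torus_affine//.
  - exact: measurable_funeneg.
  - by move=> k x; rewrite !funenegE /= pu.
  - exact: measurable_funepos.
  - by move=> k x; rewrite !funeposE /= pu.
rewrite /cintegral (aux (fun x => Re (f x)) f1) ?(aux (fun x => Im (f x)) f2)//.
  by move=> k x; rewrite pf.
by move=> k x; rewrite pf.
Qed.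

End complex_integral.

Lemma continuous_sumr (R : realType) (T : topologicalType) (I : Type) (r : seq I)
    (F : I -> T -> R) :
  (forall i, continuous (F i)) -> continuous (fun x => \sum_(i <- r) F i x).
Proof.
move=> cF; elim: r => [|i r IH].
  by under eq_fun do rewrite big_nil; move=> x; exact: cvg_cst.
under eq_fun do rewrite big_cons.
by move=> x; apply: cvgD; [exact: cF|exact: IH].
Qed.

(** * Characters and their orthogonality *)

Section characters.
Context {R : realType} {d : nat}.
Notation torus := (@torus_measure R d).
Implicit Types (k l : 'cV[int]_d) (x y : 'cV[R]_d).

Definition dotz k x : R := \sum_i (k i 0)%:~R * x i 0.

Lemma characterE k x : character k x =
  complex.Complex (cos (2 * pi * dotz k x)) (sin (2 * pi * dotz k x)).
Proof. by []. Qed.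

Lemma complex_cos_sinD (a b : R) : complex.Complex (cos (a + b)) (sin (a + b)) =
  complex.Complex (cos a) (sin a) * complex.Complex (cos b) (sin b).
Proof.
apply/eqP; rewrite eq_complex /= cosD sinD eqxx /=; apply/eqP.
by rewrite addrC [X in X + _]mulrC [X in _ + X]mulrC [RHS]addrC addrC mulrC [X in _ + X]mulrC.
Qed.

Lemma characterDr k x y : character k (x + y) = character k x * character k y.
Proof.
rewrite !characterE -complex_cos_sinD -mulrDr; congr (complex.Complex (cos (_ * _)) (sin (_ * _)));
  rewrite /dotz -big_split/=; apply: eq_bigr => i _; by rewrite mxE mulrDr.
Qed.

Lemma characterDl k l x : character (k + l) x = character k x * character l x.
Proof.
rewrite !characterE -complex_cos_sinD -mulrDr; congr (complex.Complex (cos (_ * _)) (sin (_ * _)));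
  rewrite /dotz -big_split/=; apply: eq_bigr => i _; by rewrite mxE intrD mulrDl.
Qed.

Lemma character0l x : character 0 x = 1.
Proof.
rewrite characterE (_ : dotz 0 x = 0) ?mulr0 ?cos0 ?sin0//.
by rewrite /dotz big1// => i _; rewrite mxE mul0r.
Qed.

Lemma dotzN k x : dotz (- k) x = - dotz k x.
Proof. by rewrite /dotz -sumrN; apply: eq_bigr => i _; rewrite mxE intrN mulNr. Qed.

Lemma characterNr k x : character k (- x) = character (- k) x.
Proof.
rewrite !characterE (_ : dotz k (- x) = dotz (- k) x)// dotzN /dotz -sumrN.
by apply: eq_bigr => i _; rewrite mxE mulrN.
Qed.

Lemma characterNl k x : character (- k) x = conjc (character k x).
Proof. by rewrite !characterE dotzN mulrN cosN sinN. Qed.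

Lemma normc_character k x : normc (character k x) = 1.
Proof. by rewrite /= cos2Dsin2 sqrtr1. Qed.

Lemma cos_sin_2pi_int (n : int) : cos (2 * pi * n%:~R) = 1 :> R /\ sin (2 * pi * n%:~R) = 0 :> R.
Proof.
have nat (m : nat) : cos (2 * pi * m%:R) = 1 :> R /\ sin (2 * pi * m%:R) = 0 :> R.
  elim: m => [|m [IH1 IH2]]; first by rewrite mulr0 cos0 sin0.
  have e : 2 * pi = pi *+ 2 :> R by rewrite mulr_natl.
  rewrite -(natr1 m) mulrDr mulr1 cosD sinD IH1 IH2 e cos2pi sin2pi.
  by rewrite !(mul1r, mul0r, mulr0, addr0, subr0).
case: n => n; first exact: nat.
by rewrite NegzE rmorphN/= mulrN cosN sinN; have [-> ->] := nat n.+1; rewrite oppr0.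
Qed.

Lemma character_intvec k l : character k (intvec l : 'cV[R]_d) = 1.
Proof.
have e : dotz k (intvec l) = (\sum_i k i 0 * l i 0)%:~R.
  rewrite /dotz (big_morph _ (fun a b : int => intrD R a b) (mulr0z 1)).
  by apply: eq_bigr => i _; rewrite mxE intrM.
rewrite characterE e.
by have [-> ->] := cos_sin_2pi_int (\sum_i k i 0 * l i 0).
Qed.

Lemma periodic_character k : Defs.periodic (@character R d k).
Proof. by move=> l x; rewrite characterDr character_intvec mulr1. Qed.

Lemma measurable_dotz k : measurable_fun [set: 'cV[R]_d] (dotz k).
Proof.
apply: measurable_sum => i; apply: measurable_funM => //.
exact: measurable_entry.
Qed.

Lemma cmeasurable_character k : cmeasurable (@character R d k).
Proof.
have m : measurable_fun [set: 'cV[R]_d] (fun x => 2 * pi * dotz k x).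
  by apply: measurable_funM => //; exact: measurable_dotz.
split.
  rewrite (_ : (fun _ => _) = cos \o (fun x => 2 * pi * dotz k x))//.
  apply: measurableT_comp => //.
  by apply: continuous_measurable_fun; exact: continuous_cos.
rewrite (_ : (fun _ => _) = sin \o (fun x => 2 * pi * dotz k x))//.
apply: measurableT_comp => //.
by apply: continuous_measurable_fun; exact: continuous_sin.
Qed.

Lemma continuous_entry (i : 'I_d) : continuous (fun x : 'cV[R]_d => x i 0).
Proof. exact: coord_continuous. Qed.

Lemma continuous_dotz k : continuous (dotz k).
Proof.
apply: continuous_sumr => i x.
apply: (@continuousM R _ (fun=> (k i 0)%:~R) (fun x : 'cV[R]_d => x i 0)).
  exact: cst_continuous.
exact: continuous_entry.
Qed.

Lemma ccontinuous_character k : ccontinuous (@character R d k).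
Proof.
have m : continuous (fun x => 2 * pi * dotz k x).
  move=> x; apply: (@continuousM R _ (fun=> 2 * pi) (dotz k)).
    exact: cst_continuous.
  exact: continuous_dotz.
split=> x; apply: continuous_comp (m x) _.
  exact: (@continuous_cos R).
exact: (@continuous_sin R).
Qed.

Definition L1 f := @cmeasurable R d f /\
  (\int[torus]_x (normc (f x))%:E < +oo)%E.

Lemma L1_cintegrable f : L1 f -> cintegrable f.
Proof. by move=> [mf fi]; exact: cintegrableP. Qed.

Lemma L1_bounded f (B : R) : cmeasurable f -> (forall x, normc (f x) <= B) -> L1 f.
Proof.
move=> mf fB; split => //; apply: (@le_lt_trans _ _ (\int[torus]_x (B%:E))%E).
  apply: ge0_le_integral => //.
  - by move=> x _; rewrite lee_fin normc_ge0.
  - exact: measurable_EFin_normc.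
  - by move=> x _; rewrite lee_fin.
by rewrite integral_cst// [X in (_ * X)%E]torus_measureT mule1 ltry.
Qed.

Lemma L1Mbounded f g (B : R) : L1 f -> cmeasurable g -> (forall x, normc (g x) <= B) ->
  L1 (fun x => g x * f x).
Proof.
move=> [mf fi] mg gB; split; first exact: measurable_cfunM.
have B0 : 0 <= B by rewrite (le_trans (normc_ge0 (g 0))).
apply: (@le_lt_trans _ _ (\int[torus]_x (B%:E * (normc (f x))%:E))%E).
  apply: ge0_le_integral => //.
  - by move=> x _; rewrite lee_fin normc_ge0.
  - by apply: measurable_EFin_normc; exact: measurable_cfunM.
  - by apply: measurable_funeM; exact: measurable_EFin_normc.
  - by move=> x _; rewrite -EFinM lee_fin normcM ler_wpM2r ?normc_ge0.
rewrite ge0_integralZl_EFin//; last exact: measurable_EFin_normc.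
  by rewrite lte_mul_pinfty.
by move=> x _; rewrite lee_fin normc_ge0.
Qed.

Lemma L1_character k : L1 (character k).
Proof.
apply: (@L1_bounded _ 1); first exact: cmeasurable_character.
by move=> x; rewrite normc_character.
Qed.

Lemma L1Mcharacter k f : L1 f -> L1 (fun x => character k x * f x).
Proof.
move=> Lf; apply: (@L1Mbounded _ _ 1) => //; first exact: cmeasurable_character.
by move=> x; rewrite normc_character.
Qed.

Lemma cintegral_character k : cintegral (@character R d k) = (k == 0)%:R.
Proof.
have [->|k0] := eqVneq k 0.
  under eq_cintegral do rewrite character0l.
  rewrite /cintegral /= !Rintegral_cst// [X in fine X]torus_measureT /= mul1r mul0r.
  by [].
have /existsP[i ki] : [exists i, k i 0 != 0].
  apply: contra_neqT k0; rewrite negb_exists => /forallP h.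
  by apply/colP => i; rewrite mxE; have := h i; rewrite negbK => /eqP.
(* Half a wavelength in a direction in which k is nonzero. Translating by it changes the sign of the
   character, so the integral is equal to its own opposite. *)
pose a : 'cV[R]_d := (2 * (k i 0)%:~R)^-1 *: delta_mx i 0.
have ca : character k a = -1.
  have e : 2 * pi * dotz k a = pi.
    rewrite /dotz (bigD1 i)//= big1 ?addr0.
      rewrite /a !mxE !eqxx mulr1.
      have k0' : (k i 0)%:~R != 0 :> R by rewrite intr_eq0.
      by field.
    by move=> j ji; rewrite /a !mxE (negbTE ji) !mulr0.
  by rewrite characterE e cospi sinpi; apply/eqP; rewrite eq_complex /= oppr0 !eqxx.
have := cintegral_affine a (cmeasurable_character k) (@periodic_character k) (or_introl erefl).
under eq_cintegral do rewrite scale1r characterDr ca.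
rewrite cintegralZ; last exact/L1_cintegrable/L1_character.
move=> h; apply/eqP; rewrite -[_ == _]/(_ == 0).
have : cintegral (@character R d k) *+ 2 = 0 by rewrite mulr2n -{1}h mulN1r addNr.
by move/eqP; rewrite mulrn_eq0.
Qed.

End characters.

(** * Trigonometric polynomials *)

Section trigonometric_polynomials.
Context {R : realType} {d : nat}.
Notation torus := (@torus_measure R d).
Implicit Types (k l : 'cV[int]_d) (x y : 'cV[R]_d) (f g : 'cV[R]_d -> R[i]).

(** Trigonometric polynomials without a prescribed spectrum. As the list has no repetition, c is the
    family of Fourier coefficients on s. *)
Definition tpoly f := exists s : seq 'cV[int]_d, exists c : 'cV[int]_d -> R[i],
  uniq s /\ forall x, f x = \sum_(k <- s) c k * character k x.

Lemma eq_tpoly f g : f =1 g -> tpoly f -> tpoly g.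
Proof. by move=> /funext ->. Qed.

Lemma tpoly_widen (s t : seq 'cV[int]_d) (c : 'cV[int]_d -> R[i]) x :
  uniq s -> uniq t -> {subset s <= t} ->
  \sum_(k <- s) c k * character k x =
  \sum_(k <- t) (if k \in s then c k else 0) * character k x.
Proof.
move=> us ut st.
rewrite [RHS](bigID (mem s)) /= [X in _ + X]big1 ?addr0; last first.
  by move=> k /negbTE ->; rewrite mul0r.
under [RHS]eq_bigr => k ks do rewrite ks.
rewrite -[RHS]big_filter; apply: perm_big; apply: uniq_perm => //.
  exact: filter_uniq.
move=> k; rewrite mem_filter; apply/idP/andP => [ks|[]//].
by split => //; exact: st.
Qed.

Lemma tpolyZ (a : R[i]) f : tpoly f -> tpoly (fun x => a * f x).
Proof.
move=> [s [c [us fE]]]; exists s, (fun k => a * c k); split => // x.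
by rewrite fE mulr_sumr; apply: eq_bigr => k _; rewrite mulrA.
Qed.

Lemma tpolyD f g : tpoly f -> tpoly g -> tpoly (fun x => f x + g x).
Proof.
move=> [s [c [us fE]]] [t [e [ut gE]]].
exists (undup (s ++ t)).
exists (fun k => (if k \in s then c k else 0) + (if k \in t then e k else 0)).
split; first exact: undup_uniq.
move=> x; rewrite fE gE.
rewrite (@tpoly_widen s (undup (s ++ t)))// ?undup_uniq//; last first.
  by move=> k ks; rewrite mem_undup mem_cat ks.
rewrite (@tpoly_widen t (undup (s ++ t)))// ?undup_uniq//; last first.
  by move=> k kt; rewrite mem_undup mem_cat kt orbT.
by rewrite -big_split; apply: eq_bigr => k _; rewrite mulrDl.
Qed.

Lemma tpolyB f g : tpoly f -> tpoly g -> tpoly (fun x => f x - g x).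
Proof.
move=> tf tg; apply: (eq_tpoly _ (tpolyD tf (tpolyZ (-1) tg))) => x.
by rewrite mulN1r.
Qed.

Lemma tpoly0 : tpoly (fun=> 0).
Proof. by exists [::], (fun=> 0); split => // x; rewrite big_nil. Qed.

Lemma tpoly_character k : tpoly (character k).
Proof.
by exists [:: k], (fun=> 1); split => // x; rewrite big_seq1 mul1r.
Qed.

Lemma tpoly_sum (I : Type) (r : seq I) (F : I -> 'cV[R]_d -> R[i]) :
  (forall i, tpoly (F i)) -> tpoly (fun x => \sum_(i <- r) F i x).
Proof.
move=> tF; elim: r => [|i r IH].
  by under eq_fun do rewrite big_nil; exact: tpoly0.
by under eq_fun do rewrite big_cons; exact: tpolyD.
Qed.

Lemma tpoly_sumZ (I : Type) (r : seq I) (c : I -> R[i]) (F : I -> 'cV[R]_d -> R[i]) :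
  (forall i, tpoly (F i)) -> tpoly (fun x => \sum_(i <- r) c i * F i x).
Proof. by move=> tF; apply: tpoly_sum => i; exact: tpolyZ. Qed.

Lemma tpoly_shift f a : tpoly f -> tpoly (fun x => f (x - a)).
Proof.
move=> [s [c [us fE]]]; exists s, (fun k => c k * character k (- a)); split => // x.
by rewrite fE; apply: eq_bigr => k _; rewrite characterDr -mulrA [X in _ * X]mulrC.
Qed.

Lemma cmeasurable_tpoly f : tpoly f -> cmeasurable f.
Proof.
move=> [s [c [us fE]]]; have -> : f = fun x => \sum_(k <- s) c k * character k x.
  exact/funext.
apply: measurable_cfun_sum => k; apply: measurable_cfunM.
  exact: measurable_cfun_cst.
exact: cmeasurable_character.
Qed.

Lemma periodic_tpoly f : tpoly f -> Defs.periodic f.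
Proof.
move=> [s [c [us fE]]] l x; rewrite !fE; apply: eq_bigr => k _.
by rewrite periodic_character.
Qed.

Lemma ccontinuous_tpoly f : tpoly f -> ccontinuous f.
Proof.
move=> [s [c [us fE]]]; have -> : f = fun x => \sum_(k <- s) c k * character k x.
  exact/funext.
split.
  have -> : (fun x => Re (\sum_(k <- s) c k * character k x)) = (fun x =>
      \sum_(k <- s) (Re (c k) * Re (character k x) - Im (c k) * Im (character k x))).
    apply/funext => x; rewrite (big_morph _ (@complex_ReD R) (erefl : Re 0 = 0)).
    by apply: eq_bigr => k _; rewrite complex_ReM.
  apply: continuous_sumr => k x; have [h1 h2] : ccontinuous (@character R d k) by exact: ccontinuous_character.
  apply: (@continuousB R _ _ (fun x => Re (c k) * Re (character k x))
    (fun x => Im (c k) * Im (character k x))).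
    by exact: (continuousM (@cst_continuous _ _ (Re (c k)) x) (h1 x)).
  by exact: (continuousM (@cst_continuous _ _ (Im (c k)) x) (h2 x)).
have -> : (fun x => Im (\sum_(k <- s) c k * character k x)) = (fun x =>
    \sum_(k <- s) (Re (c k) * Im (character k x) + Im (c k) * Re (character k x))).
  apply/funext => x; rewrite (big_morph _ (@complex_ImD R) (erefl : Im 0 = 0)).
  by apply: eq_bigr => k _; rewrite complex_ImM.
apply: continuous_sumr => k x; have [h1 h2] : ccontinuous (@character R d k) by exact: ccontinuous_character.
apply: (@continuousD R _ _ (fun x => Re (c k) * Im (character k x))
  (fun x => Im (c k) * Re (character k x))).
  by exact: (continuousM (@cst_continuous _ _ (Re (c k)) x) (h2 x)).
by exact: (continuousM (@cst_continuous _ _ (Im (c k)) x) (h1 x)).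
Qed.

Lemma tpoly_bounded f : tpoly f -> exists2 B, 0 <= B & forall x, normc (f x) <= B.
Proof.
move=> [s [c [us fE]]]; exists (\sum_(k <- s) normc (c k)).
  by apply: sumr_ge0 => k _; exact: normc_ge0.
move=> x; rewrite fE (le_trans (normc_sum _ _ _))// ler_sum// => k _.
by rewrite normcM normc_character mulr1.
Qed.

Lemma L1_tpoly f : tpoly f -> L1 f.
Proof.
move=> tf; have [B _ fB] := tpoly_bounded tf.
by apply: (L1_bounded _ fB); exact: cmeasurable_tpoly.
Qed.

Lemma L1D f g : L1 f -> L1 g -> L1 (fun x => f x + g x).
Proof.
move=> [mf fi] [mg gi]; split; first exact: measurable_cfunD.
apply: (@le_lt_trans _ _ (\int[torus]_x ((normc (f x))%:E + (normc (g x))%:E))%E).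
  apply: ge0_le_integral => //.
  - by move=> x _; rewrite lee_fin normc_ge0.
  - by apply: measurable_EFin_normc; exact: measurable_cfunD.
  - by apply: emeasurable_funD; exact: measurable_EFin_normc.
  - by move=> x _; rewrite -EFinD lee_fin le_normcD.
rewrite ge0_integralD//; do ?[exact: lte_add_pinfty | exact: measurable_EFin_normc
  | by move=> x _; rewrite lee_fin normc_ge0].
Qed.

Lemma L1Z (a : R[i]) f : L1 f -> L1 (fun x => a * f x).
Proof.
by move=> Lf; apply: (@L1Mbounded _ _ _ _ (normc a) Lf).
Qed.

Lemma L1B f g : L1 f -> L1 g -> L1 (fun x => f x - g x).
Proof.
move=> Lf Lg; have := L1D Lf (L1Z (-1) Lg).
by under eq_fun do rewrite mulN1r.
Qed.

Lemma L1_fourier f k : L1 f -> cintegrable (fun x => f x * character (- k) x).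
Proof.
move=> Lf; apply: L1_cintegrable.
under eq_fun do rewrite mulrC; exact: L1Mcharacter.
Qed.

Lemma fourierZ (a : R[i]) f k : L1 f -> fourier (fun x => a * f x) k = a * fourier f k.
Proof.
move=> Lf; rewrite /fourier -cintegralZ; last exact: L1_fourier.
by apply: eq_cintegral => x; rewrite mulrA.
Qed.

Lemma fourierB f g k : L1 f -> L1 g ->
  fourier (fun x => f x - g x) k = fourier f k - fourier g k.
Proof.
move=> Lf Lg; rewrite /fourier -cintegralB; [|exact: L1_fourier..].
by apply: eq_cintegral => x; rewrite mulrBl.
Qed.

Lemma fourier_character k l : fourier (@character R d k) l = (k == l)%:R.
Proof.
rewrite /fourier; under eq_cintegral do rewrite -characterDl.
by rewrite cintegral_character subr_eq0.
Qed.

Lemma fourier_sum (I : Type) (r : seq I) (F : I -> 'cV[R]_d -> R[i]) k :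
  (forall i, L1 (F i)) ->
  fourier (fun x => \sum_(i <- r) F i x) k = \sum_(i <- r) fourier (F i) k.
Proof.
move=> LF; rewrite /fourier -cintegral_sum; last by move=> i; exact: L1_fourier.
by apply: eq_cintegral => x; rewrite mulr_suml.
Qed.

Lemma fourier_sum_character (I : Type) (r : seq I) (c : I -> R[i]) (n : I -> 'cV[int]_d) k :
  fourier (fun x => \sum_(i <- r) c i * character (n i) x) k =
  \sum_(i <- r) c i * (n i == k)%:R.
Proof.
rewrite fourier_sum => [|i]; last by apply: L1Z; exact: L1_character.
apply: eq_bigr => i _; rewrite fourierZ; last exact: L1_character.
by rewrite fourier_character.
Qed.

Lemma sum_eq_uniq (s : seq 'cV[int]_d) (c : 'cV[int]_d -> R[i]) k : uniq s ->
  \sum_(l <- s) c l * (l == k)%:R = if k \in s then c k else 0.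
Proof.
move=> us; case: ifPn => ks.
  rewrite (bigD1_seq k)//= eqxx mulr1 big1 ?addr0// => l /negbTE ->.
  by rewrite mulr0.
rewrite big_seq big1// => l ls; have [lk|] := eqVneq l k; last by rewrite mulr0.
by move: ks; rewrite -lk ls.
Qed.

(** By orthogonality the coefficients of f - g are its Fourier coefficients. The identities between
    operators below are verified coefficient by coefficient through this lemma. *)
Lemma tpoly_fourier_inj f g : tpoly f -> tpoly g ->
  (forall k, fourier f k = fourier g k) -> f = g.
Proof.
move=> tf tg fg; have th := tpolyB tf tg.
have h0 k : fourier (fun x => f x - g x) k = 0.
  by rewrite fourierB ?fg ?subrr//; exact: L1_tpoly.
have [s [c [us hE]]] := th.
apply/funext => x; apply/eqP; rewrite -subr_eq0 hE; apply/eqP.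
rewrite big_seq big1// => k ks.
have := h0 k; rewrite (_ : (fun x => f x - g x) =
  (fun x => \sum_(k <- s) c k * character k x)); last exact/funext.
by rewrite fourier_sum_character sum_eq_uniq// ks => ->; rewrite mul0r.
Qed.

Lemma convolutionE (s : seq 'cV[int]_d) (c : 'cV[int]_d -> R[i]) g x : L1 g ->
  convolution (fun y => \sum_(k <- s) c k * character k y) g x =
  \sum_(k <- s) c k * fourier g k * character k x.
Proof.
move=> Lg.
rewrite /convolution (@eq_cintegral _ _ _ (fun y => \sum_(k <- s)
  (c k * character k x) * (g y * character (- k) y))).
  rewrite cintegral_sum => [|k]; last exact/cintegrableZ/L1_fourier.
  apply: eq_bigr => k _; rewrite cintegralZ; last exact: L1_fourier.
  by rewrite mulrAC.
move=> y; rewrite mulr_suml; apply: eq_bigr => k _.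
by rewrite characterDr characterNr; ring.
Qed.

Lemma tpoly_convolution f g : tpoly f -> L1 g -> tpoly (convolution f g).
Proof.
move=> [s [c [us fE]]] Lg; exists s, (fun k => c k * fourier g k); split => // x.
have -> : f = fun x => \sum_(k <- s) c k * character k x by exact/funext.
by rewrite convolutionE.
Qed.

Lemma fourier_convolution f g k : tpoly f -> L1 g ->
  fourier (convolution f g) k = fourier f k * fourier g k.
Proof.
move=> [s [c [us fE]]] Lg.
have -> : f = fun x => \sum_(k <- s) c k * character k x by exact/funext.
rewrite (_ : convolution _ _ =
  (fun x => \sum_(k <- s) c k * fourier g k * character k x)); last first.
  by apply/funext => x; rewrite convolutionE.
rewrite !fourier_sum_character (@sum_eq_uniq s (fun k => c k * fourier g k))//.
by rewrite sum_eq_uniq//; case: ifP; rewrite ?mul0r.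
Qed.

Lemma fourier_shift f a k : tpoly f ->
  fourier (fun x => f (x - a)) k = fourier f k * character (- k) a.
Proof.
move=> [s [c [us fE]]].
have -> : f = fun x => \sum_(k <- s) c k * character k x by exact/funext.
rewrite fourier_sum_character sum_eq_uniq//.
rewrite (_ : (fun _ => _) = (fun x => \sum_(k <- s) c k * character (- k) a * character k x)).
  rewrite fourier_sum_character (@sum_eq_uniq s (fun k => c k * character (- k) a))//.
  by case: ifP; rewrite ?mul0r.
apply/funext => x; apply: eq_bigr => l _.
by rewrite characterDr characterNr; ring.
Qed.

Lemma trig_poly_tpoly (A : 'M[R]_d) f : finite_set (frequencies A) -> trig_poly A f ->
  tpoly f /\ (forall k, ~ frequencies A k -> fourier f k = 0).
Proof.
move=> fA [c fE].
pose S : seq 'cV[int]_d := finmap.enum_fset (fset_set (frequencies A)).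
have fE' x : f x = \sum_(k <- S) c k * character k x by rewrite fE fsbig_finite.
have uS : uniq S by exact: finmap.fset_uniq.
split; first by exists S, c.
move=> k kA; have -> : f = fun x => \sum_(k <- S) c k * character k x by exact/funext.
rewrite fourier_sum_character sum_eq_uniq//.
by rewrite [k \in S](in_fset_set fA) memNset.
Qed.

End trigonometric_polynomials.

(** * The lattice of nodes *)

Section lattice.
Context {R : realType} {d : nat}.
Variable a : 'rV[int]_d.
Hypothesis a_neq0 : forall i, a 0 i != 0.
Implicit Types (k l n r : 'cV[int]_d).

Let aR i : R := (a 0 i)%:~R.

Let aR_neq0 i : aR i != 0.
Proof. by rewrite intr_eq0. Qed.

Definition lattice_node k : 'cV[R]_d := \col_i ((k i 0)%:~R / (a 0 i)%:~R).

(** With [a] the diagonal of M^j, the bounds -1/2, 1/2 describe D(M^j) and -1/4, 1/4 describe D(M^j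
    / 2). When an entry of [a] is negative the excluded endpoint for k moves to the other side;
    working with k/a hides this. *)
Definition lattice_box (lo hi : R) : set 'cV[int]_d :=
  [set k | forall i, lo <= lattice_node k i 0 < hi].

Definition lattice_mul r : 'cV[int]_d := \col_i (a 0 i * r i 0).

Lemma lattice_nodeD k l : lattice_node (k + l) = lattice_node k + lattice_node l.
Proof. by apply/colP => i; rewrite !mxE intrD mulrDl. Qed.

Lemma lattice_nodeN k : lattice_node (- k) = - lattice_node k.
Proof. by apply/colP => i; rewrite !mxE intrN mulNr. Qed.

Lemma lattice_node_mul r : lattice_node (lattice_mul r) = intvec r.
Proof. by apply/colP => i; rewrite !mxE intrM mulrAC divff ?aR_neq0// mul1r. Qed.

Lemma lattice_nodeMmul k r : lattice_node (k + lattice_mul r) = lattice_node k + intvec r.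
Proof. by rewrite lattice_nodeD lattice_node_mul. Qed.

Lemma dilation_mulcol (x : 'cV[R]_d) i : (dilation a *m x) i 0 = aR i * x i 0.
Proof.
by rewrite /dilation mul_diag_mx !mxE.
Qed.

Lemma invmx_dilation k : invmx (dilation a) *m intvec k = lattice_node k.
Proof.
have e : intvec k = dilation a *m lattice_node k.
  by apply/colP => i; rewrite dilation_mulcol !mxE mulrC divfK ?aR_neq0.
have u : (dilation a : 'M[R]_d) \in unitmx.
  rewrite unitmxE /dilation det_diag unitfE; apply/prodf_neq0 => i _.
  by rewrite !mxE; exact: aR_neq0.
by rewrite e mulKmx.
Qed.

Lemma frequencies_dilation : frequencies (dilation a : 'M[R]_d) = lattice_box (- 2^-1) 2^-1.
Proof.
apply/seteqP; split => [k [u cu e] i|k h].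
  have -> : lattice_node k i 0 = u i 0.
    have := congr1 (fun w : 'cV[R]_d => w i 0) e.
    by rewrite dilation_mulcol !mxE => ->; rewrite mulrAC divff ?aR_neq0// mul1r.
  exact: cu.
exists (lattice_node k) => //.
by apply/colP => i; rewrite dilation_mulcol !mxE mulrC divfK ?aR_neq0.
Qed.

Lemma frequencies_half : frequencies (2^-1 *: (dilation a : 'M[R]_d)) = lattice_box (- 4^-1) 4^-1.
Proof.
apply/seteqP; split => [k [u cu e] i|k h].
  have -> : lattice_node k i 0 = 2^-1 * u i 0.
    have := congr1 (fun w : 'cV[R]_d => w i 0) e.
    rewrite -scalemxAl [RHS]mxE dilation_mulcol !mxE => ->.
    by rewrite mulrCA mulrAC divff ?aR_neq0// mul1r.
  by have /andP[h1 h2] := cu i; apply/andP; split; lra.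
exists (2 *: lattice_node k).
  by move=> i; have /andP[h1 h2] := h i; rewrite mxE; apply/andP; split; lra.
apply/colP => i; rewrite -scalemxAl [RHS]mxE dilation_mulcol [X in _ * (_ * X)]mxE.
have : aR i * lattice_node k i 0 = intvec k i 0 by rewrite !mxE mulrC divfK ?aR_neq0.
by move=> <-; lra.
Qed.

(** Rounding k/a to the nearest integer vector, with halves rounded up, leaves a remainder in the
    half-open centred box: this is division of k by [a] with remainder in D(M^j). *)
Definition lattice_quo k : 'cV[int]_d := \col_i Num.floor (lattice_node k i 0 + 2^-1).

Definition lattice_red k := k - lattice_mul (lattice_quo k).

Lemma lattice_mulN r : lattice_mul (- r) = - lattice_mul r.
Proof. by apply/colP => i; rewrite !mxE mulrN. Qed.

Lemma lattice_red_node k i : lattice_node (lattice_red k) i 0 =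
  lattice_node k i 0 - (lattice_quo k i 0)%:~R.
Proof. by rewrite /lattice_red -lattice_mulN lattice_nodeMmul !mxE intrN. Qed.

Lemma lattice_red_box k : lattice_box (- 2^-1) 2^-1 (lattice_red k).
Proof.
move=> i; rewrite lattice_red_node [lattice_quo k i 0]mxE.
set t := lattice_node k i 0.
have h1 := floor_le (t + 2^-1).
have h2 := floorD1_gt (t + 2^-1); rewrite intrD in h2.
apply/andP; split; lra.
Qed.

Lemma lattice_quo_unique k r :
  lattice_box (- 2^-1) 2^-1 (k - lattice_mul r) -> r = lattice_quo k.
Proof.
move=> h; apply/colP => i; rewrite [RHS]mxE; apply/esym/floor_def.
have e : lattice_node (k - lattice_mul r) i 0 = lattice_node k i 0 - (r i 0)%:~R.
  by rewrite -lattice_mulN lattice_nodeMmul !mxE intrN.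
by have := h i; rewrite e intrD => /andP[h1 h2]; apply/andP; split; lra.
Qed.

Lemma lattice_mul0 : lattice_mul 0 = 0.
Proof. by apply/colP => i; rewrite !mxE mulr0. Qed.

Lemma lattice_red_id k : lattice_box (- 2^-1) 2^-1 k -> lattice_red k = k.
Proof.
move=> h; rewrite /lattice_red -(@lattice_quo_unique k 0) ?lattice_mul0 ?subr0//.
Qed.

Lemma lattice_quoD k r : lattice_quo (k + lattice_mul r) = lattice_quo k + r.
Proof.
apply/colP => i; rewrite !mxE intrD mulrDl intrM [X in _ + X + _]mulrAC divff ?aR_neq0// mul1r.
by rewrite addrAC floorDrz ?intr_int// intrKfloor.
Qed.

Lemma lattice_mulD r n : lattice_mul (r + n) = lattice_mul r + lattice_mul n.
Proof. by apply/colP => i; rewrite !mxE mulrDr. Qed.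

Lemma lattice_redD k r : lattice_red (k + lattice_mul r) = lattice_red k.
Proof.
by rewrite /lattice_red lattice_quoD lattice_mulD opprD addrACA subrr addr0.
Qed.

Definition residue (f : {dffun forall i : 'I_d, 'I_(absz (a 0 i))}) : 'cV[int]_d :=
  lattice_red (\col_i (f i : nat)%:Z).

(** D(M^j) is listed through the product of the sets {0, ..., |a_i| - 1}, each element being reduced
    into the centred box, so that its cardinality |det M^j| can be read off. *)
Definition residues : seq 'cV[int]_d :=
  [seq residue f | f <- enum {: {dffun forall i : 'I_d, 'I_(absz (a 0 i))}}].

Lemma mem_residues k : k \in residues <-> lattice_box (- 2^-1) 2^-1 k.
Proof.
split=> [/mapP[f _ ->]|h]; first exact: lattice_red_box.
have lt i : (absz (k i 0%R %% a 0%R i)%Z < absz (a 0%R i))%N.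
  by rewrite -ltz_nat gez0_abs ?modz_ge0// ltz_mod.
apply/mapP; exists [ffun i => Ordinal (lt i)] => //; first by rewrite mem_enum.
rewrite /residue -{1}(lattice_red_id h).
rewrite -[RHS](lattice_redD _ (\col_i (k i 0%R %/ a 0%R i)%Z)); congr lattice_red.
apply/colP => i; rewrite !mxE ffunE /= gez0_abs ?modz_ge0//.
by rewrite addrC [X in X + _]mulrC -divz_eq.
Qed.

Lemma residues_uniq : uniq residues.
Proof.
rewrite map_inj_uniq ?enum_uniq// => f g fg.
apply/ffunP => i; apply/val_inj => /=.
have : (f i : nat)%:Z = (g i : nat)%:Z.
  have e k : k i 0 = (lattice_red k + lattice_mul (lattice_quo k)) i 0.
    by rewrite subrK.
  have m (h : {dffun forall i : 'I_d, 'I_(absz (a 0 i))}) : ((h i : nat)%:Z %% a 0%R i)%Z = (residue h i 0%R %% a 0%R i)%Z.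
    have := e (\col_i (h i : nat)%:Z); rewrite [LHS]mxE => ->.
    by rewrite [X in (X %% _)%Z = _]mxE [X in (_ + X)%Z]mxE mulrC addrC modzMDl.
  have lt (h : {dffun forall i : 'I_d, 'I_(absz (a 0 i))}) : ((h i : nat)%:Z %% a 0%R i)%Z = (h i : nat)%:Z.
    by rewrite -modz_abs modz_small// ltz_nat ltn_ord.
  by rewrite -lt m fg -m lt.
by case.
Qed.

Lemma size_residues : size residues = (\prod_i absz (a 0%R i))%N.
Proof.
rewrite size_map -cardE card_dep_ffun foldrE big_map big_enum /=.
by apply: eq_bigr => i _; rewrite card_ord.
Qed.

Lemma residues_frequencies : [set` residues] = frequencies (dilation a : 'M[R]_d).
Proof.
by rewrite frequencies_dilation; apply/seteqP; split => k /mem_residues.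
Qed.

Lemma finite_frequencies : finite_set (frequencies (dilation a : 'M[R]_d)).
Proof. by rewrite -residues_frequencies; exact: finite_seq. Qed.

Lemma sum_frequencies (V : nmodType) (F : 'cV[int]_d -> V) :
  \sum_(k \in frequencies (dilation a : 'M[R]_d)) F k = \sum_(k <- residues) F k.
Proof. by rewrite -residues_frequencies [RHS]fsbig_seq//; exact: residues_uniq. Qed.

(** A map that is injective modulo the lattice induces, after reduction, an injection of the finite
    set of residues into itself, hence a permutation. It serves for translations and for k -> -k. *)
Lemma sum_residues_reindex (V : nmodType) (F : 'cV[int]_d -> V) (sig : 'cV[int]_d -> 'cV[int]_d) :
  (forall k r, F (k + lattice_mul r) = F k) ->
  (forall k l, (exists r, sig k = sig l + lattice_mul r) -> exists r, k = l + lattice_mul r) ->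
  \sum_(k <- residues) F (sig k) = \sum_(k <- residues) F k.
Proof.
move=> FP siginj.
have Fred k : F (lattice_red k) = F k.
  by rewrite /lattice_red -lattice_mulN FP.
under eq_bigr do rewrite -Fred.
rewrite -(big_map (fun k => lattice_red (sig k)) predT F); apply: perm_big.
have u : uniq [seq lattice_red (sig k) | k <- residues].
  rewrite map_inj_in_uniq ?residues_uniq// => k l /mem_residues hk /mem_residues hl e.
  have [|r kl] := siginj k l.
    exists (lattice_quo (sig k) - lattice_quo (sig l)).
    move: e; rewrite /lattice_red lattice_mulD lattice_mulN => e.
    by rewrite addrA addrAC -e subrK.
  by rewrite -(lattice_red_id hk) -(lattice_red_id hl) kl lattice_redD.
apply: uniq_perm => //; first exact: residues_uniq.
have [] := uniq_min_size u _ (_ : size residues <= size [seq lattice_red (sig k) | k <- residues])%N => //.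
- by move=> k /mapP[l _ ->]; apply/mem_residues; exact: lattice_red_box.
- by rewrite size_map.
Qed.

End lattice.

(** * Dirichlet kernels and Parseval's identity *)

Section dirichlet_kernels.
Context {R : realType} {d : nat}.
Notation torus := (@torus_measure R d).
Implicit Types (k l : 'cV[int]_d) (x y : 'cV[R]_d) (S : seq 'cV[int]_d).

Lemma cos_2pi_eq1 (t : R) : `|t| < 1 -> cos (2 * pi * t) = 1 -> t = 0.
Proof.
move=> t1.
wlog t0 : t t1 / 0 <= t.
  move=> H; case: (leP 0 t) => [|t0 ct]; first exact: H.
  by apply/eqP; rewrite -oppr_eq0; apply/eqP/H; rewrite ?normrN ?oppr_ge0 ?ltW// mulrN cosN.
move=> ct; apply/eqP/negPn/negP => tn0.
have tp : 0 < t by rewrite lt_neqAle eq_sym tn0.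
have : 0 < sin (pi * t).
  apply: sin_gt0_pi; rewrite mulr_gt0 ?pi_gt0//=.
  by rewrite -[ltRHS]mulr1 ltr_pM2l ?pi_gt0// -(ger0_norm t0).
have e : 2 * pi * t = (pi * t) *+ 2 by rewrite -mulrA mulr_natl.
move: ct; rewrite e cos_mulr2n cos2sin2 => h.
by have -> : sin (pi * t) = 0; [apply/eqP; rewrite -sqrf_eq0; apply/eqP; lra|rewrite ltxx].
Qed.

(** The Dirichlet kernel with spectrum S; the square of its modulus is a Fejer kernel up to a
    factor. *)
Definition chi S x : R[i] := \sum_(k <- S) character k x.

Lemma tpoly_chi S : tpoly (chi S).
Proof. by apply: tpoly_sum => k; exact: tpoly_character. Qed.

Lemma normcE_conj (z : R[i]) : ((normc z ^+ 2)%:C)%C = z * conjc z.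
Proof.
rewrite normcE2; case: z => u v /=; apply/eqP; rewrite eq_complex /=.
by apply/andP; split; apply/eqP; ring.
Qed.

Lemma normc2_chi S x : ((normc (chi S x) ^+ 2)%:C)%C =
  \sum_(k <- S) \sum_(l <- S) character (k - l) x.
Proof.
rewrite normcE_conj /chi mulr_suml; apply: eq_bigr => k _.
rewrite rmorph_sum mulr_sumr; apply: eq_bigr => l _.
by rewrite /= characterDl characterNl.
Qed.

Lemma Re_cintegral_real (f : 'cV[R]_d -> R) :
  complex.Re (cintegral (fun x => (f x)%:C)%C) = \int[torus]_x f x.
Proof. by []. Qed.

Lemma integral_normc_tpoly_ge0 (f : 'cV[R]_d -> R[i]) : tpoly f ->
  (\int[torus]_x ((normc (f x)) ^+ 2)%:E)%E =
  (complex.Re (cintegral (fun x => (normc (f x) ^+ 2)%:C)%C))%:E.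
Proof.
move=> tf; rewrite Re_cintegral_real /Rintegral fineK//.
have [B B0 fB] := tpoly_bounded tf.
rewrite ge0_fin_numE; last by apply: integral_ge0 => x _; rewrite lee_fin sqr_ge0.
apply: (@le_lt_trans _ _ (\int[torus]_x ((B ^+ 2)%:E))%E).
  apply: ge0_le_integral => //.
  - by move=> x _; rewrite lee_fin sqr_ge0.
  - apply/measurable_EFinP/measurable_funX.
    by apply: measurable_normc; exact: cmeasurable_tpoly.
  - by move=> x _; rewrite lee_fin ler_pXn2r// nnegrE normc_ge0.
by rewrite integral_cst// [X in (_ * X)%E]torus_measureT mule1 ltry.
Qed.

Lemma integral_normc2_chi S : uniq S ->
  (\int[torus]_x ((normc (chi S x)) ^+ 2)%:E)%E = ((size S)%:R)%:E.
Proof.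
move=> uS; rewrite integral_normc_tpoly_ge0; last exact: tpoly_chi.
rewrite (eq_cintegral (normc2_chi S)) cintegral_sum; last first.
  by move=> k; apply: cintegrable_sum => l; apply/L1_cintegrable/L1_character.
rewrite (eq_big_seq (fun=> 1)); last first.
  move=> k kS; rewrite cintegral_sum; last by move=> l; apply/L1_cintegrable/L1_character.
  rewrite (eq_bigr (fun l => 1 * (l == k)%:R)).
    by rewrite (@sum_eq_uniq R d S (fun=> 1))// kS.
  by move=> l _; rewrite cintegral_character subr_eq0 mul1r eq_sym.
rewrite big_const_seq count_predT iter_addr_0.
by rewrite -[1]/((1 : R)%:C)%C -rmorphMn /=.
Qed.

Lemma integral_normc2_chi_affine S y (b : R) : uniq S -> b = 1 \/ b = -1 ->
  (\int[torus]_x ((normc (chi S (y + b *: x))) ^+ 2)%:E)%E = ((size S)%:R)%:E.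
Proof.
move=> uS hb; rewrite -(integral_normc2_chi uS).
rewrite (ge0_integral_torus_affine (F := fun x => ((normc (chi S x)) ^+ 2)%:E))//.
- apply/measurable_EFinP/measurable_funX.
  by apply: measurable_normc; apply: cmeasurable_tpoly; exact: tpoly_chi.
- by move=> x; rewrite lee_fin sqr_ge0.
- by move=> k x; rewrite periodic_tpoly//; exact: tpoly_chi.
Qed.

End dirichlet_kernels.

(** * Discrete orthogonality on the nodes *)

Section lattice_sums.
Context {R : realType} {d : nat}.
Variable a : 'rV[int]_d.
Hypothesis a_neq0 : forall i, a 0 i != 0.
Implicit Types (k l n r : 'cV[int]_d) (x y : 'cV[R]_d).

Notation E := (@residues R d a).
Notation nd := (@lattice_node R d a).
Notation box lo hi := (@lattice_box R d a lo hi).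
Let N : R := (size E)%:R.

Lemma size_residues_gt0 : (0 < size E)%N.
Proof.
by rewrite size_residues; apply/prodn_gt0 => i; rewrite absz_gt0.
Qed.

Lemma sizeR_residues_gt0 : 0 < N.
Proof. by rewrite ltr0n size_residues_gt0. Qed.

Lemma character_node_mul n r : character n (nd (lattice_mul a r)) = 1 :> R[i].
Proof. by rewrite lattice_node_mul// character_intvec. Qed.

Lemma sum_residues_shift (V : nmodType) (F : 'cV[int]_d -> V) l :
  (forall k r, F (k + lattice_mul a r) = F k) ->
  \sum_(k <- E) F (k + l) = \sum_(k <- E) F k.
Proof.
move=> FP; apply: (sum_residues_reindex a_neq0 (sig := fun k => k + l)) => // k k' [r e].
by exists r; apply: (addIr l); rewrite e addrAC.
Qed.

Lemma sum_residues_opp (V : nmodType) (F : 'cV[int]_d -> V) :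
  (forall k r, F (k + lattice_mul a r) = F k) ->
  \sum_(k <- E) F (- k) = \sum_(k <- E) F k.
Proof.
move=> FP; apply: (sum_residues_reindex a_neq0 (sig := -%R)) => // k k' [r e].
by exists (- r); apply: oppr_inj; rewrite e lattice_mulN opprD opprK.
Qed.

(** If k and l differ in coordinate i, translating the sum by the node of e_i multiplies it by exp(2
    pi i (k_i - l_i) / a_i). Both frequencies lie in the centred box, so the quotient has modulus
    less than 1 and is nonzero; the factor is not 1 and the sum vanishes. *)
Lemma sum_character_node k l : k \in E -> l \in E ->
  \sum_(n <- E) character (k - l) (nd n) = N%:C%C * (k == l)%:R.
Proof.
move=> kE lE; have [->|kl] := eqVneq k l.
  under eq_bigr do rewrite subrr character0l.
  rewrite big_const_seq count_predT iter_addr_0 mulr1 /N.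
  by rewrite -[1]/((1 : R)%:C)%C -rmorphMn.
rewrite mulr0; set n := k - l.
have P m r : character n (nd (m + lattice_mul a r)) = character n (nd m).
  by rewrite lattice_nodeD characterDr character_node_mul mulr1.
have [i ki] : exists i, k i 0 != l i 0.
  apply/existsP; apply: contra_neqT kl; rewrite negb_exists => /forallP h.
  by apply/colP => i; have := h i; rewrite negbK => /eqP.
pose e : 'cV[int]_d := delta_mx i 0.
have S := sum_residues_shift e P.
move: S; under eq_bigr do rewrite lattice_nodeD characterDr.
rewrite -mulr_suml => S.
apply/eqP; apply: contraT => S0.
have c1 : character n (nd e) = 1.
  by apply: (mulfI S0); rewrite S mulr1.
have tE : dotz n (nd e) = nd k i 0 - nd l i 0.
  rewrite /dotz (bigD1 i)//= big1 ?addr0.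
    by rewrite !mxE !eqxx /= intrB mul1r mulrBl.
  by move=> j ji; rewrite !mxE (negbTE ji) /= mul0r mulr0.
have /(mem_residues a_neq0)/(_ i)/andP[h1 h2] := kE.
have /(mem_residues a_neq0)/(_ i)/andP[h3 h4] := lE.
have t1 : `|dotz n (nd e)| < 1 by rewrite tE ltr_norml; apply/andP; split; lra.
have : dotz n (nd e) = 0.
  apply: cos_2pi_eq1 => //.
  by move: c1; rewrite characterE => /(congr1 (@complex.Re R)).
rewrite tE !mxE => /eqP; rewrite subr_eq0 => /eqP h.
have aR : (a 0 i)%:~R != 0 :> R by rewrite intr_eq0.
have /eqP := mulIf (invr_neq0 aR) h.
by rewrite eqr_int (negbTE ki).
Qed.

(** A discrete Parseval identity: only the diagonal terms of the expanded square survive the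
    summation over nodes. That the sum does not depend on x is what the Schur test needs later. *)
Lemma sum_normc2_chi_node x :
  \sum_(k <- E) normc (chi E (x - nd k)) ^+ 2 = N ^+ 2.
Proof.
apply: (@complexI R).
rewrite rmorph_sum /=; under eq_bigr do rewrite normc2_chi.
rewrite exchange_big /= (eq_big_seq (fun=> N%:C%C)); last first.
  move=> k kE; rewrite exchange_big /=.
  rewrite (eq_big_seq (fun l => (character (k - l) x * N%:C%C) * (l == k)%:R)).
    rewrite (@sum_eq_uniq R d E (fun l => character (k - l) x * N%:C%C)) ?residues_uniq//.
    by rewrite kE subrr character0l mul1r.
  move=> l lE; rewrite -mulrA -sum_character_node// mulr_sumr.
  by apply: eq_bigr => n _; rewrite characterDr characterNr opprB.
rewrite big_const_seq count_predT iter_addr_0 expr2 rmorphM /= -mulr_natl.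
by congr (_ * _); rewrite /N rmorph_nat.
Qed.

End lattice_sums.

(** * De la Vallee-Poussin kernels *)

Section vallee_poussin.
Context {R : realType} {d : nat}.
Notation torus := (@torus_measure R d).
Variable a : 'rV[int]_d.
Hypothesis a_neq0 : forall i, a 0 i != 0.
Implicit Types (k l n r : 'cV[int]_d) (x y : 'cV[R]_d).

Notation E := (@residues R d a).
Notation nd := (@lattice_node R d a).
Notation box lo hi := (@lattice_box R d a lo hi).
Let N : R := (size E)%:R.

Definition majorant (V : 'cV[R]_d -> R[i]) (Phi : 'cV[R]_d -> R) (C : R) :=
  [/\ measurable_fun [set: 'cV[R]_d] Phi, (forall x, 0 <= Phi x),
      (forall x, normc (V x) <= Phi x) &
      (forall y (b : R), b = 1 \/ b = -1 ->
        (\int[torus]_x (Phi (y + b *: x))%:E <= C%:E)%E)].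

Let tern (t : 'I_3) : int := (t : nat)%:Z - 1.

(** The interval [-1/4, 1/2) is three times as long as [0, 1/4). The translation step n/4 has to be
    rounded up to the integer c; the loss is harmless because a negative integer k is at most -1 and
    an integer k >= n/4 is at least c. *)
Lemma ternary_cover (n : R) (k : int) : 0 < n ->
  - 4^-1 <= k%:~R / n < 2^-1 ->
  exists t : 'I_3, 0 <= (k - tern t * Num.ceil (n / 4))%:~R / n < 4^-1.
Proof.
move=> n0; rewrite ler_pdivlMr// ltr_pdivrMr// => /andP[h1 h2].
set c := Num.ceil (n / 4).
have c1 : n / 4 <= c%:~R by exact: ceil_ge.
have c2 : c%:~R < n / 4 + 1.
  by have := ceilB1_lt (n / 4); rewrite -/c intrB; lra.
suff [t h] : exists t : int, (t = -1 \/ t = 0 \/ t = 1) /\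
    0 <= (k - t * c)%:~R :> R /\ (k - t * c)%:~R < n / 4.
  have [th [h3 h4]] := h.
  have [j jt] : exists j : 'I_3, tern j = t.
    by case: th => [->|[->|->]]; [exists (@Ordinal 3 0 isT)|exists (@Ordinal 3 1 isT)|
      exists (@Ordinal 3 2 isT)].
  exists j; rewrite jt ler_pdivlMr// ltr_pdivrMr// mul0r h3/=; lra.
have [k0|k0] := ltP k 0.
  exists (-1); split; first by left.
  have : k <= -1 by rewrite -ltzD1 addrC subrr.
  rewrite -(ler_int R) => k1.
  by rewrite mulN1r opprK intrD; split; lra.
have [kq|kq] := ltP (k%:~R : R) (n / 4).
  exists 0; split; first by right; left.
  by rewrite mul0r subr0 ler0z.
exists 1; split; first by right; right.
have : c <= k by rewrite /c ceil_le_int.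
rewrite -(ler_int R) => ck.
by rewrite mul1r intrB; split; lra.
Qed.

Let A := [seq k <- E | `[< box (- 4^-1) 2^-1 k >]].
Let B := [seq k <- E | `[< box 0 4^-1 k >]].

Let memA k : k \in A <-> box (- 4^-1) 2^-1 k.
Proof.
rewrite mem_filter; split => [/andP[/asboolP]//|h]; apply/andP; split; first exact/asboolP.
by apply/mem_residues => // i; have /andP[h1 h2] := h i; apply/andP; split; lra.
Qed.

Let memB k : k \in B <-> box 0 4^-1 k.
Proof.
rewrite mem_filter; split => [/andP[/asboolP]//|h]; apply/andP; split; first exact/asboolP.
by apply/mem_residues => // i; have /andP[h1 h2] := h i; apply/andP; split; lra.
Qed.

(** [ternary_cover] in each coordinate covers A by 3^d integer translates of B. *)
Let size_A : (size A <= 3 ^ d * size B)%N.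
Proof.
pose c i : int := Num.ceil (`|(a 0 i)%:~R| / 4 : R).
pose sh (t : {ffun 'I_d -> 'I_3}) : 'cV[int]_d := \col_i (sgz (a 0 i) * (tern (t i) * c i)).
pose L := [seq b + sh t | t <- enum {: {ffun 'I_d -> 'I_3}}, b <- B].
have sL : size L = (3 ^ d * size B)%N.
  by rewrite size_allpairs -cardE card_ffun !card_ord.
rewrite -sL; apply: uniq_leq_size; first by rewrite filter_uniq ?residues_uniq.
move=> k /memA hk.
(* The sign of a_i is moved to the frequency, so that [ternary_cover] is applied with the positive
   modulus |a_i|. *)
have ndE m i : nd m i 0 = (sgz (a 0 i) * m i 0)%:~R / `|(a 0 i)%:~R|.
  rewrite mxE; case: (ltgtP (a 0 i) 0) (a_neq0 i) => // ai _.
    by rewrite ltr0_sgz// ltr0_norm ?ltrz0// mulN1r intrN invrN mulrNN.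
  by rewrite gtr0_sgz// gtr0_norm ?ltr0z// mul1r.
have h i : exists t : 'I_3, 0 <= nd (k - sh [ffun=> t]) i 0 < 4^-1.
  have [||t ht] := @ternary_cover `|(a 0 i)%:~R| (sgz (a 0 i) * k i 0).
  - by rewrite normr_gt0 intr_eq0.
  - by rewrite -ndE; exact: hk.
  exists t; rewrite ndE.
  have -> // : sgz (a 0 i) * (k - sh [ffun=> t]) i 0 =
      sgz (a 0 i) * k i 0 - tern t * Num.ceil (`|(a 0 i)%:~R| / 4 : R).
  rewrite mxE [(- sh _) i 0]mxE mxE ffunE mulrBr [sgz _ * (_ * (_ * _))]mulrA mulz_sg.
  by rewrite a_neq0 mul1r.
have [t ht] := choice h.
apply/allpairsP; exists ([ffun i => t i], k - sh [ffun i => t i]); split => /=.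
- by rewrite mem_enum.
- apply/memB => i; have := ht i.
  by rewrite !mxE !ffunE.
- by rewrite subrK.
Qed.

Let memB0 : 0 \in B.
Proof.
by apply/memB => i; rewrite !mxE mul0r lexx invr_gt0/=.
Qed.

(** V is |B|^(-1) times [chi A] times the conjugate of [chi B]; its coefficient at l is the
    proportion of b in B with l + b in A. It is 1 on [-1/4, 1/4) because [-1/4, 1/4) + [0, 1/4) lies
    in [-1/4, 1/2), and 0 off [-1/2, 1/2) because A - B lies there. The majorant comes from 2uv <=
    u^2 + v^2, and Parseval gives it the integral (|A| + |B|) / (2|B|), at most 3^d by [size_A]. *)
Lemma half_kernel : exists V Phi, [/\ tpoly V,
  (forall k, box (- 4^-1) 4^-1 k -> fourier V k = 1),
  (forall k, ~ box (- 2^-1) 2^-1 k -> fourier V k = 0) &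
  majorant V Phi (3 ^+ d)].
Proof.
have uA : uniq A by rewrite filter_uniq ?residues_uniq.
have uB : uniq B by rewrite filter_uniq ?residues_uniq.
pose nB : R := (size B)%:R.
have nB0 : 0 < nB.
  by rewrite ltr0n; case: B memB0.
pose V (x : 'cV[R]_d) : R[i] := \sum_(b <- B) (nB^-1)%:C%C * \sum_(k <- A) character (k - b) x.
pose Phi (x : 'cV[R]_d) : R := (2 * nB)^-1 * (normc (chi A x) ^+ 2 + normc (chi B x) ^+ 2).
have tV : tpoly V.
  by apply: tpoly_sumZ => b; apply: tpoly_sum => k; exact: tpoly_character.
have fV l : fourier V l = (nB^-1)%:C%C * \sum_(b <- B) (l + b \in A)%:R.
  rewrite fourier_sum; last first.
    by move=> b; apply: L1Z; apply: L1_tpoly; apply: tpoly_sum => k; exact: tpoly_character.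
  rewrite mulr_sumr; apply: eq_bigr => b _; rewrite fourierZ; last first.
    by apply: L1_tpoly; apply: tpoly_sum => k; exact: tpoly_character.
  rewrite fourier_sum; last by move=> k; exact: L1_character.
  congr (_ * _); transitivity (\sum_(k <- A) 1 * (k == l + b)%:R : R[i]).
    by apply: eq_bigr => k _; rewrite fourier_character mul1r subr_eq.
  by rewrite (@sum_eq_uniq R d A (fun=> 1))//; case: ifP.
have VE x : V x = (nB^-1)%:C%C * (chi A x * conjc (chi B x)).
  rewrite /V -mulr_sumr; congr (_ * _).
  rewrite /chi rmorph_sum mulr_sumr; apply: eq_bigr => b _.
  by rewrite mulr_suml; apply: eq_bigr => k _; rewrite characterDl characterNl.
exists V, Phi; split => //.
- move=> k hk; rewrite fV (eq_big_seq (fun=> 1)).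
    rewrite big_const_seq count_predT iter_addr_0 -[1]/((1 : R)%:C)%C -rmorphMn.
    by rewrite -rmorphM /= -/nB mulVf ?gt_eqF.
  move=> b /memB hb; have -> // : k + b \in A.
  apply/memA => i; rewrite lattice_nodeD mxE.
  have /andP[h1 h2] := hk i; have /andP[h3 h4] := hb i; apply/andP; split; lra.
- move=> k hk; rewrite fV big_seq big1 ?mulr0// => b /memB hb.
  case: (boolP (k + b \in A)) => // /memA hkb; exfalso; apply: hk => i.
  have := hkb i; rewrite lattice_nodeD mxE => /andP[h1 h2].
  have /andP[h3 h4] := hb i; apply/andP; split; lra.
- have mc S : measurable_fun [set: 'cV[R]_d] (fun x => normc (chi S x) ^+ 2).
    apply: measurable_funX; apply: measurable_normc; apply: cmeasurable_tpoly.
    exact: tpoly_chi.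
  have mcE S : measurable_fun [set: 'cV[R]_d] (fun x => (normc (chi S x) ^+ 2)%:E).
    exact/measurable_EFinP.
  split.
  + by apply: measurable_funM => //; exact: measurable_funD.
  + move=> x; rewrite /Phi mulr_ge0 ?invr_ge0 ?mulr_ge0 ?(ltW nB0)//.
    by rewrite addr_ge0 ?sqr_ge0.
  + move=> x; rewrite VE !normcM normcJ' normc_real ger0_norm ?invr_ge0 ?(ltW nB0)//.
    rewrite /Phi invfM [2^-1 * _]mulrC -mulrA ler_pM2l ?invr_gt0//.
    have := sqr_ge0 (normc (chi A x) - normc (chi B x)); rewrite sqrrB; lra.
  + move=> y b hb; rewrite /Phi.
    have mc' S : measurable_fun [set: 'cV[R]_d] (fun x => (normc (chi S (y + b *: x)) ^+ 2)%:E).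
      exact: (measurableT_comp (mcE S) (measurable_affine_cV y b)).
    under eq_integral do rewrite EFinM EFinD.
    rewrite ge0_integralZl_EFin//; last 3 first.
    * by move=> x _; rewrite adde_ge0 ?lee_fin ?sqr_ge0.
    * exact: emeasurable_funD.
    * by rewrite invr_ge0 mulr_ge0 ?(ltW nB0).
    rewrite ge0_integralD//; last 2 first.
    * by move=> x _; rewrite lee_fin sqr_ge0.
    * by move=> x _; rewrite lee_fin sqr_ge0.
    rewrite !integral_normc2_chi_affine// -EFinD -EFinM lee_fin.
    rewrite -/nB mulrC ler_pdivrMr ?mulr_gt0//.
    have h1 : (size A)%:R <= 3 ^+ d * nB :> R.
      by rewrite -natrX -natrM ler_nat.
    have h2 : 1 <= 3 ^+ d :> R by rewrite exprn_ege1// ler1n.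
    have h3 : nB <= 3 ^+ d * nB by rewrite ler_peMl// ltW.
    lra.
Qed.

Let shift (t : {ffun 'I_d -> 'I_3}) : 'cV[int]_d := lattice_mul a (\col_i tern (t i)).

(** A point of [-1, 1) rounds to -1, 0 or 1, so n lies in exactly one of the 3^d translates of
    D(M^j) by these multiples of the lattice. *)
Let sum_shift n : box (- 1) 1 n ->
  \sum_(t : {ffun 'I_d -> 'I_3}) (n - shift t \in E)%:R = 1 :> R[i].
Proof.
move=> hn.
have tq i : exists t : 'I_3, tern t = @lattice_quo R d a n i 0.
  rewrite mxE; set x := nd n i 0.
  have /andP[h1 h2] := hn i; rewrite -/x in h1 h2.
  have [x1|x1] := ltP x (- 2^-1).
    exists (@Ordinal 3 0 isT); apply/esym/floor_def; apply/andP; split.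
      by rewrite /tern /= sub0r intrN; lra.
    by rewrite /tern /= sub0r addNr; lra.
  have [x2|x2] := ltP x 2^-1.
    exists (@Ordinal 3 1 isT); apply/esym/floor_def; apply/andP; split.
      by rewrite /tern /= subrr; lra.
    by rewrite /tern /= subrr add0r; lra.
  exists (@Ordinal 3 2 isT); apply/esym/floor_def; apply/andP; split.
    by rewrite /tern /=; lra.
  by rewrite /tern /=; lra.
have [t ht] := choice tq.
rewrite (bigD1 [ffun i => t i])//= big1 ?addr0.
  have -> // : n - shift [ffun i => t i] \in E.
  apply/mem_residues => //.
  have -> : shift [ffun i => t i] = lattice_mul a (@lattice_quo R d a n).
    by congr lattice_mul; apply/colP => i; rewrite mxE ffunE ht.
  exact: lattice_red_box.
move=> u ut; case: (boolP (n - shift u \in E)) => // /(mem_residues a_neq0) hu.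
exfalso; move/negP: ut; apply; apply/eqP/ffunP => i; rewrite ffunE.
have := lattice_quo_unique a_neq0 hu => /(congr1 (fun w : 'cV[int]_d => w i 0)).
rewrite -ht mxE /tern => /addIr [] e; exact/val_inj.
Qed.

(** V is a Fejer-type kernel |chi E|^2 / N multiplied by the sum of the 3^d characters [shift t].
    For l and b in D(M^j) the sum l + b lies in [-1, 1), so by [sum_shift] each b contributes
    exactly 1/N to the coefficient at l. Bounding the characters by 1 leaves 3^d |chi E|^2 / N as
    majorant, with constant node sums. *)
Lemma full_kernel : exists V Phi, [/\ tpoly V,
  (forall k, box (- 2^-1) 2^-1 k -> fourier V k = 1),
  (forall x, \sum_(k <- E) Phi (x - nd k) = 3 ^+ d * N) &
  majorant V Phi (3 ^+ d)].
Proof.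
have uE : uniq E by exact: residues_uniq.
have N0 : 0 < N by exact: sizeR_residues_gt0.
pose V (x : 'cV[R]_d) : R[i] := \sum_(b <- E) (N^-1)%:C%C *
  \sum_(t : {ffun 'I_d -> 'I_3}) \sum_(k <- E) character (shift t + k - b) x.
pose Phi (x : 'cV[R]_d) : R := (3 ^+ d / N) * normc (chi E x) ^+ 2.
have tV1 (b : 'cV[int]_d) : tpoly (fun x : 'cV[R]_d =>
    \sum_(t : {ffun 'I_d -> 'I_3}) \sum_(k <- E) character (shift t + k - b) x).
  by apply: tpoly_sum => t; apply: tpoly_sum => k; exact: tpoly_character.
have tV : tpoly V by apply: tpoly_sumZ.
have mc : measurable_fun [set: 'cV[R]_d] (fun x => normc (chi E x) ^+ 2).
  apply: measurable_funX; apply: measurable_normc; apply: cmeasurable_tpoly.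
  exact: tpoly_chi.
exists V, Phi; split => //.
- move=> l hl.
  rewrite fourier_sum; last by move=> b; apply: L1Z; exact: L1_tpoly.
  rewrite (eq_big_seq (fun=> (N^-1)%:C%C)).
    rewrite big_const_seq count_predT iter_addr_0 -rmorphMn /= -mulr_natr -/N.
    by rewrite mulVf ?gt_eqF.
  move=> b /(mem_residues a_neq0) hb; rewrite fourierZ; last exact: L1_tpoly.
  rewrite -[RHS]mulr1; congr (_ * _).
  rewrite -(@sum_shift (l + b)); last first.
    move=> i; rewrite lattice_nodeD mxE; have /andP[h1 h2] := hl i.
    have /andP[h3 h4] := hb i; apply/andP; split; lra.
  rewrite fourier_sum; last first.
    by move=> t; apply: L1_tpoly; apply: tpoly_sum => k; exact: tpoly_character.
  apply: eq_bigr => t _; rewrite fourier_sum; last by move=> k; exact: L1_character.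
  transitivity (\sum_(k <- E) 1 * (k == l + b - shift t)%:R : R[i]).
    apply: eq_bigr => k _; rewrite fourier_character mul1r.
    by rewrite subr_eq [k == _]eq_sym subr_eq [in RHS]eq_sym [k + _]addrC.
  by rewrite (@sum_eq_uniq R d E (fun=> 1))//; case: ifP.
- move=> x; rewrite /Phi -mulr_sumr sum_normc2_chi_node//.
  by rewrite -/N expr2 mulrA divfK ?gt_eqF.
- split.
  + exact: measurable_funM.
  + by move=> x; rewrite mulr_ge0 ?sqr_ge0// divr_ge0 ?exprn_ge0// ltW.
  + move=> x.
    have -> : V x = (N^-1)%:C%C * ((\sum_(t : {ffun 'I_d -> 'I_3}) character (shift t) x) *
        (chi E x * conjc (chi E x))).
      rewrite /V -mulr_sumr; congr (_ * _).
      rewrite mulrA {2}/chi rmorph_sum mulr_sumr; apply: eq_bigr => b _.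
      rewrite -mulrA !mulr_suml; apply: eq_bigr => t _.
      rewrite mulr_sumr; apply: eq_bigr => k _.
      by rewrite !characterDl characterNl mulrA.
    rewrite !normcM normcJ' normc_real ger0_norm ?invr_ge0 ?(ltW N0)//.
    rewrite /Phi -expr2 mulrA ler_wpM2r ?sqr_ge0// mulrC ler_wpM2r ?invr_ge0 ?(ltW N0)//.
    rewrite (le_trans (normc_sum _ _ _))//.
    under eq_bigr do rewrite normc_character.
    by rewrite sumr_const card_ffun !card_ord natrX.
  + move=> y b hb; rewrite /Phi.
    under eq_integral do rewrite EFinM.
    rewrite ge0_integralZl_EFin//; last 3 first.
    * by move=> x _; rewrite lee_fin sqr_ge0.
    * apply/measurable_EFinP.
      exact: (measurableT_comp mc (measurable_affine_cV y b)).
    * by rewrite divr_ge0 ?exprn_ge0// ltW.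
    rewrite integral_normc2_chi_affine// -EFinM lee_fin -/N divfK ?gt_eqF//.
Qed.

End vallee_poussin.

(** * Extended norms and the Schur test *)

Section torus_tonelli.
Context {R : realType} {d : nat}.
Notation torus := (@torus_measure R d).
Local Open Scope ereal_scope.

(** A copy of the torus measure that carries the sigma-finite structure for Tonelli's theorem. *)
Definition torus_finite : set 'cV[R]_d -> \bar R := torus.

HB.instance Definition _ := isMeasure.Build _ _ _ torus_finite
  (measure0 torus) (measure_ge0 torus) (@measure_semi_sigma_additive _ _ _ torus).

Let sigma_finite_torus : sigma_finite [set: 'cV[R]_d] torus_finite.
Proof.
exists (fun=> setT); first by rewrite bigcup_const.
by move=> _; split => //; rewrite [X in X < _]torus_measureT ltry.
Qed.

HB.instance Definition _ := Measure_isSigmaFinite.Build _ _ _ torus_finite sigma_finite_torus.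

Lemma torus_finiteE (F : 'cV[R]_d -> \bar R) : \int[torus]_x F x = \int[torus_finite]_x F x.
Proof. exact: eq_measure_integral. Qed.

Lemma torus_tonelli (F : 'cV[R]_d -> 'cV[R]_d -> \bar R) :
  measurable_fun [set: 'cV[R]_d * 'cV[R]_d] (fun p => F p.1 p.2) ->
  (forall x y, 0 <= F x y) ->
  \int[torus]_x \int[torus]_y F x y = \int[torus]_y \int[torus]_x F x y.
Proof.
move=> mF F0.
rewrite torus_finiteE; under eq_integral do rewrite torus_finiteE.
rewrite [RHS]torus_finiteE; under [RHS]eq_integral do rewrite torus_finiteE.
by have := fubini_tonelli (m1 := torus_finite) (m2 := torus_finite) (fun p => F p.1 p.2) mF
  (fun p => F0 p.1 p.2).
Qed.

Lemma measurable_torus_integral (F : 'cV[R]_d -> 'cV[R]_d -> \bar R) :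
  measurable_fun [set: 'cV[R]_d * 'cV[R]_d] (fun p => F p.1 p.2) ->
  (forall x y, 0 <= F x y) ->
  measurable_fun [set: 'cV[R]_d] (fun x => \int[torus]_y F x y).
Proof.
move=> mF F0.
under eq_fun do rewrite torus_finiteE.
exact: (measurable_fun_fubini_tonelli_F (m2 := torus_finite) (fun p => F p.1 p.2) mF
  (fun p => F0 p.1 p.2)).
Qed.

End torus_tonelli.

Section extended_norms.
Context {R : realType} {d : nat}.
Notation torus := (@torus_measure R d).
Local Open Scope ereal_scope.
Notation "'N_ p [ f ]" := ('N[torus]_p[f]).
Implicit Types (f g u w : 'cV[R]_d -> R) (F G : 'cV[R]_d -> \bar R) (p q : \bar R).

Lemma torus_gt0 : 0 < torus setT.
Proof. by rewrite torus_measureT lte01. Qed.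

Lemma conjugate_cases p q : 1 <= p -> p^-1 + q^-1 = 1 ->
  [\/ p = 1 /\ q = +oo, p = +oo /\ q = 1 |
      exists r t : R, [/\ p = r%:E, q = t%:E, (1 < r)%R, (1 < t)%R & (r^-1 + t^-1 = 1)%R]].
Proof.
case: p => [r| |]//; last first.
  by move=> _; rewrite invey add0e => /eqP; rewrite inve_eq1 => /eqP ->; constructor 2.
rewrite lee_fin => r1; have rp : (0 < r)%R by exact: lt_le_trans ltr01 r1.
have r0 : (r != 0)%R by rewrite gt_eqF.
rewrite inver (negbTE r0).
case: q => [t| |]; rewrite ?invey ?inveNy//.
  rewrite inver; case: eqP => [//|/eqP t0].
  rewrite -EFinD => -[rt].
  have rV0 : (0 < r^-1)%R by rewrite invr_gt0.
  have rV1 : (r^-1 <= 1)%R by rewrite invf_le1.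
  have tV : (0 <= t^-1 < 1)%R by apply/andP; split; lra.
  have tV0 : (0 < t^-1)%R.
    by case/andP: tV => tV _; rewrite lt_neqAle tV eq_sym invr_eq0 t0.
  have t1 : (1 < t)%R.
    by rewrite -invf_lt1 ?(andP tV).2// -invr_gt0.
  constructor 3; exists r, t; split => //.
  have : (r^-1 < 1)%R by lra.
  by rewrite invf_lt1.
rewrite adde0 => -[/eqP]; rewrite invr_eq1 => /eqP ->; constructor 1; split => //.
Qed.

Lemma measurable_poweR_abse (r : R) F : measurable_fun setT F ->
  measurable_fun setT (fun x => `|F x| `^ r).
Proof.
move=> mF; have mA : measurable_fun setT (abse \o F) by exact: measurableT_comp.
exact: (measurableT_comp (measurable_poweR r) mA).
Qed.

Lemma le_torus_Lnorm p F G : 1 <= p -> measurable_fun setT F -> measurable_fun setT G ->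
  (forall x, 0 <= F x) -> (forall x, F x <= G x) -> 'N_p[F] <= 'N_p[G].
Proof.
move=> p1 mF mG F0 FG; have G0 x : 0 <= G x by exact: le_trans (FG x).
rewrite unlock; case: p p1 => [r| |]//.
  rewrite lee_fin => r1; have r0 : (0 <= r)%R by rewrite (le_trans _ r1).
  apply: gt0_ler_poweR; rewrite ?invr_ge0//.
  - by rewrite in_itv/= leey andbT integral_ge0// => x _; exact: poweR_ge0.
  - by rewrite in_itv/= leey andbT integral_ge0// => x _; exact: poweR_ge0.
  apply: ge0_le_integral => //.
  - by move=> x _; exact: poweR_ge0.
  - exact: measurable_poweR_abse.
  - exact: measurable_poweR_abse.
  move=> x _; apply: gt0_ler_poweR; rewrite ?in_itv/= ?leey ?abse_ge0//.
  by rewrite !gee0_abs.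
move=> _; rewrite torus_gt0; apply: le_ess_sup; apply: nearW => x /=.
by rewrite !gee0_abs.
Qed.

Lemma torus_Lnorm_cst p (c : R) : 1 <= p -> (0 <= c)%R -> 'N_p[(fun=> c%:E)] = c%:E.
Proof.
move=> p1 c0; rewrite unlock; case: p p1 => [r| |]//.
  rewrite lee_fin => r1; have r0 : (r != 0)%R by rewrite gt_eqF// (lt_le_trans _ r1).
  under eq_integral do rewrite gee0_abs ?lee_fin//.
  rewrite poweR_EFin integral_cst// [X in _ * X]torus_measureT mule1 -poweR_EFin.
  by rewrite -poweRrM divff// poweRe1// lee_fin.
by move=> _; rewrite torus_gt0 ess_sup_cst ?torus_gt0// gee0_abs// lee_fin.
Qed.

Lemma torus_LnormZ p (c : R) F : 1 <= p -> measurable_fun setT F -> (0 <= c)%R ->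
  'N_p[(fun x => c%:E * F x)] = c%:E * 'N_p[F].
Proof.
move=> p1 mF c0; rewrite unlock; case: p p1 => [r| |]//.
  rewrite lee_fin => r1; have r0 : (r != 0)%R by rewrite gt_eqF// (lt_le_trans _ r1).
  under eq_integral do rewrite abseM poweRM// gee0_abs ?lee_fin//.
  rewrite poweR_EFin ge0_integralZl_EFin ?powR_ge0//.
  - rewrite poweRM ?lee_fin ?powR_ge0 ?integral_ge0//; last by move=> x _; exact: poweR_ge0.
    by rewrite -poweR_EFin -poweRrM divff// poweRe1// lee_fin.
  - by move=> x _; exact: poweR_ge0.
  - exact: measurable_poweR_abse.
move=> _; rewrite torus_gt0 -(ess_supZl _ torus_gt0 c0).
by congr ess_sup; apply/funext => x /=; rewrite abseM gee0_abs ?lee_fin.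
Qed.

Lemma torus_LnormD p f g : 1 <= p -> measurable_fun setT f -> measurable_fun setT g ->
  'N_p[(fun x => (f x + g x)%:E)] <= 'N_p[(fun x => (f x)%:E)] + 'N_p[(fun x => (g x)%:E)].
Proof. by move=> p1 mf mg; exact: eminkowski. Qed.

Lemma torus_hoelder p q f g : 1 <= p -> p^-1 + q^-1 = 1 ->
  measurable_fun setT f -> measurable_fun setT g ->
  (forall x, 0 <= f x)%R -> (forall x, 0 <= g x)%R ->
  \int[torus]_x (f x * g x)%:E <= 'N_p[(fun x => (f x)%:E)] * 'N_q[(fun x => (g x)%:E)].
Proof.
move=> p1 pq mf mg f0 g0.
have H (u w : 'cV[R]_d -> R) : measurable_fun setT u -> measurable_fun setT w ->
    (forall x, 0 <= u x)%R -> (forall x, 0 <= w x)%R ->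
    \int[torus]_x (u x * w x)%:E <= 'N_1[(fun x => (u x)%:E)] * 'N_(+oo)[(fun x => (w x)%:E)].
  move=> mu mw u0 w0; rewrite Lnorm1.
  under [X in _ <= X * _]eq_integral do rewrite gee0_abs ?lee_fin//.
  have : 0 <= 'N_(+oo)[(fun x => (w x)%:E)] by exact: Lnorm_ge0.
  have W : \forall x \ae torus, (w x)%:E <= 'N_(+oo)[(fun x => (w x)%:E)].
    rewrite unlock torus_gt0.
    have := ess_sup_ge torus (abse \o (fun x => (w x)%:E)).
    by apply: filterS => x; rewrite /= ger0_norm.
  move: W; case: ('N_(+oo)[_]) => [M|_ _|]//.
    move=> W M0; rewrite muleC -ge0_integralZl_EFin//.
    - apply: ae_ge0_le_integral => //.
      + by move=> x _; rewrite lee_fin mulr_ge0.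
      + by apply/measurable_EFinP; exact: measurable_funM.
      + by move=> x _; rewrite mule_ge0 ?lee_fin.
      + by apply: measurable_funeM; apply/measurable_EFinP.
      apply: filterS W => x; rewrite !lee_fin => wM _.
      by rewrite mulrC ler_wpM2r.
    - by move=> x _; rewrite lee_fin.
    - exact/measurable_EFinP.
  (* Here the essential supremum of w is infinite. The right-hand side is +oo unless u vanishes
     almost everywhere; in that case it is 0 by the convention 0 * +oo = 0, and the left-hand side
     must be shown to vanish too. *)
  have [I0|I0] := eqVneq (\int[torus]_x (u x)%:E) 0; last first.
    rewrite gt0_muley ?leey// lt0e I0/= integral_ge0// => x _; rewrite lee_fin//.
  rewrite I0 mul0e.
  have ae0 : ae_eq torus setT (fun x => (u x)%:E) (cst 0).
    apply/(ae_eq_integral_abs torus measurableT); first exact/measurable_EFinP.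
    by rewrite -[RHS]I0; apply: eq_integral => x _; rewrite gee0_abs ?lee_fin.
  rewrite le_eqVlt; apply/orP; left; apply/eqP.
  rewrite (ae_eq_integral (cst 0)) ?integral0//.
    by apply/measurable_EFinP; exact: measurable_funM.
  by apply: filterS ae0 => x h _; have [->] := h Logic.I; rewrite mul0r.
case: (conjugate_cases p1 pq) => [[-> ->]|[-> ->]|[r [t [-> -> r1 t1 rt]]]].
- exact: H.
- by under eq_integral do rewrite mulrC; rewrite muleC; exact: H.
- have := hoelder torus mf mg (lt_trans ltr01 r1) (lt_trans ltr01 t1) rt.
  rewrite Lnorm1; apply: le_trans.
  rewrite le_eqVlt; apply/orP; left; apply/eqP; apply: eq_integral => x _ /=.
  by rewrite ger0_norm// mulr_ge0.
Qed.

End extended_norms.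

(** * The Schur test with a weight *)

Section weighted_schur_test.
Context {R : realType} {d : nat}.
Notation torus := (@torus_measure R d).
Local Open Scope ereal_scope.
Notation "'N_ p [ f ]" := ('N[torus]_p[f]).

Lemma torus_LnormE (r : R) (u : 'cV[R]_d -> R) : (forall x, 0 <= u x)%R ->
  'N_r%:E[(fun x => (u x)%:E)] = (\int[torus]_x (u x `^ r)%:E) `^ r^-1.
Proof.
move=> u0; rewrite unlock; congr (_ `^ _).
by apply: eq_integral => x _; rewrite gee0_abs ?lee_fin.
Qed.

Variables (K : 'cV[R]_d -> 'cV[R]_d -> R) (w F : 'cV[R]_d -> R) (c : R).
Hypothesis mK : measurable_fun [set: 'cV[R]_d * 'cV[R]_d] (fun z => K z.1 z.2).
Hypothesis mw : measurable_fun [set: 'cV[R]_d] w.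
Hypothesis mF : measurable_fun [set: 'cV[R]_d] F.
Hypothesis K0 : forall x y, (0 <= K x y)%R.
Hypothesis w0 : forall x, (0 <= w x)%R.
Hypothesis F0 : forall x, (0 <= F x)%R.
Hypothesis c0 : (0 <= c)%R.
Hypothesis Kw : forall y, \int[torus]_x (K x y)%:E <= (c * w y)%:E.

Let mKl x : measurable_fun [set: 'cV[R]_d] (K x).
Proof. exact: (measurableT_comp mK (measurable_fun_pair (measurable_cst x) (@measurable_id _ _ _))). Qed.

Let mKr y : measurable_fun [set: 'cV[R]_d] (fun x => K x y).
Proof. exact: (measurableT_comp mK (measurable_fun_pair (@measurable_id _ _ _) (measurable_cst y))). Qed.

Let mpow (u : 'cV[R]_d -> R) (r : R) : measurable_fun [set: 'cV[R]_d] u ->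
  measurable_fun [set: 'cV[R]_d] (fun x => u x `^ r)%R.
Proof. by move=> mu; exact: (measurableT_comp (measurable_powR r) mu). Qed.

Let mKg (g : 'cV[R]_d -> R) : measurable_fun [set: 'cV[R]_d] g ->
  measurable_fun [set: 'cV[R]_d * 'cV[R]_d] (fun z => (K z.1 z.2 * g z.2)%:E).
Proof.
move=> mg; apply/measurable_EFinP; apply: measurable_funM => //.
exact: (measurableT_comp mg measurable_snd).
Qed.

Let tonelli_Kg (g : 'cV[R]_d -> R) : measurable_fun [set: 'cV[R]_d] g ->
  (forall y, 0 <= g y)%R ->
  \int[torus]_x \int[torus]_y (K x y * g y)%:E <= c%:E * \int[torus]_y (w y * g y)%:E.
Proof.
move=> mg g0.
rewrite (torus_tonelli (F := fun x y => (K x y * g y)%:E)); last 2 first.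
- exact: mKg.
- by move=> x y; rewrite lee_fin mulr_ge0.
rewrite -ge0_integralZl_EFin//; last 2 first.
- by move=> y _; rewrite lee_fin mulr_ge0.
- by apply/measurable_EFinP; exact: measurable_funM.
apply: ge0_le_integral => //.
- by move=> y _; apply: integral_ge0 => x _; rewrite lee_fin mulr_ge0.
- apply: (measurable_torus_integral (F := fun y x => (K x y * g y)%:E)).
    have sw : measurable_fun [set: 'cV[R]_d * 'cV[R]_d] (fun z : 'cV[R]_d * 'cV[R]_d => (z.2, z.1)).
      exact: measurable_fun_pair.
    exact: (measurableT_comp (mKg mg) sw).
  by move=> x y; rewrite lee_fin mulr_ge0.
- by apply: measurable_funeM; apply/measurable_EFinP; exact: measurable_funM.
move=> y _; under eq_integral do rewrite mulrC EFinM.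
rewrite ge0_integralZl_EFin//; last 2 first.
- by move=> x _; rewrite lee_fin.
- by apply/measurable_EFinP; exact: mKr.
apply: (@le_trans _ _ ((g y)%:E * (c * w y)%:E)); first by rewrite lee_wpmul2l ?lee_fin.
by rewrite -!EFinM lee_fin mulrC mulrA.
Qed.

(* K F = (K^(1/q) w^(1/p)) (K^(1/p) w^(-1/p) F), followed by Hoelder's inequality in y
   and Tonelli's theorem. *)
Lemma weighted_schur (p q : \bar R) : 1 <= p -> p^-1 + q^-1 = 1 ->
  (forall x y, w y = 0%R -> K x y = 0%R) ->
  (forall x (t : R), q = t%:E ->
    \int[torus]_y (K x y * w y `^ (t - 1))%:E <= c%:E * \int[torus]_y (w y `^ t)%:E) ->
  'N_p[(fun x => \int[torus]_y (K x y * F y)%:E)] <=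
  c%:E * 'N_q[(fun y => (w y)%:E)] * 'N_p[(fun y => (F y)%:E)].
Proof.
move=> p1 pq wK Kq.
have mG : measurable_fun [set: 'cV[R]_d] (fun x => \int[torus]_y (K x y * F y)%:E).
  apply: (measurable_torus_integral (F := fun x y => (K x y * F y)%:E)); first exact: mKg.
  by move=> x y; rewrite lee_fin mulr_ge0.
have G0 x : 0 <= \int[torus]_y (K x y * F y)%:E.
  by apply: integral_ge0 => y _; rewrite lee_fin mulr_ge0.
case: (conjugate_cases p1 pq) => [[pE qE]|[pE qE]|[r [t [pE qE r1 t1 rt]]]].
- rewrite pE qE Lnorm1; under eq_integral do rewrite gee0_abs//.
  apply: le_trans (tonelli_Kg mF F0) _.
  rewrite -muleA lee_wpmul2l ?lee_fin//.
  under eq_integral do rewrite mulrC.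
  rewrite muleC; apply: torus_hoelder => //.
  by rewrite inve1 invey adde0.
(* For t = 1 the weight disappears from the row hypothesis, which becomes a bound on the L_1 norm of
   K(x, .); Hoelder with exponents 1 and +oo concludes. *)
- have := Kq _ 1%R qE; rewrite pE qE.
  have -> : \int[torus]_y (w y `^ 1)%:E = 'N_1[(fun y => (w y)%:E)].
    by rewrite Lnorm1; apply: eq_integral => y _; rewrite powRr1// gee0_abs ?lee_fin.
  move=> {}Kq.
  rewrite [in leLHS]unlock torus_gt0; apply/ess_supP; apply: nearW => x /=.
  rewrite gee0_abs//.
  apply: le_trans (@torus_hoelder _ _ 1 +oo (K x) F _ _ _ _ _ _) _ => //.
    by rewrite inve1 invey adde0.
  rewrite lee_wpmul2r ?Lnorm_ge0//; apply: le_trans (Kq x).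
  rewrite Lnorm1 le_eqVlt; apply/orP; left; apply/eqP; apply: eq_integral => y _.
  by rewrite subrr powRr0 mulr1 gee0_abs ?lee_fin.
have rp : (0 < r)%R by exact: lt_trans ltr01 r1.
have tp : (0 < t)%R by exact: lt_trans ltr01 t1.
have rn0 : (r != 0)%R by rewrite gt_eqF.
have tn0 : (t != 0)%R by rewrite gt_eqF.
have tr : (t / r = t - 1)%R.
  have -> : (r^-1 = 1 - t^-1)%R by lra.
  by rewrite mulrBr mulr1 divff.
pose S := \int[torus]_y (w y `^ t)%:E.
(* The r-th power of the second Hoelder factor. When it is integrated in x, the weight in the column
   bound [Kw] cancels w^(-1), which leaves c times the integral of F^r. *)
pose J x := \int[torus]_y (K x y * ((w y)^-1 * F y `^ r))%:E.
have S0 : 0 <= S by apply: integral_ge0 => y _; rewrite lee_fin powR_ge0.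
have cS0 : 0 <= c%:E * S by rewrite mule_ge0 ?lee_fin.
have mwF : measurable_fun [set: 'cV[R]_d] (fun y => (w y)^-1 * F y `^ r)%R.
  apply: measurable_funM; last exact: mpow.
  have -> : (fun y => (w y)^-1)%R = (fun y => w y `^ (-1))%R.
    by apply/funext => y; rewrite powR_inv1.
  exact: (mpow (-1) mw).
have wF0 y : (0 <= (w y)^-1 * F y `^ r)%R by rewrite mulr_ge0 ?invr_ge0 ?powR_ge0.
have mJ : measurable_fun [set: 'cV[R]_d] J.
  apply: (measurable_torus_integral (F := fun x y => (K x y * ((w y)^-1 * F y `^ r))%:E)).
    exact: (mKg mwF).
  by move=> x y; rewrite lee_fin mulr_ge0.
have J0 x : 0 <= J x by apply: integral_ge0 => y _; rewrite lee_fin mulr_ge0.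
have Ktr (b : R) : (0 <= b)%R -> (b `^ t^-1 * b `^ r^-1 = b)%R.
  have tr1 : (t^-1 + r^-1 = 1)%R by lra.
  by move=> b0; rewrite -powRD tr1 ?oner_eq0// powRr1.
have Gx x : \int[torus]_y (K x y * F y)%:E <= (c%:E * S) `^ t^-1 * (J x) `^ r^-1.
  pose f y := ((K x y) `^ t^-1 * (w y) `^ r^-1)%R.
  pose g y := ((K x y) `^ r^-1 * ((w y) `^ (- r^-1) * F y))%R.
  have f0 y : (0 <= f y)%R by rewrite mulr_ge0 ?powR_ge0.
  have g0 y : (0 <= g y)%R by rewrite !mulr_ge0 ?powR_ge0.
  have mf : measurable_fun [set: 'cV[R]_d] f by apply: measurable_funM; exact: mpow.
  have mg : measurable_fun [set: 'cV[R]_d] g.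
    by apply: measurable_funM; [exact: mpow|apply: measurable_funM => //; exact: mpow].
  have fg y : (K x y * F y = f y * g y)%R.
    (* Where w vanishes the powers of w do not cancel, but there K vanishes as well. *)
    rewrite /f /g; have [wy0|wy] := eqVneq (w y) 0%R.
      by rewrite (wK x y wy0) powR0 ?invr_neq0// !mul0r.
    have -> : (K x y `^ t^-1 * w y `^ r^-1 * (K x y `^ r^-1 * (w y `^ (- r^-1) * F y)) =
      (K x y `^ t^-1 * K x y `^ r^-1) * ((w y `^ r^-1 * w y `^ (- r^-1)) * F y))%R by ring.
    by rewrite Ktr// -powRD ?wy ?implybT// subrr powRr0 mul1r.
  under eq_integral do rewrite fg.
  apply: le_trans (@torus_hoelder _ _ t%:E r%:E f g _ _ _ _ _ _) _ => //.
  - by rewrite lee_fin ltW.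
  - by rewrite !inver (negbTE rn0) (negbTE tn0) -EFinD addrC rt.
  rewrite !torus_LnormE//; apply: lee_pmul; rewrite ?poweR_ge0//.
    apply: gt0_ler_poweR; rewrite ?invr_ge0 ?(ltW tp)//.
    - by rewrite in_itv/= leey andbT; apply: integral_ge0 => y _; rewrite lee_fin powR_ge0.
    - by rewrite in_itv/= leey andbT.
    apply: le_trans (Kq x t qE); rewrite le_eqVlt; apply/orP; left; apply/eqP.
    apply: eq_integral => y _; rewrite /f powRM ?powR_ge0// -!powRrM mulVf// powRr1//.
    by rewrite [(r^-1 * t)%R]mulrC tr.
  rewrite le_eqVlt; apply/orP; left; apply/eqP; congr (_ `^ _).
  apply: eq_integral => y _; rewrite /g !powRM ?mulr_ge0 ?powR_ge0// -!powRrM mulVf// powRr1//.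
  by rewrite mulNr mulVf// powR_inv1.
rewrite pE qE [in leLHS]unlock; under eq_integral do rewrite gee0_abs//.
apply: (@le_trans _ _ ((c%:E * S) `^ t^-1 * (\int[torus]_x J x) `^ r^-1)).
  have -> : (c%:E * S) `^ t^-1 = ((c%:E * S) `^ t^-1 `^ r) `^ r^-1.
    by rewrite -[RHS]poweRrM divff// poweRe1// poweR_ge0.
  rewrite -poweRM ?poweR_ge0//; last exact: integral_ge0.
  apply: gt0_ler_poweR; rewrite ?invr_ge0 ?(ltW rp)//.
  - by rewrite in_itv/= leey andbT; apply: integral_ge0 => y _; exact: poweR_ge0.
  - by rewrite in_itv/= leey andbT mule_ge0 ?poweR_ge0//; exact: integral_ge0.
  rewrite -ge0_integralZl ?poweR_ge0//.
  apply: ge0_le_integral => //.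
  - by move=> x _; exact: poweR_ge0.
  - exact: (measurableT_comp (measurable_poweR r) mG).
  - exact: emeasurable_funM.
  move=> x _.
  have -> : J x = (J x `^ r^-1) `^ r by rewrite -poweRrM mulVf// poweRe1.
  rewrite -poweRM ?poweR_ge0//; apply: gt0_ler_poweR; rewrite ?(ltW rp)//.
  - by rewrite in_itv/= leey andbT.
  - by rewrite in_itv/= leey andbT mule_ge0 ?poweR_ge0.
have JF : \int[torus]_x J x <= c%:E * \int[torus]_y (F y `^ r)%:E.
  apply: le_trans (tonelli_Kg mwF wF0) _; rewrite lee_wpmul2l ?lee_fin//.
  apply: ge0_le_integral => //.
  - by move=> y _; rewrite lee_fin mulr_ge0.
  - by apply/measurable_EFinP; exact: measurable_funM.
  - by apply/measurable_EFinP; exact: mpow.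
  move=> y _; rewrite lee_fin; have [->|wy] := eqVneq (w y) 0%R.
    by rewrite mul0r powR_ge0.
  by rewrite mulrA divff// mul1r.
have IF0 : 0 <= \int[torus]_y (F y `^ r)%:E.
  by apply: integral_ge0 => y _; rewrite lee_fin powR_ge0.
apply: (@le_trans _ _ ((c%:E * S) `^ t^-1 * (c%:E * \int[torus]_y (F y `^ r)%:E) `^ r^-1)).
  rewrite lee_wpmul2l ?poweR_ge0//; apply: gt0_ler_poweR => //.
  - by rewrite invr_ge0 ltW.
  - by rewrite in_itv/= leey andbT integral_ge0.
  - by rewrite in_itv/= leey andbT mule_ge0 ?lee_fin.
rewrite !poweRM ?lee_fin// muleACA !torus_LnormE// -/S muleA.
by rewrite !poweR_EFin -EFinM Ktr.
Qed.

End weighted_schur_test.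

(** * Continuous periodic functions are measurable and bounded *)

Section continuous_periodic.
Context {R : realType} {d : nat}.
Implicit Types (u : 'cV[R]_d -> R).

Let grid (n : nat) (x : 'cV[R]_d) : 'cV[int]_d := \col_i Num.floor (n.+1%:R * x i 0).

Let grid_point (n : nat) (k : 'cV[int]_d) : 'cV[R]_d := \col_i ((k i 0)%:~R / n.+1%:R).

Let measurable_grid n (k : 'cV[int]_d) : measurable [set x | grid n x = k].
Proof.
rewrite (_ : [set x | _] = product_set (fun i => (fun t : R => n.+1%:R * t) @^-1`
    `[(k i 0)%:~R, (k i 0 + 1)%:~R[%classic)).
  apply: measurable_product_set => i; rewrite -[X in measurable X]setTI.
  have mf : measurable_fun [set: R] (fun t : R => n.+1%:R * t) by exact: measurable_funM.
  by apply: mf => //; exact: measurable_itv.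
apply/seteqP; split => [x /= <- i|x /= h].
  by rewrite mxE /= in_itv/=; exact: floor_itv.
apply/colP => i; rewrite mxE; apply: floor_def.
by have := h i; rewrite /= in_itv.
Qed.

Let grid_cvg (x : 'cV[R]_d) : grid_point n (grid n x) @[n --> \oo] --> x.
Proof.
apply/cvg_ballP => e e0.
have [N _ hN] := @near_infty_natSinv_lt R (PosNum e0).
exists N => // n /= /hN /= hn; split => // i j; rewrite ord1 /ball /= !mxE.
have /andP[h1 h2] := floor_itv (n.+1%:R * x i 0).
rewrite intrD in h2; set t : R := (Num.floor _)%:~R in h1 h2 *.
apply: le_lt_trans hn.
have -> : x i 0 - t / n.+1%:R = (n.+1%:R * x i 0 - t) / n.+1%:R by field.
by rewrite normrM ger0_norm ?subr_ge0// ger0_norm ?invr_ge0// ler_piMl ?invr_ge0//; lra.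
Qed.

(** The sigma-algebra on vectors is generated by the coordinates, not by the open sets.
    Measurability is obtained by writing u as the pointwise limit of its values at grid points,
    which are constant on countably many measurable cells. *)
Lemma continuous_measurable_cV u : continuous u -> measurable_fun [set: 'cV[R]_d] u.
Proof.
move=> cu; apply: (@measurable_fun_cvg _ _ _ _ (fun n x => u (grid_point n (grid n x)))).
  move=> n _ Y mY; rewrite setTI.
  rewrite (_ : _ @^-1` _ = \bigcup_k (if `[< Y (u (grid_point n k)) >] then
      [set x | grid n x = k] else set0)).
    apply: countable_bigcupT_measurable; first exact: countableP.
    by move=> k; case: ifP => _; [exact: measurable_grid|exact: measurable0].
  apply/seteqP; split => [x /= Yx|x [k _]].
    by exists (grid n x) => //; rewrite asboolT.
  by case: ifP => // /asboolP Yk /= e; rewrite e.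
by move=> x _; apply: continuous_cvg; [exact: cu|exact: grid_cvg].
Qed.

Lemma ccontinuous_cmeasurable (f : 'cV[R]_d -> R[i]) : ccontinuous f -> cmeasurable f.
Proof. by move=> [c1 c2]; split; exact: continuous_measurable_cV. Qed.

Let continuous_trmx : continuous (@trmx R 1 d).
Proof.
move=> x; apply/(@cvg_ballP R _ _ (nbhs x) (nbhs_filter x)) => e e0; apply/nbhs_ballP; exists e => //= y [_ h].
by split => // i j; rewrite !mxE; exact: h.
Qed.

Let compact_cell : compact [set x : 'cV[R]_d | forall i, `[- 2^-1, 2^-1]%classic (x i 0)].
Proof.
rewrite (_ : [set x | _] = trmx @` [set v : 'rV[R]_d | forall i, `[- 2^-1, 2^-1]%classic (v ord0 i)]).
  apply: continuous_compact; first exact: (continuous_subspaceT continuous_trmx).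
  apply: (@rV_compact R d (fun=> `[- 2^-1, 2^-1]%classic)) => i.
  exact: (@segment_compact R).
apply/seteqP; split => [x /= h|_ [v h <-] i].
  by exists x^T; [move=> i; rewrite mxE; have := h i; rewrite (ord1 ord0)|rewrite trmxK].
by rewrite mxE; have := h i; rewrite (ord1 ord0).
Qed.

Lemma continuous_periodic_bounded u : continuous u ->
  (forall k x, u (x + intvec k) = u x) -> exists B, forall x, `|u x| <= B.
Proof.
move=> cu pu.
have [B [_ hB]] : bounded_set (u @` [set x : 'cV[R]_d | forall i, `[- 2^-1, 2^-1]%classic (x i 0)]).
  apply: compact_bounded; apply: continuous_compact compact_cell.
  exact: continuous_subspaceT.
exists (B + 1) => x.
pose k : 'cV[int]_d := \col_i (- Num.floor (x i 0 + 2^-1)).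
rewrite -(pu k x); apply: (hB (B + 1)); first by lra.
exists (x + intvec k) => // i /=.
rewrite in_itv/= !mxE intrN.
have /andP[h1 h2] := floor_itv (x i 0 + 2^-1); rewrite intrD in h2.
by apply/andP; split; lra.
Qed.

Lemma ccontinuous_bounded (f : 'cV[R]_d -> R[i]) : ccontinuous f -> Defs.periodic f ->
  exists B, forall x, normc (f x) <= B.
Proof.
move=> [c1 c2] pf.
have [B1 h1] : exists B, forall x, `|Re (f x)| <= B.
  by apply: (continuous_periodic_bounded c1) => k x; rewrite pf.
have [B2 h2] : exists B, forall x, `|Im (f x)| <= B.
  by apply: (continuous_periodic_bounded c2) => k x; rewrite pf.
exists (B1 + B2) => x; rewrite (le_trans (normc_le_ReIm _))//; exact: lerD.
Qed.

End continuous_periodic.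

(** * Norms of complex-valued functions on the torus *)

Section Lp_norms.
Context {R : realType} {d : nat}.
Notation torus := (@torus_measure R d).
Implicit Types (f g : 'cV[R]_d -> R[i]) (p q : \bar R).

Lemma Lp_norm_ge0 p f : (0 <= Lp_norm p f)%E.
Proof. exact: Lnorm_ge0. Qed.

Lemma Lp_normZ p (c : R[i]) f : (1 <= p)%E -> cmeasurable f ->
  Lp_norm p (fun x => c * f x) = ((normc c)%:E * Lp_norm p f)%E.
Proof.
move=> p1 mf; rewrite /Lp_norm -torus_LnormZ ?normc_ge0//; last exact: measurable_EFin_normc.
by congr Lnorm; apply/funext => x; rewrite normcM EFinM.
Qed.

Lemma le_Lp_norm p f g : (1 <= p)%E -> cmeasurable f -> cmeasurable g ->
  (forall x, normc (f x) <= normc (g x)) -> (Lp_norm p f <= Lp_norm p g)%E.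
Proof.
move=> p1 mf mg fg; apply: le_torus_Lnorm => //; do ?exact: measurable_EFin_normc.
by move=> x; rewrite lee_fin normc_ge0.
Qed.

Lemma Lp_normD p f g : (1 <= p)%E -> cmeasurable f -> cmeasurable g ->
  (Lp_norm p (fun x => (f x + g x)%R) <= Lp_norm p f + Lp_norm p g)%E.
Proof.
move=> p1 mf mg; have mnf := measurable_normc mf; have mng := measurable_normc mg.
apply: le_trans (torus_LnormD p1 mnf mng); apply: le_torus_Lnorm => //.
- by apply: measurable_EFin_normc; exact: measurable_cfunD.
- by apply/measurable_EFinP; exact: measurable_funD.
- by move=> x; rewrite lee_fin normc_ge0.
- by move=> x; rewrite lee_fin le_normcD.
Qed.

Lemma Lp_normBC p f g : Lp_norm p (fun x => f x - g x) = Lp_norm p (fun x => g x - f x).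
Proof. by congr Lnorm; apply/funext => x; rewrite -opprB normcN. Qed.

Lemma Lp_norm_triangle p f g h : (1 <= p)%E -> cmeasurable f -> cmeasurable g -> cmeasurable h ->
  (Lp_norm p (fun x => (f x - g x)%R) <=
   Lp_norm p (fun x => (f x - h x)%R) + Lp_norm p (fun x => (h x - g x)%R))%E.
Proof.
move=> p1 mf mg mh; apply: le_trans (Lp_normD p1 (measurable_cfunB mf mh) (measurable_cfunB mh mg)).
rewrite le_eqVlt; apply/orP; left; apply/eqP; congr Lp_norm; apply/funext => x.
by rewrite addrA subrK.
Qed.

Lemma Lp_normB p f g : (1 <= p)%E -> cmeasurable f -> cmeasurable g ->
  (Lp_norm p (fun x => (f x - g x)%R) <= Lp_norm p f + Lp_norm p g)%E.
Proof.
move=> p1 mf mg.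
have m0 : cmeasurable (fun _ : 'cV[R]_d => 0 : R[i]) by exact: measurable_cfun_cst.
have := Lp_norm_triangle p1 mf mg m0.
rewrite [X in (_ <= _ + X)%E -> _]Lp_normBC.
have e (u : 'cV[R]_d -> R[i]) : (fun x => u x - 0) = u by apply/funext => x; rewrite subr0.
by rewrite !e.
Qed.

Lemma Lp_norm_bounded p f (B : R) : (1 <= p)%E -> cmeasurable f ->
  (forall x, normc (f x) <= B) -> (Lp_norm p f <= B%:E)%E.
Proof.
move=> p1 mf fB; have B0 : 0 <= B by rewrite (le_trans (normc_ge0 (f 0))).
rewrite -[leRHS](torus_Lnorm_cst (d := d) p1 B0); apply: le_torus_Lnorm => //.
- exact: measurable_EFin_normc.
- by move=> x; rewrite lee_fin normc_ge0.
Qed.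

Lemma L1_le_Lp_norm p q f : (1 <= p)%E -> (p^-1 + q^-1 = 1)%E -> cmeasurable f ->
  (\int[torus]_x (normc (f x))%:E <= Lp_norm p f)%E.
Proof.
move=> p1 pq mf.
have q1 : (1 <= q)%E.
  case: (conjugate_cases p1 pq) => [[_ ->]|[_ ->]|[r [t [_ -> _ t1 _]]]]//.
    by rewrite leey.
  by rewrite lee_fin ltW.
have := torus_hoelder p1 pq (measurable_normc mf) (measurable_cst (1 : R))
  (fun x => normc_ge0 _) (fun=> ler01).
by rewrite torus_Lnorm_cst// mule1; under eq_integral do rewrite mulr1.
Qed.

Lemma L1_Lebesgue p q f : (1 <= p)%E -> (p^-1 + q^-1 = 1)%E -> Lebesgue_space p f -> L1 f.
Proof.
move=> p1 pq [mf _ fi]; split => //; apply: le_lt_trans fi; exact: L1_le_Lp_norm pq mf.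
Qed.

Lemma approx_Lebesgue p f : (1 <= p)%E -> approx_space p f -> Lebesgue_space p f.
Proof.
move=> p1; rewrite /approx_space; case: eqP => // -> [cf pf].
have mf := ccontinuous_cmeasurable cf.
have [B fB] := ccontinuous_bounded cf pf.
by split => //; apply: le_lt_trans (Lp_norm_bounded _ mf fB) _; rewrite ?ltry ?leey.
Qed.

Lemma tpoly_Lebesgue p f : (1 <= p)%E -> tpoly f -> Lebesgue_space p f.
Proof.
move=> p1 tf; have mf := cmeasurable_tpoly tf; have [B _ fB] := tpoly_bounded tf.
split => //; first exact: periodic_tpoly.
by apply: le_lt_trans (Lp_norm_bounded p1 mf fB) _; rewrite ltry.
Qed.

Lemma tpoly_approx p f : (1 <= p)%E -> tpoly f -> approx_space p f.
Proof.
move=> p1 tf; rewrite /approx_space; case: eqP => _; last exact: tpoly_Lebesgue.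
by split; [exact: ccontinuous_tpoly|exact: periodic_tpoly].
Qed.

Lemma approx_spaceB p f g : (1 <= p)%E -> approx_space p f -> approx_space p g ->
  approx_space p (fun x => f x - g x).
Proof.
move=> p1; rewrite /approx_space; case: eqP => _.
  move=> [[f1 f2] pf] [[g1 g2] pg]; split; last by move=> k x; rewrite pf pg.
  split.
    have -> : (fun x => Re (f x - g x)) = (fun x => Re (f x)) - (fun x => Re (g x)).
      by apply/funext => x; rewrite complex_ReD complex_ReN.
    by move=> x; apply: continuousB; [exact: f1|exact: g1].
  have -> : (fun x => Im (f x - g x)) = (fun x => Im (f x)) - (fun x => Im (g x)).
    by apply/funext => x; rewrite complex_ImD complex_ImN.
  by move=> x; apply: continuousB; [exact: f2|exact: g2].
move=> [mf pf fi] [mg pg gi]; split.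
- exact: measurable_cfunB.
- by move=> k x; rewrite pf pg.
- have mNg : cmeasurable (fun x => (-1) * g x) by apply: measurable_cfunM.
  apply: (@le_lt_trans _ _ (Lp_norm p f + Lp_norm p (fun x => ((-1) * g x)%R))%E).
    apply: le_trans (Lp_normD p1 mf mNg).
    by under [in leRHS]eq_fun do rewrite mulN1r.
  rewrite Lp_normZ// normcN normc1 mul1e; exact: lte_add_pinfty.
Qed.

Lemma Lp_norm_affine p f (a : 'cV[R]_d) (b : R) : cmeasurable f -> Defs.periodic f ->
  b = 1 \/ b = -1 -> (1 <= p)%E -> Lp_norm p (fun x => f (a + b *: x)) = Lp_norm p f.
Proof.
move=> mf pf hb p1; have mn := measurable_EFin_normc mf.
have Lr (r : R) (F : 'cV[R]_d -> \bar R) :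
  'N[torus]_r%:E[F]%E = ((\int[torus]_x (`|F x| `^ r)) `^ r^-1)%E by rewrite unlock.
have Ly (F : 'cV[R]_d -> \bar R) : 'N[torus]_(+oo)[F]%E = ess_sup torus (abse \o F).
  by rewrite unlock torus_gt0.
case: p p1 => [r _| _|]//.
  have := @ge0_integral_torus_affine R d (fun x => (`|(normc (f x))%:E| `^ r)%E) a b.
  rewrite /Lp_norm !Lr => ->//; first exact: measurable_poweR_abse.
    by move=> x; exact: poweR_ge0.
  by move=> k x; rewrite pf.
rewrite /Lp_norm !Ly.
have mess : measurable_fun [set: 'cV[R]_d] (abse \o (fun x => (normc (f x))%:E)).
  exact: measurableT_comp.
have mess' : measurable_fun [set: 'cV[R]_d] (abse \o (fun x => (normc (f (a + b *: x)))%:E)).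
  exact: (measurableT_comp mess (measurable_affine_cV a b)).
(* The essential supremum depends only on the measures of the superlevel sets, and these are
   integrals of periodic indicators. *)
have e y : torus ((abse \o (fun x => (normc (f (a + b *: x)))%:E)) @^-1` `]y, +oo[%classic) =
    torus ((abse \o (fun x => (normc (f x))%:E)) @^-1` `]y, +oo[%classic).
  have mi : measurable (`]y, +oo[%classic : set (\bar R)) by exact: emeasurable_itv.
  pose A := (abse \o (fun x => (normc (f x))%:E)) @^-1` `]y, +oo[%classic.
  have mA : measurable A by rewrite -[A]setTI; exact: mess.
  pose A' := (abse \o (fun x => (normc (f (a + b *: x)))%:E)) @^-1` `]y, +oo[%classic.
  have mA' : measurable A' by rewrite -[A']setTI; exact: mess'.
  rewrite -/A -/A' -(setIT A) -(setIT A').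
  rewrite -!integral_indic//.
  rewrite -[RHS](@ge0_integral_torus_affine R d _ a b)//.
  - by apply/measurable_EFinP; exact: measurable_indic.
  - move=> k x; rewrite !indicE; congr (_%:R%:E); congr nat_of_bool.
    by apply/idP/idP => /set_mem h; apply/mem_set; move: h; rewrite /A /= pf.
by rewrite !ess_supEmu0//; congr ereal_inf; apply/seteqP; split => y /=; rewrite e.
Qed.

End Lp_norms.

(** * Convolution operators *)

Section convolution_operator_norm.
Context {R : realType} {d : nat}.
Notation torus := (@torus_measure R d).
Implicit Types (f g phi U V : 'cV[R]_d -> R[i]) (p q : \bar R).

Lemma cmeasurable_affine f (a : 'cV[R]_d) (b : R) : cmeasurable f ->
  cmeasurable (fun x => f (a + b *: x)).
Proof.
move=> [m1 m2]; have mN := measurable_affine_cV a b.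
split; first exact: (measurableT_comp m1 mN).
exact: (measurableT_comp m2 mN).
Qed.

Lemma cmeasurable_subl f (a : 'cV[R]_d) : cmeasurable f -> cmeasurable (fun x => f (a - x)).
Proof.
by move=> /(@cmeasurable_affine f a (-1)); under eq_fun do rewrite scaleN1r.
Qed.

Lemma L1_affine f (a : 'cV[R]_d) (b : R) : L1 f -> Defs.periodic f -> b = 1 \/ b = -1 ->
  L1 (fun x => f (a + b *: x)).
Proof.
move=> [mf fi] pf hb; split; first exact: cmeasurable_affine.
have := @ge0_integral_torus_affine R d (fun x => (normc (f x))%:E) a b.
move=> -> //; first exact: measurable_EFin_normc.
  by move=> x; rewrite lee_fin normc_ge0.
by move=> l x; rewrite pf.
Qed.

Lemma L1_reflect f : L1 f -> Defs.periodic f -> L1 (fun x => f (- x)).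
Proof.
move=> Lf pf; have := L1_affine 0 Lf pf (or_intror erefl).
by under eq_fun do rewrite add0r scaleN1r.
Qed.

Lemma normc_fourier_le f k : L1 f ->
  ((normc (fourier f k))%:E <= 2%:E * \int[torus]_x (normc (f x))%:E)%E.
Proof.
move=> [mf _]; apply: le_trans (normc_cintegral_le _) _.
  by apply: measurable_cfunM => //; exact: cmeasurable_character.
rewrite le_eqVlt; apply/orP; left; apply/eqP; congr (_ * _)%E.
by apply: eq_integral => x _; rewrite normcM normc_character mulr1.
Qed.

(** A crude uniform bound, good enough to show that [convolution_norm] is finite and that functions
    of norm zero are sent to zero. *)
Lemma convolution_bounded phi : tpoly phi -> exists2 B, 0 <= B &
  forall f, L1 f -> forall x,
    ((normc (convolution phi f x))%:E <= B%:E * \int[torus]_x (normc (f x))%:E)%E.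
Proof.
move=> [s [c [us phiE]]].
exists (\sum_(k <- s) normc (c k) * 2).
  by apply: sumr_ge0 => k _; rewrite mulr_ge0 ?normc_ge0.
move=> f Lf x; have -> : phi = fun x => \sum_(k <- s) c k * character k x by exact/funext.
rewrite convolutionE//.
have : (\int[torus]_x (normc (f x))%:E \is a fin_num)%E.
  by rewrite ge0_fin_numE ?Lf.2// integral_ge0// => y _; rewrite lee_fin normc_ge0.
move=> /fineK Ef; rewrite -Ef -EFinM lee_fin.
apply: le_trans (normc_sum _ _ _) _; rewrite mulr_suml; apply: ler_sum => k _.
rewrite !normcM normc_character mulr1 -mulrA ler_wpM2l ?normc_ge0//.
by have := normc_fourier_le k Lf; rewrite -Ef -EFinM lee_fin.
Qed.

Lemma convolutionZr phi (a : R[i]) f : tpoly phi -> L1 f ->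
  convolution phi (fun x => a * f x) = (fun x => a * convolution phi f x).
Proof.
move=> tphi Lf; apply: tpoly_fourier_inj.
- by apply: tpoly_convolution => //; exact: L1Z.
- by apply: tpolyZ; exact: tpoly_convolution.
move=> k; rewrite fourier_convolution//; last exact: L1Z.
rewrite !fourierZ ?fourier_convolution//; last by apply: L1_tpoly; exact: tpoly_convolution.
by rewrite mulrCA.
Qed.

Lemma convolutionBr phi f g : tpoly phi -> L1 f -> L1 g ->
  convolution phi (fun x => f x - g x) = (fun x => convolution phi f x - convolution phi g x).
Proof.
move=> tphi Lf Lg; apply: tpoly_fourier_inj.
- by apply: tpoly_convolution => //; exact: L1B.
- by apply: tpolyB; exact: tpoly_convolution.
move=> k; rewrite fourier_convolution//; last exact: L1B.
rewrite !fourierB ?fourier_convolution ?mulrBr//; by apply: L1_tpoly; exact: tpoly_convolution.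
Qed.

Lemma tpoly_reflect f : tpoly f -> tpoly (fun x => f (- x)).
Proof.
move=> [s [c [us fE]]].
have -> : (fun x => f (- x)) = (fun x => \sum_(k <- s) c k * character (- k) x).
  by apply/funext => x; rewrite fE; apply: eq_bigr => k _; rewrite characterNr.
by apply: tpoly_sumZ => k; exact: tpoly_character.
Qed.

Lemma conjugate_ge1 p q : (1 <= p)%E -> (p^-1 + q^-1 = 1)%E -> (1 <= q)%E.
Proof.
move=> p1 pq; case: (conjugate_cases p1 pq) => [[_ ->]|[_ ->]|[r [t [_ -> _ t1 _]]]]//.
  by rewrite leey.
by rewrite lee_fin ltW.
Qed.

Section fixed_exponents.
Variables (p q : \bar R) (phi : 'cV[R]_d -> R[i]).
Hypothesis p1 : (1 <= p)%E.
Hypothesis pq : (p^-1 + q^-1 = 1)%E.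
Hypothesis tphi : tpoly phi.

Let q1 : (1 <= q)%E := conjugate_ge1 p1 pq.

Let qp : (q^-1 + p^-1 = 1)%E. Proof. by rewrite addeC. Qed.

Lemma convolution_norm_ge0 : (0 <= convolution_norm phi q)%E.
Proof.
apply: (@le_trans _ _ (Lp_norm q (convolution phi (fun=> 0)))); first exact: Lp_norm_ge0.
apply: ereal_sup_ubound; exists (fun=> 0) => //; split; first exact: tpoly_Lebesgue q1 tpoly0.
apply: le_trans (@Lp_norm_bounded _ _ q (fun=> 0) 0 q1 (measurable_cfun_cst _ _) _) _ => //.
by move=> x; rewrite normc0.
Qed.

Lemma convolution_norm_lty : (convolution_norm phi q < +oo)%E.
Proof.
have [B B0 hB] := convolution_bounded tphi.
apply: (@le_lt_trans _ _ B%:E); last by rewrite ltry.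
apply: ge_ereal_sup => _ [f [Lf fle] <-].
have L1f := L1_Lebesgue q1 qp Lf.
apply: Lp_norm_bounded => //; first by apply: cmeasurable_tpoly; exact: tpoly_convolution.
move=> x; rewrite -lee_fin; apply: le_trans (hB _ L1f x) _.
rewrite -[leRHS]mule1 lee_wpmul2l ?lee_fin//.
by apply: le_trans (L1_le_Lp_norm q1 qp _) fle; case: Lf.
Qed.

Lemma convolution_norm_fin : convolution_norm phi q \is a fin_num.
Proof. by rewrite ge0_fin_numE ?convolution_norm_lty ?convolution_norm_ge0. Qed.

Lemma le_convolution_norm f : Lebesgue_space q f ->
  (Lp_norm q (convolution phi f) <= convolution_norm phi q * Lp_norm q f)%E.
Proof.
move=> Lf; have L1f := L1_Lebesgue q1 qp Lf; have [mf pf fi] := Lf.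
have : Lp_norm q f \is a fin_num by rewrite ge0_fin_numE ?Lp_norm_ge0.
move=> /fineK; set nu := fine _ => nuE.
have nu0 : 0 <= nu by rewrite fine_ge0// Lp_norm_ge0.
(* A function of norm zero cannot be normalised; its convolution vanishes identically because its
   integral norm is zero. *)
have [nuz|nun0] := eqVneq nu 0.
  have [B B0 hB] := convolution_bounded tphi.
  have f0 : (\int[torus]_x (normc (f x))%:E = 0)%E.
    apply/eqP; rewrite eq_le; apply/andP; split.
      by rewrite (le_trans (L1_le_Lp_norm q1 qp mf))// -nuE nuz.
    by apply: integral_ge0 => x _; rewrite lee_fin normc_ge0.
  apply: (@le_trans _ _ 0%E); last by rewrite mule_ge0 ?convolution_norm_ge0 ?Lp_norm_ge0.
  apply: Lp_norm_bounded => //; first by apply: cmeasurable_tpoly; exact: tpoly_convolution.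
  by move=> x; have := hB _ L1f x; rewrite f0 mule0 lee_fin.
have nup : 0 < nu by rewrite lt_neqAle eq_sym nun0.
pose f1 x := (nu^-1)%:C%C * f x.
have nf1 : Lp_norm q f1 = 1%E.
  rewrite Lp_normZ// normc_real ger0_norm ?invr_ge0// -nuE -EFinM mulVf//.
have : (Lp_norm q (convolution phi f1) <= convolution_norm phi q)%E.
  apply: ereal_sup_ubound; exists f1 => //; split; last by rewrite nf1.
  split; last by rewrite nf1 ltry.
    by apply: measurable_cfunM => //; exact: measurable_cfun_cst.
  by move=> k x; rewrite /f1 pf.
rewrite convolutionZr// Lp_normZ//; last by apply: cmeasurable_tpoly; exact: tpoly_convolution.
rewrite normc_real ger0_norm ?invr_ge0// -nuE => h.
by rewrite muleC -lee_pdivrMl.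
Qed.

Lemma fourier_reflect f k : cmeasurable f -> Defs.periodic f ->
  cintegral (fun x => character k x * f (- x)) = fourier f k.
Proof.
move=> mf pf; rewrite /fourier.
rewrite -[RHS](@cintegral_affine _ _ _ 0 (-1)).
- apply: eq_cintegral => x; rewrite add0r scaleN1r characterNr opprK.
  by rewrite mulrC.
- by apply: measurable_cfunM => //; exact: cmeasurable_character.
- by move=> l x; rewrite pf periodic_character.
- by right.
Qed.

(** For the pairing (U * f)(0), the integral of U(x) f(-x), convolution with phi is symmetric: both
    sides are the sum over k of the products of the coefficients of phi, U and f. The reflection
    avoids complex conjugates. *)
Lemma convolution_duality U f : tpoly U -> L1 f -> Defs.periodic f ->
  cintegral (fun x => convolution phi U x * f (- x)) =
  cintegral (fun x => U x * convolution phi f (- x)).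
Proof.
move=> tU Lf pf; have [mf _] := Lf.
have [s [c [us phiE]]] := tphi.
have phiE' : phi = fun x => \sum_(k <- s) c k * character k x by exact/funext.
have LU := L1_tpoly tU.
have Lr k : L1 (fun x => character k x * f (- x)).
  by apply: L1Mcharacter; exact: L1_reflect.
transitivity (\sum_(k <- s) c k * fourier U k * fourier f k).
  rewrite phiE'; under eq_cintegral do rewrite convolutionE// mulr_suml.
  rewrite (@eq_cintegral _ _ _ (fun x => \sum_(k <- s)
      (c k * fourier U k) * (character k x * f (- x)))).
    rewrite cintegral_sum; last by move=> k; apply: cintegrableZ; exact: L1_cintegrable.
    apply: eq_bigr => k _; rewrite cintegralZ; last exact: L1_cintegrable.
    by rewrite fourier_reflect.
  by move=> x; apply: eq_bigr => k _; rewrite mulrA.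
rewrite phiE'.
rewrite (@eq_cintegral _ _ (fun x => U x * _) (fun x => \sum_(k <- s)
    (c k * fourier f k) * (U x * character (- k) x))); last first.
  move=> x; rewrite convolutionE// mulr_sumr; apply: eq_bigr => k _.
  by rewrite characterNr; ring.
rewrite cintegral_sum; last by move=> k; apply: cintegrableZ; exact: L1_fourier.
apply: eq_bigr => k _; rewrite cintegralZ; last exact: L1_fourier.
by rewrite mulrAC.
Qed.

End fixed_exponents.
End convolution_operator_norm.

(** * Transfer of the convolution norm from L_q to L_p *)

Section convolution_norm_exchange.
Context {R : realType} {d : nat}.
Notation torus := (@torus_measure R d).
Implicit Types (f g phi U V : 'cV[R]_d -> R[i]) (p q : \bar R).

(** The extremal function of the finite case has no analogue at p = +oo. Instead |phi * U| <= 2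
    |phi|_1 |U|_oo, and |phi|_1 = |phi * V|_1 is at most the convolution norm times |V|_1. *)
Lemma convolution_norm_swap_infty phi U V (C : R) : tpoly phi -> tpoly U -> tpoly V ->
  0 <= C -> (Lp_norm 1 V <= C%:E)%E -> convolution phi V = phi ->
  (Lp_norm +oo (convolution phi U) <=
   (2 * C)%:E * convolution_norm phi 1 * Lp_norm +oo U)%E.
Proof.
move=> tphi tU tV C0 VC phiV.
have p1y : ((1 : \bar R)^-1 + +oo^-1 = 1)%E by rewrite inve1 invey adde0.
have q1y : (+oo^-1 + (1 : \bar R)^-1 = 1)%E by rewrite inve1 invey add0e.
have oney : (1 <= +oo :> \bar R)%E by rewrite leey.
have K0 := convolution_norm_ge0 phi oney q1y.
have Kf := convolution_norm_fin oney q1y tphi.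
have phi1 : (Lp_norm 1 phi <= C%:E * convolution_norm phi 1)%E.
  rewrite -{1}phiV muleC.
  apply: le_trans (le_convolution_norm oney q1y tphi (tpoly_Lebesgue (lexx _) tV)) _.
  exact: lee_wpmul2l.
have mphi := cmeasurable_tpoly tphi; have mU := cmeasurable_tpoly tU.
have Uf : Lp_norm +oo U \is a fin_num.
  by rewrite ge0_fin_numE ?Lp_norm_ge0//; case: (tpoly_Lebesgue oney tU).
apply: (@le_trans _ _ ((2 * (C * fine (convolution_norm phi 1)) * fine (Lp_norm +oo U))%:E)).
  apply: Lp_norm_bounded => //.
    by apply: cmeasurable_tpoly; apply: tpoly_convolution => //; exact: L1_tpoly.
  move=> x; rewrite -lee_fin.
  have ms : cmeasurable (fun y => phi (x - y)).
    have := cmeasurable_affine x (-1) mphi.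
    by under [X in cmeasurable X -> _]eq_fun do rewrite scaleN1r.
  apply: le_trans (normc_cintegral_le _) _; first exact: measurable_cfunM.
  rewrite -mulrA EFinM lee_wpmul2l//.
  under eq_integral do rewrite normcM.
  apply: le_trans (torus_hoelder (lexx _) p1y (measurable_normc ms) (measurable_normc mU)
    (fun=> normc_ge0 _) (fun=> normc_ge0 _)) _.
  rewrite EFinM fineK// lee_wpmul2r ?Lp_norm_ge0//.
  have := @Lp_norm_affine _ _ 1 phi x (-1) mphi (periodic_tpoly tphi) (or_intror erefl) (lexx _).
  rewrite /Lp_norm; under [X in Lnorm _ _ X = _ -> _]eq_fun do rewrite scaleN1r.
  by move=> ->; rewrite EFinM fineK.
by rewrite -[in leRHS](fineK Kf) -[in leRHS](fineK Uf) -!EFinM lee_fin !mulrA.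
Qed.

(* With [u = conj G |G|^(r-2)] reflected, [int |G|^r = int G u(-x) = int U (phi * u)(-x)]. *)
Lemma convolution_norm_swap_fin (r : R) q phi U : (1 <= r)%R -> ((r%:E)^-1 + q^-1 = 1)%E ->
  tpoly phi -> tpoly U ->
  (Lp_norm r%:E (convolution phi U) <= 2%:E * convolution_norm phi q * Lp_norm r%:E U)%E.
Proof.
move=> r1 pq tphi tU.
have p1 : (1 <= r%:E)%E by rewrite lee_fin.
have q1 := conjugate_ge1 p1 pq.
have r0 : 0 < r by exact: lt_le_trans ltr01 r1.
pose G := convolution phi U.
have LU := L1_tpoly tU.
have tG : tpoly G by exact: tpoly_convolution.
have [B B0 GB] := tpoly_bounded tG.
pose I := (\int[torus]_x ((normc (G x)) `^ r)%:E)%E.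
have mGr : measurable_fun [set: 'cV[R]_d] (fun x => (normc (G x) `^ r)).
  by apply: (measurableT_comp (measurable_powR r)); apply: measurable_normc; exact: cmeasurable_tpoly.
have I0 : (0 <= I)%E by apply: integral_ge0 => x _; rewrite lee_fin powR_ge0.
have If : I \is a fin_num.
  rewrite ge0_fin_numE//; apply: (@le_lt_trans _ _ (\int[torus]_x ((B `^ r)%:E))%E).
    apply: ge0_le_integral => //.
    - by move=> x _; rewrite lee_fin powR_ge0.
    - exact/measurable_EFinP.
    - by move=> x _; rewrite lee_fin ge0_ler_powR ?nnegrE ?normc_ge0// ltW.
  by rewrite integral_cst// [X in (_ * X)%E]torus_measureT mule1 ltry.
pose g x := G (- x).
have tg : tpoly g by exact: tpoly_reflect.
(* The factor conj (g x) makes u vanish at the zeros of g, whatever value the power with exponent r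
   - 2 takes there. *)
pose u x := ((normc (g x) `^ (r - 2))%:C)%C * conjc (g x).
have nu x : normc (u x) = if normc (g x) == 0 then 0 else normc (g x) `^ (r - 1).
  rewrite /u normcM normc_real normcJ' ger0_norm ?powR_ge0//.
  have [->|g0] := eqVneq (normc (g x)) 0; first by rewrite mulr0.
  have -> : r - 1 = r - 2 + 1 by lra.
  by rewrite [in RHS]powRD ?g0 ?implybT// powRr1// normc_ge0.
have mng := measurable_normc (cmeasurable_tpoly tg).
have mu : cmeasurable u.
  apply: measurable_cfunM; last exact/measurable_conjc/cmeasurable_tpoly.
  split; last exact: measurable_cst.
  exact: (measurableT_comp (measurable_powR (r - 2)) mng).
have gB x : normc (g x) <= B by exact: GB.
have uB x : normc (u x) <= B `^ (r - 1).
  rewrite nu; case: ifP => _; first exact: powR_ge0.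
  by rewrite ge0_ler_powR ?nnegrE ?normc_ge0// subr_ge0.
have pu : Defs.periodic u by move=> k x; rewrite /u (periodic_tpoly tg).
have Lu : Lebesgue_space q u.
  split => //; apply: le_lt_trans (Lp_norm_bounded q1 mu uB) _; exact: ltry.
have L1u : L1 u by exact: L1_bounded mu uB.
have IE : cintegral (fun x => G x * u (- x)) = ((fine I)%:C)%C.
  rewrite (@eq_cintegral _ _ _ (fun x => (normc (G x) `^ r)%:C)%C).
    by rewrite /cintegral /= Rintegral_cst// mul0r.
  move=> x; rewrite /u /g opprK mulrCA -normcE_conj -rmorphM; congr (_%:C)%C.
  have [->|g0] := eqVneq (normc (G x)) 0; first by rewrite expr0n mulr0 powR0 ?gt_eqF.
  rewrite -powR_mulrn ?normc_ge0// -powRD ?g0 ?implybT//.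
  by congr (_ `^ _); lra.
have tP : tpoly (convolution phi u) by exact: tpoly_convolution.
have mP := cmeasurable_tpoly tP.
have tPr := tpoly_reflect tP.
have NP : Lp_norm q (fun x => convolution phi u (- x)) = Lp_norm q (convolution phi u).
  rewrite -(@Lp_norm_affine _ _ q _ 0 (-1) mP (periodic_tpoly tP) (or_intror erefl) q1).
  by congr Lp_norm; apply/funext => x; rewrite add0r scaleN1r.
have Nu : (Lp_norm q u <= ((fine I) `^ (1 - r^-1))%:E)%E.
  have Ig : (\int[torus]_x ((normc (g x)) `^ r)%:E = I)%E.
    have h : (\int[torus]_x ((normc (G (0 + (-1) *: x))) `^ r)%:E = I)%E.
      apply: (@ge0_integral_torus_affine R d (fun x => (normc (G x) `^ r)%:E) 0 (-1)).
      - exact/measurable_EFinP.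
      - by move=> x; rewrite lee_fin powR_ge0.
      - by move=> k x; rewrite (periodic_tpoly tG).
      - by right.
    by rewrite -h; apply: eq_integral => x _; rewrite add0r scaleN1r.
  (* For r = 1 the exponent 1 - 1/r is 0 and |u| <= 1. Otherwise (r - 1) t = r, so |u|^t is at most
     |g|^r. *)
  case: (conjugate_cases p1 pq) => [[rE qE]|[//]|[r' [t [[<-] qE r1' t1 rt]]]].
    case: rE => r1E; rewrite qE; rewrite r1E invr1 subrr powRr0.
    apply: (Lp_norm_bounded _ mu) => [|x]; first by rewrite leey.
    by rewrite nu r1E subrr powRr0; case: ifP; rewrite ?ler01 ?lexx.
  rewrite qE /Lp_norm torus_LnormE => [|x]; last exact: normc_ge0.
  have t0 : 0 < t by exact: lt_trans ltr01 t1.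
  have -> : 1 - r^-1 = t^-1 by lra.
  rewrite -poweR_EFin (fineK If); apply: gt0_ler_poweR.
  - by rewrite invr_ge0 ltW.
  - rewrite in_itv/= leey andbT; apply: integral_ge0 => x _.
    by rewrite lee_fin powR_ge0.
  - by rewrite in_itv/= leey andbT.
  rewrite -Ig; apply: ge0_le_integral; first by [].
  - by move=> x _; rewrite lee_fin powR_ge0.
  - apply/measurable_EFinP.
    exact: (measurableT_comp (measurable_powR t) (measurable_normc mu)).
  - apply/measurable_EFinP.
    exact: (measurableT_comp (measurable_powR r) mng).
  move=> x _; rewrite lee_fin nu; case: ifP => [_|/negbT g0].
    by rewrite [X in X <= _]powR0; [exact: powR_ge0|rewrite gt_eqF].
  rewrite -powRrM le_eqVlt; apply/orP; left; apply/eqP; congr (_ `^ _).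
  have -> : r - 1 = r * t^-1.
    have -> : t^-1 = 1 - r^-1 by lra.
    by rewrite mulrBr mulr1 divff ?gt_eqF.
  by rewrite divfK ?gt_eqF.
have mU := cmeasurable_tpoly tU.
have Kf := convolution_norm_fin p1 pq tphi.
have Uf : Lp_norm r%:E U \is a fin_num.
  by rewrite ge0_fin_numE ?Lp_norm_ge0//; case: (tpoly_Lebesgue p1 tU).
pose kq := fine (convolution_norm phi q); pose nU := fine (Lp_norm r%:E U).
have kqE : convolution_norm phi q = kq%:E by rewrite fineK.
have nUE : Lp_norm r%:E U = nU%:E by rewrite fineK.
have key : fine I <= 2 * nU * kq * (fine I) `^ (1 - r^-1).
  have h : ((normc (cintegral (fun x => G x * u (- x))))%:E <=
      2%:E * (nU%:E * (kq%:E * ((fine I) `^ (1 - r^-1))%:E)))%E.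
    rewrite convolution_duality//.
    apply: le_trans (normc_cintegral_le _) _.
      by apply: measurable_cfunM => //; exact: cmeasurable_tpoly.
    rewrite lee_wpmul2l//; under eq_integral do rewrite normcM.
    apply: le_trans (torus_hoelder p1 pq (measurable_normc mU)
      (measurable_normc (cmeasurable_tpoly tPr)) (fun=> normc_ge0 _) (fun=> normc_ge0 _)) _.
    rewrite -nUE lee_wpmul2l ?Lp_norm_ge0//.
    rewrite -[X in (X <= _)%E]/(Lp_norm q (fun x => convolution phi u (- x))) NP.
    apply: le_trans (le_convolution_norm p1 pq tphi Lu) _.
    by rewrite kqE lee_wpmul2l// -kqE; exact: convolution_norm_ge0 pq.
  move: h; rewrite IE normc_real -!EFinM lee_fin ger0_norm ?fine_ge0//.
  by rewrite !mulrA.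
rewrite /Lp_norm torus_LnormE => [|x]; last exact: normc_ge0.
rewrite -/I -(fineK If) poweR_EFin -[X in (_ * _ * X)%E]/(Lp_norm r%:E U) kqE nUE -!EFinM lee_fin.
have [Iz|In0] := eqVneq (fine I) 0.
  rewrite Iz powR0 ?invr_neq0 ?gt_eqF//.
  rewrite !mulr_ge0 ?fine_ge0 ?Lp_norm_ge0//; exact: convolution_norm_ge0 pq.
have Ip : 0 < fine I by rewrite lt_neqAle eq_sym In0 fine_ge0.
rewrite -(@ler_pM2r _ ((fine I) `^ (1 - r^-1))) ?powR_gt0//.
rewrite -powRD ?In0 ?implybT//.
have -> : r^-1 + (1 - r^-1) = 1 by lra.
by rewrite powRr1 ?fine_ge0// -[2 * kq * nU]mulrAC.
Qed.

Lemma convolution_norm_swap p q phi U V (C : R) : (1 <= p)%E -> (p^-1 + q^-1 = 1)%E ->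
  tpoly phi -> tpoly U -> tpoly V ->
  1 <= C -> (Lp_norm 1 V <= C%:E)%E -> convolution phi V = phi ->
  (Lp_norm p (convolution phi U) <= (2 * C)%:E * convolution_norm phi q * Lp_norm p U)%E.
Proof.
move=> p1 pq tphi tU tV C1 VC phiV.
have C0 : 0 <= C by exact: le_trans C1.
case: (conjugate_cases p1 pq) => [[pE qE]|[-> ->]|[r [t [pE qE r1 t1 rt]]]].
- apply: le_trans (_ : 2%:E * convolution_norm phi q * Lp_norm p U <= _)%E.
    by move: pq; rewrite pE => pq'; apply: convolution_norm_swap_fin.
  rewrite lee_wpmul2r ?Lp_norm_ge0// lee_wpmul2r ?(convolution_norm_ge0 _ p1 pq)//.
  by rewrite lee_fin ler_peMr.
- exact: convolution_norm_swap_infty VC phiV.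
- apply: le_trans (_ : 2%:E * convolution_norm phi q * Lp_norm p U <= _)%E.
    by move: pq; rewrite pE => pq'; apply: convolution_norm_swap_fin => //; exact: ltW.
  rewrite lee_wpmul2r ?Lp_norm_ge0// lee_wpmul2r ?(convolution_norm_ge0 _ p1 pq)//.
  by rewrite lee_fin ler_peMr.
Qed.

End convolution_norm_exchange.

(** * The sampling operator *)

Section sampling.
Context {R : realType} {d : nat}.
Notation torus := (@torus_measure R d).
Variable a : 'rV[int]_d.
Hypothesis a_neq0 : forall i, a 0 i != 0.
Implicit Types (k l n r : 'cV[int]_d) (x y : 'cV[R]_d) (f g phi t : 'cV[R]_d -> R[i]).
Notation E := (@residues R d a).
Notation nd := (@lattice_node R d a).
Notation box lo hi := (@lattice_box R d a lo hi).
Let N : R := (size E)%:R.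

Definition sampling phi g x : R[i] :=
  (N^-1)%:C%C * \sum_(k <- E) g (nd k) * phi (x - nd k).

Definition discrete_fourier g l : R[i] :=
  (N^-1)%:C%C * \sum_(k <- E) g (nd k) * character (- l) (nd k).

Definition band_limited phi := tpoly phi /\
  forall k, ~ box (- 2^-1) 2^-1 k -> fourier phi k = 0.

Lemma band_limited_notin phi k : band_limited phi -> k \notin E -> fourier phi k = 0.
Proof.
by move=> [_ phi0] /negP kE; apply: phi0 => /(mem_residues a_neq0).
Qed.

Lemma tpoly_sampling phi g : tpoly phi -> tpoly (sampling phi g).
Proof.
move=> tphi; apply: tpolyZ; apply: tpoly_sumZ => k; exact: tpoly_shift.
Qed.

Lemma eq_sampling phi f g : (forall k, f (nd k) = g (nd k)) ->
  sampling phi f = sampling phi g.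
Proof.
by move=> fg; apply/funext => x; congr (_ * _); apply: eq_bigr => k _; rewrite fg.
Qed.

Lemma samplingB phi f g x :
  sampling phi (fun y => f y - g y) x = sampling phi f x - sampling phi g x.
Proof.
rewrite /sampling -mulrBr -sumrB; congr (_ * _).
by apply: eq_bigr => k _; rewrite mulrBl.
Qed.

(** Translating phi by a node multiplies its coefficient by a character value, so the samples of g
    enter only through their discrete Fourier transform. *)
Lemma fourier_sampling phi g l : tpoly phi ->
  fourier (sampling phi g) l = fourier phi l * discrete_fourier g l.
Proof.
move=> tphi; rewrite fourierZ; last first.
  by apply: L1_tpoly; apply: tpoly_sumZ => k; exact: tpoly_shift.
rewrite fourier_sum; last first.
  by move=> k; apply: L1Z; apply: L1_tpoly; exact: tpoly_shift.
rewrite /discrete_fourier mulrCA; congr (_ * _); rewrite mulr_sumr.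
apply: eq_bigr => k _; rewrite fourierZ; last by apply: L1_tpoly; exact: tpoly_shift.
by rewrite fourier_shift// mulrCA.
Qed.

Lemma band_limitedE t x : band_limited t ->
  t x = \sum_(k <- E) fourier t k * character k x.
Proof.
move=> bt; have [tt _] := bt.
suff h : t = (fun x => \sum_(k <- E) fourier t k * character k x) by exact: (congr1 (@^~ x) h).
apply: tpoly_fourier_inj => //.
  by apply: tpoly_sumZ => k; exact: tpoly_character.
move=> k; rewrite fourier_sum_character sum_eq_uniq; last exact: residues_uniq.
by case: ifPn => // kE; exact: band_limited_notin.
Qed.

(** There is no aliasing: different frequencies in D(M^j) are orthogonal on the nodes. *)
Lemma discrete_fourier_band_limited t l : band_limited t -> l \in E ->
  discrete_fourier t l = fourier t l.
Proof.
move=> bt lE; rewrite /discrete_fourier.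
under eq_bigr => k _ do rewrite (band_limitedE (nd k) bt) mulr_suml.
rewrite exchange_big/=.
under eq_bigr => k _.
  under eq_bigr do rewrite -mulrA -characterDl.
  rewrite -mulr_sumr; over.
rewrite big_seq.
under eq_bigr => k kE.
  rewrite (sum_character_node a_neq0 kE lE) mulrCA; over.
rewrite -big_seq -mulr_sumr sum_eq_uniq ?residues_uniq// lE mulrA.
rewrite -[X in X * _]rmorphM/= mulVf ?mul1r//.
by rewrite gt_eqF// sizeR_residues_gt0.
Qed.

Lemma sampling_band_limited phi t : band_limited phi -> band_limited t ->
  sampling phi t = convolution phi t.
Proof.
move=> bphi bt; have [tphi _] := bphi; apply: tpoly_fourier_inj.
- exact: tpoly_sampling.
- by apply: tpoly_convolution => //; apply: L1_tpoly; case: bt.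
move=> l; rewrite fourier_sampling// fourier_convolution//; last by apply: L1_tpoly; case: bt.
have [lE|lE] := boolP (l \in E); first by rewrite discrete_fourier_band_limited.
by rewrite (band_limited_notin bphi lE) !mul0r.
Qed.

Lemma convolution_band_limited phi V : band_limited phi -> tpoly V ->
  (forall k, box (- 2^-1) 2^-1 k -> fourier V k = 1) -> convolution phi V = phi.
Proof.
move=> [tphi phi0] tV V1; apply: tpoly_fourier_inj => //.
  by apply: tpoly_convolution => //; exact: L1_tpoly.
move=> l; rewrite fourier_convolution//; last exact: L1_tpoly.
have [h|h] := pselect (box (- 2^-1) 2^-1 l); first by rewrite V1// mulr1.
by rewrite phi0// mul0r.
Qed.

(** Both sides have at l the coefficient of phi times the discrete transform of g, since V has
    coefficient 1 on the spectrum of phi. Nothing is asked of g, of which only the node values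
    count. *)
Lemma sampling_convolution phi V g : band_limited phi -> tpoly V ->
  (forall k, box (- 2^-1) 2^-1 k -> fourier V k = 1) ->
  sampling phi g = convolution phi (sampling V g).
Proof.
move=> bphi tV V1; have [tphi phi0] := bphi; apply: tpoly_fourier_inj.
- exact: tpoly_sampling.
- by apply: tpoly_convolution => //; apply: L1_tpoly; exact: tpoly_sampling.
move=> l; rewrite fourier_convolution//; last by apply: L1_tpoly; exact: tpoly_sampling.
rewrite !fourier_sampling//.
have [h|h] := pselect (box (- 2^-1) 2^-1 l); first by rewrite V1// mul1r.
by rewrite phi0// !mul0r.
Qed.

End sampling.

Lemma torus_integral_sumZ (R : realType) (d : nat) (I : Type) (r : seq I) (b : I -> R)
    (f : I -> 'cV[R]_d -> R) :
  (forall i, 0 <= b i) -> (forall i x, 0 <= f i x) ->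
  (forall i, measurable_fun [set: 'cV[R]_d] (f i)) ->
  (\int[torus_measure]_x (\sum_(i <- r) b i * f i x)%:E =
   \sum_(i <- r) (b i)%:E * \int[torus_measure]_x (f i x)%:E)%E.
Proof.
move=> b0 f0 mf.
transitivity (\sum_(i <- r) \int[torus_measure]_x (b i * f i x)%:E)%E.
  rewrite -ge0_integral_sum; last 3 first.
  - exact: measurableT.
  - move=> i; apply/measurable_EFinP; apply: measurable_funM; first exact: measurable_cst.
    exact: mf.
  - by move=> i x _; rewrite lee_fin mulr_ge0.
  by apply: eq_integral => x _; rewrite sumEFin.
apply: eq_bigr => i _; under eq_integral do rewrite EFinM.
apply: (@ge0_integralZl_EFin _ _ _ torus_measure setT measurableT).
- by move=> x _; rewrite lee_fin.
- by apply/measurable_EFinP; exact: mf.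
- exact: b0.
Qed.

(** * The Schur test applied to sampled convolutions *)

Section sampled_convolution.
Context {R : realType} {d : nat}.
Notation torus := (@torus_measure R d).
Variable a : 'rV[int]_d.
Hypothesis a_neq0 : forall i, a 0 i != 0.
Implicit Types (k l n r : 'cV[int]_d) (x y : 'cV[R]_d) (f g : 'cV[R]_d -> R[i]).
Notation E := (@residues R d a).
Notation nd := (@lattice_node R d a).
Let N : R := (size E)%:R.
Let N0 : 0 < N. Proof. exact: sizeR_residues_gt0. Qed.

Definition node_average (h : 'cV[R]_d -> R[i]) y : R :=
  N^-1 * \sum_(k <- E) normc (h (nd k - y)).

Variables (V h : 'cV[R]_d -> R[i]) (Phi : 'cV[R]_d -> R) (c : R).
Hypothesis mPhi : measurable_fun [set: 'cV[R]_d] Phi.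
Hypothesis Phi0 : forall x, 0 <= Phi x.
Hypothesis Phi_sum : forall x, \sum_(k <- E) Phi (x - nd k) = c * N.
Hypothesis Phi_int : forall y (b : R), b = 1 \/ b = -1 ->
  (\int[torus]_x (Phi (y + b *: x))%:E <= c%:E)%E.
Hypothesis mh : cmeasurable h.
Hypothesis ph : Defs.periodic h.

Let H := node_average h.
Let K x y : R := N^-1 * \sum_(k <- E) Phi (x - nd k) * normc (h (nd k - y)).

Let c0 : 0 <= c.
Proof.
by rewrite -(pmulr_lge0 _ N0) -(Phi_sum 0) sumr_ge0.
Qed.

Let mhn k : measurable_fun [set: 'cV[R]_d] (fun y => normc (h (nd k - y))).
Proof.
by apply: measurable_normc; exact: cmeasurable_subl.
Qed.

Let mH : measurable_fun [set: 'cV[R]_d] H.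
Proof.
apply: measurable_funM; first exact: measurable_cst.
by apply: measurable_sum => k; exact: mhn.
Qed.

Let H0 y : 0 <= H y.
Proof. by rewrite mulr_ge0 ?invr_ge0 ?ler0n// sumr_ge0// => k _; exact: normc_ge0. Qed.

Let K0 x y : 0 <= K x y.
Proof.
by rewrite mulr_ge0 ?invr_ge0 ?ler0n// sumr_ge0// => k _; rewrite mulr_ge0 ?normc_ge0.
Qed.

Let mPhin k : measurable_fun [set: 'cV[R]_d] (fun x => Phi (x - nd k)).
Proof.
apply: (measurableT_comp mPhi).
have := @measurable_affine_cV R d (- nd k) 1.
by under eq_fun do rewrite scale1r addrC.
Qed.

Let mK : measurable_fun [set: 'cV[R]_d * 'cV[R]_d] (fun z => K z.1 z.2).
Proof.
apply: measurable_funM; first exact: measurable_cst.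
apply: measurable_sum => k; apply: measurable_funM.
- exact: (measurableT_comp (mPhin k) measurable_fst).
- exact: (measurableT_comp (mhn k) measurable_snd).
Qed.

Let Kw y : (\int[torus]_x (K x y)%:E <= (c * H y)%:E)%E.
Proof.
have -> : (\int[torus]_x (K x y)%:E =
    \sum_(k <- E) (N^-1 * normc (h (nd k - y)))%:E * \int[torus]_x (Phi (x - nd k))%:E)%E.
  rewrite -(@torus_integral_sumZ _ _ _ E (fun k => N^-1 * normc (h (nd k - y)))
    (fun k x => Phi (x - nd k))); last 3 first.
  - by move=> k; rewrite mulr_ge0 ?normc_ge0// invr_ge0 ler0n.
  - by move=> k x.
  - exact: mPhin.
  apply: eq_integral => x _; congr EFin.
  by rewrite /K mulr_sumr; apply: eq_bigr => k _; ring.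
have -> : (c * H y)%:E = (\sum_(k <- E) (N^-1 * normc (h (nd k - y)))%:E * c%:E)%E.
  under [RHS]eq_bigr do rewrite -EFinM.
  rewrite sumEFin; congr EFin; rewrite /H /node_average mulrCA mulrC mulr_sumr mulr_suml.
  by apply: eq_bigr => k _; ring.
apply: lee_sum => k _; rewrite lee_wpmul2l ?lee_fin ?mulr_ge0 ?invr_ge0 ?ler0n ?normc_ge0//.
have := @Phi_int (- nd k) 1 (or_introl erefl).
by under eq_integral do rewrite scale1r addrC.
Qed.

Let wK x y : H y = 0 -> K x y = 0.
Proof.
move=> /eqP; rewrite mulf_eq0 invr_eq0 gt_eqF//= psumr_eq0 => [/allP Hy|k _]; last exact: normc_ge0.
rewrite /K big_seq big1 ?mulr0// => k kE.
by have /eqP -> := Hy k kE; rewrite mulr0.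
Qed.

(** A translation by a node permutes the nodes modulo Z^d, and h is periodic. *)
Let H_node k y : H (y + nd k) = H y.
Proof.
rewrite /H /node_average; congr (_ * _).
rewrite -(@sum_residues_shift R d a a_neq0 _ (fun n => normc (h (nd n - (y + nd k)))) k).
  by apply: eq_bigr => n _; rewrite lattice_nodeD opprD addrACA [nd k - _]addrC -addrA addNr addr0.
move=> n r; rewrite lattice_nodeMmul// addrAC; congr normc; exact: ph.
Qed.

(** The row condition of the Schur test. As H is invariant under translation by nodes, the integral
    of |h(x_k - y)| H(y)^(t-1) has the same value J for every node x_k. The left-hand side is then J
    times the node average of Phi(x - x_k), which is c, and the integral of H^t is J itself. *)
Let Kq x (t : R) : 1 <= t -> (\int[torus]_y (K x y * H y `^ (t - 1))%:E <=
  c%:E * \int[torus]_y (H y `^ t)%:E)%E.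
Proof.
move=> t1.
have mHt u : measurable_fun [set: 'cV[R]_d] (fun y => H y `^ u).
  exact: (measurableT_comp (measurable_powR u) mH).
pose G k y := normc (h (nd k - y)) * H y `^ (t - 1).
have mG k : measurable_fun [set: 'cV[R]_d] (G k) by exact: measurable_funM.
have G0 k y : 0 <= G k y by rewrite mulr_ge0 ?normc_ge0 ?powR_ge0.
pose J := (\int[torus]_y (G 0%R y)%:E)%E.
have GJ k : (\int[torus]_y (G k y)%:E = J)%E.
  rewrite -(@ge0_integral_torus_affine R d (fun y => (G k y)%:E) (nd k) 1); last 4 first.
  - by apply/measurable_EFinP; exact: mG.
  - by move=> y; rewrite lee_fin.
  - move=> n y; rewrite /G; congr (_ * _ `^ _)%:E.
      rewrite opprD addrA -(ph n (nd k - y - intvec n)).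
      by rewrite subrK.
    have := H_node (lattice_mul a n) y; by rewrite lattice_node_mul.
  - by left.
  apply: eq_integral => y _; rewrite /G scale1r [nd k + y]addrC H_node; congr (normc (h _) * _)%:E.
  rewrite opprD addrC -addrA addNr addr0.
  suff -> : nd 0 = 0 :> 'cV[R]_d by rewrite sub0r.
  by apply/matrixP => i l; rewrite !mxE mul0r.
have KE : (\int[torus]_y (K x y * H y `^ (t - 1))%:E =
    \sum_(k <- E) (N^-1 * Phi (x - nd k))%:E * J)%E.
  under [RHS]eq_bigr => k _ do rewrite -(GJ k).
  rewrite -(@torus_integral_sumZ _ _ _ E (fun k => N^-1 * Phi (x - nd k)) G) //; last first.
    by move=> k; rewrite mulr_ge0// invr_ge0 ler0n.
  apply: eq_integral => y _; congr EFin.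
  by rewrite /K mulr_sumr mulr_suml; apply: eq_bigr => k _; rewrite /G; ring.
have HE : (\int[torus]_y (H y `^ t)%:E = \sum_(k <- E) (N^-1)%:E * J)%E.
  under [RHS]eq_bigr => k _ do rewrite -(GJ k).
  rewrite -(@torus_integral_sumZ _ _ _ E (fun k => N^-1) G) //; last first.
    by move=> k; rewrite invr_ge0 ler0n.
  apply: eq_integral => y _; congr EFin.
  transitivity (H y * H y `^ (t - 1)).
    have [->|Hy] := eqVneq (H y) 0; first by rewrite mul0r powR0 ?gt_eqF//; lra.
    rewrite -[X in X * _]powRr1 // -powRD ?Hy ?implybT//; congr powR; lra.
  by rewrite {1}/H /node_average mulr_sumr mulr_suml; apply: eq_bigr => k _; rewrite /G; ring.
have N1 : 0 <= N^-1 by rewrite invr_ge0 ler0n.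
rewrite KE HE -!ge0_sume_distrl; [|by move=> k _; rewrite lee_fin ?mulr_ge0..].
rewrite muleA !sumEFin -EFinM -mulr_sumr Phi_sum.
rewrite big_const_seq count_predT iter_addr addr0 -mulr_natr -/N mulVf ?gt_eqF// mulr1.
by rewrite mulrCA mulVf ?gt_eqF// mulr1.
Qed.

(* The exponent q is carried by the weight H, which bounds the integral of the
   sampling kernel K in its first variable. *)
Lemma sampled_convolution_bound p q g F : (1 <= p)%E -> (p^-1 + q^-1 = 1)%E ->
  tpoly V -> (forall x, normc (V x) <= Phi x) -> cmeasurable F ->
  (forall k, (normc (g (nd k)))%:E <=
     2%:E * \int[torus]_y (normc (h (nd k - y)) * normc (F y))%:E)%E ->
  (Lp_norm p (sampling a V g) <=
   2%:E * (c%:E * 'N[torus]_q[(fun y => (node_average h y)%:E)] * Lp_norm p F))%E.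
Proof.
move=> p1 pq tV VPhi mF gh.
have mFn := measurable_normc mF.
have Fn0 y : 0 <= normc (F y) by exact: normc_ge0.
apply: le_trans (_ : 2%:E * 'N[torus]_p[(fun x => \int[torus]_y (K x y * normc (F y))%:E)] <= _)%E; last first.
  rewrite lee_wpmul2l// /Lp_norm.
  apply: (weighted_schur mK mH mFn K0 H0 Fn0 c0 Kw p1 pq wK) => x t qt.
  apply: Kq; rewrite -lee_fin -qt; exact: conjugate_ge1 pq.
have mKF : measurable_fun setT (fun x => \int[torus]_y (K x y * normc (F y))%:E)%E.
  apply: (measurable_torus_integral (F := fun x y => (K x y * normc (F y))%:E)).
    apply/measurable_EFinP; apply: measurable_funM; first exact: mK.
    exact: (measurableT_comp mFn measurable_snd).
  by move=> x y; rewrite lee_fin mulr_ge0.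
rewrite -torus_LnormZ//; apply: le_torus_Lnorm => //.
- apply: measurable_EFin_normc; apply: cmeasurable_tpoly; exact: tpoly_sampling.
- exact: measurable_funeM.
- by move=> x; rewrite lee_fin normc_ge0.
move=> x.
have -> : (\int[torus]_y (K x y * normc (F y))%:E =
    \sum_(k <- E) (N^-1 * Phi (x - nd k))%:E *
      \int[torus]_y (normc (h (nd k - y)) * normc (F y))%:E)%E.
  rewrite -(@torus_integral_sumZ _ _ _ E (fun k => N^-1 * Phi (x - nd k))
    (fun k y => normc (h (nd k - y)) * normc (F y))); last 3 first.
  - by move=> k; rewrite mulr_ge0// invr_ge0 ler0n.
  - by move=> k y; rewrite mulr_ge0 ?normc_ge0.
  - by move=> k; exact: measurable_funM.
  apply: eq_integral => y _; congr EFin.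
  by rewrite /K mulr_sumr mulr_suml; apply: eq_bigr => k _; ring.
rewrite ge0_sume_distrr; last first.
  move=> k _; rewrite mule_ge0 ?lee_fin ?mulr_ge0 ?invr_ge0 ?ler0n//.
  by apply: integral_ge0 => y _; rewrite lee_fin mulr_ge0 ?normc_ge0.
apply: le_trans (_ : (\sum_(k <- E) (N^-1 * Phi (x - nd k))%:E * (normc (g (nd k)))%:E)%E <= _)%E.
  under eq_bigr do rewrite -EFinM; rewrite sumEFin lee_fin.
  rewrite /sampling normcM normc_real ger0_norm ?invr_ge0 ?ler0n//.
  under [leRHS]eq_bigr do rewrite -mulrA; rewrite -mulr_sumr ler_wpM2l ?invr_ge0 ?ler0n//.
  apply: le_trans (normc_sum _ _ _) _; apply: ler_sum => k _.
  by rewrite normcM mulrC ler_wpM2r ?normc_ge0.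
apply: lee_sum => k _; rewrite muleCA lee_wpmul2l//.
by rewrite lee_fin mulr_ge0 ?invr_ge0 ?ler0n.
Qed.

End sampled_convolution.

(** * Norm bounds for the sampling operator *)

Section sampling_operator_norms.
Context {R : realType} {d : nat}.
Notation torus := (@torus_measure R d).
Implicit Types (k l n r : 'cV[int]_d) (x y : 'cV[R]_d) (f g phi h F U : 'cV[R]_d -> R[i]).

(** Young's inequality, obtained from the Schur test with weight 1. *)
Lemma majorant_convolution_norm (V : 'cV[R]_d -> R[i]) (Phi : 'cV[R]_d -> R) (c : R) p q f :
  (1 <= p)%E -> (p^-1 + q^-1 = 1)%E -> 0 <= c -> tpoly V -> majorant V Phi c ->
  Lebesgue_space p f ->
  (Lp_norm p (convolution V f) <= (2 * c)%:E * Lp_norm p f)%E.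
Proof.
move=> p1 pq c0 tV [mPhi Phi0 VPhi Phi_int] Lf.
have [mf _ _] := Lf; have mfn := measurable_normc mf.
have L1f : L1 f by exact: L1_Lebesgue pq Lf.
have q1 := conjugate_ge1 p1 pq.
pose K x y : R := Phi (x - y).
have mK : measurable_fun [set: 'cV[R]_d * 'cV[R]_d] (fun z => K z.1 z.2).
  apply: (measurableT_comp mPhi); apply: measurable_fun_cV => i.
  under eq_fun do rewrite !mxE.
  apply: measurable_funB.
  - exact: (measurableT_comp (@measurable_entry _ _ _ i) measurable_fst).
  - exact: (measurableT_comp (@measurable_entry _ _ _ i) measurable_snd).
have K0 x y : 0 <= K x y by exact: Phi0.
have Kw y : (\int[torus]_x (K x y)%:E <= (c * 1)%:E)%E.
  have := Phi_int (- y) 1 (or_introl erefl); rewrite mulr1.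
  by under eq_integral do rewrite scale1r addrC.
have key := @weighted_schur R d K (fun=> 1) (fun x => normc (f x)) c mK
  (measurable_cst _) mfn K0 (fun=> ler01) (fun=> normc_ge0 _) c0 Kw p q p1 pq.
apply: le_trans (_ : 2%:E * 'N[torus]_p[(fun x => \int[torus]_y (K x y * normc (f y))%:E)] <= _)%E.
  have mKF : measurable_fun setT (fun x => \int[torus]_y (K x y * normc (f y))%:E)%E.
    apply: (measurable_torus_integral (F := fun x y => (K x y * normc (f y))%:E)).
      apply/measurable_EFinP; apply: measurable_funM; first exact: mK.
      exact: (measurableT_comp mfn measurable_snd).
    by move=> x y; rewrite lee_fin mulr_ge0 ?normc_ge0.
  rewrite -torus_LnormZ//; apply: le_torus_Lnorm => //.
  - by apply: measurable_EFin_normc; apply: cmeasurable_tpoly; exact: tpoly_convolution.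
  - exact: measurable_funeM.
  - by move=> x; rewrite lee_fin normc_ge0.
  move=> x.
  have mVx : cmeasurable (fun y => V (x - y)) by exact: cmeasurable_subl (cmeasurable_tpoly tV).
  apply: le_trans (normc_cintegral_le (measurable_cfunM mVx mf)) _.
  rewrite lee_wpmul2l//; apply: ge0_le_integral => //.
  - by move=> y _; rewrite lee_fin normc_ge0.
  - apply: measurable_EFin_normc; apply: measurable_cfunM; [exact: mVx|exact: mf].
  - apply/measurable_EFinP; apply: measurable_funM; last exact: mfn.
    apply: (measurableT_comp mPhi); have := @measurable_affine_cV R d x (-1).
    by under eq_fun do rewrite scaleN1r.
  - by move=> y _; rewrite lee_fin normcM ler_wpM2r ?normc_ge0.
rewrite EFinM -muleA lee_wpmul2l//.
have := key _ _; rewrite torus_Lnorm_cst// mule1; apply.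
- by move=> x y /eqP; rewrite oner_eq0.
move=> x t _; under eq_integral do rewrite powR1 mulr1.
under [in leRHS]eq_integral do rewrite powR1.
rewrite [X in (_ <= _ * X)%E]integral_cst// mul1e torus_measureT mule1.
have -> : (fun y => (K x y)%:E) = (fun y => (Phi (x + -1 *: y))%:E).
  by apply/funext => y; rewrite scaleN1r.
by apply: Phi_int; right.
Qed.

Variable a : 'rV[int]_d.
Hypothesis a_neq0 : forall i, a 0 i != 0.
Notation E := (@residues R d a).
Notation nd := (@lattice_node R d a).
Notation box lo hi := (@lattice_box R d a lo hi).
Let N : R := (size E)%:R.
Let N0 : 0 < N. Proof. exact: sizeR_residues_gt0. Qed.

(** One factor 2 * 3^d is the price of moving phi outside as a convolution
    ([convolution_norm_kernel]), the other that of the sampling operator with the full kernel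
    ([sampled_convolution_bound]). *)
Definition sampling_const : R := 2 * 3 ^+ d * (2 * 3 ^+ d).

Let C3 : 1 <= 3 ^+ d :> R. Proof. by apply: exprn_ege1; lra. Qed.
Let C30 : 0 <= 3 ^+ d :> R. Proof. exact: le_trans C3. Qed.

Let convolution_norm_kernel p q phi (V : 'cV[R]_d -> R[i]) Phi U :
  (1 <= p)%E -> (p^-1 + q^-1 = 1)%E -> band_limited a phi -> tpoly U -> tpoly V ->
  (forall k, box (- 2^-1) 2^-1 k -> fourier V k = 1) -> majorant V Phi (3 ^+ d) ->
  (Lp_norm p (convolution phi U) <=
   (2 * 3 ^+ d)%:E * convolution_norm phi q * Lp_norm p U)%E.
Proof.
move=> p1 pq bphi tU tV V1 [mPhi Phi0 VPhi Phi_int].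
apply: (convolution_norm_swap p1 pq bphi.1 tU tV C3 _ (convolution_band_limited bphi tV V1)).
have h := Phi_int 0 1 (or_introl erefl).
rewrite /Lp_norm Lnorm1; apply: le_trans h.
apply: ge0_le_integral => //.
- apply: (measurableT_comp (@abse_measurable R setT) _).
  exact: (measurable_EFin_normc (cmeasurable_tpoly tV)).
- apply/measurable_EFinP; apply: (measurableT_comp mPhi).
  exact: measurable_affine_cV.
- by move=> x _; rewrite gee0_abs ?lee_fin ?normc_ge0// ?scale1r ?add0r VPhi.
Qed.

Lemma convolution_norm_bound p q phi U :
  (1 <= p)%E -> (p^-1 + q^-1 = 1)%E -> band_limited a phi -> tpoly U ->
  (Lp_norm p (convolution phi U) <=
   (2 * 3 ^+ d)%:E * convolution_norm phi q * Lp_norm p U)%E.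
Proof.
move=> p1 pq bphi tU.
have [V [Phi [tV V1 _ maj]]] := @full_kernel R d a a_neq0.
exact: (convolution_norm_kernel p1 pq bphi tU tV V1 maj).
Qed.

(** Needed because the one-sided error may be +oo: in the product with a zero convolution norm it
    counts as 0, so the sampling operator has to vanish outright. *)
Lemma sampling_norm0 p q phi g : (1 <= p)%E -> (p^-1 + q^-1 = 1)%E -> band_limited a phi ->
  convolution_norm phi q = 0%E -> Lp_norm p (sampling a phi g) = 0%E.
Proof.
move=> p1 pq bphi K0; apply/eqP; rewrite eq_le Lp_norm_ge0 andbT.
have [V [Phi [tV V1 _ maj]]] := @full_kernel R d a a_neq0.
rewrite (sampling_convolution g bphi tV V1).
apply: le_trans (convolution_norm_kernel p1 pq bphi (tpoly_sampling _ _ tV) tV V1 maj) _.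
by rewrite K0 mule0 mul0e.
Qed.

Let convolution_sampling_bound p q phi (V : 'cV[R]_d -> R[i]) Phi g (B : \bar R) :
  (1 <= p)%E -> (p^-1 + q^-1 = 1)%E -> band_limited a phi -> tpoly V ->
  (forall k, box (- 2^-1) 2^-1 k -> fourier V k = 1) -> majorant V Phi (3 ^+ d) ->
  (Lp_norm p (sampling a V g) <= 2%:E * ((3 ^+ d)%:E * B))%E ->
  (Lp_norm p (sampling a phi g) <= sampling_const%:E * (convolution_norm phi q * B))%E.
Proof.
move=> p1 pq bphi tV V1 maj bound.
rewrite (sampling_convolution g bphi tV V1).
apply: le_trans (convolution_norm_kernel p1 pq bphi (tpoly_sampling _ _ tV) tV V1 maj) _.
have K0 := convolution_norm_ge0 phi p1 pq.
apply: le_trans (lee_wpmul2l _ bound) _.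
  by rewrite mule_ge0// lee_fin mulr_ge0.
rewrite /sampling_const !EFinM -!muleA.
by rewrite [(convolution_norm phi q * (2%:E * _))%E]muleCA [(convolution_norm phi q * (_ * B))%E]muleCA.
Qed.

(** W reproduces itself under convolution with V, so the values of g at the nodes are bounded by
    integrals of |V(x_k - y)| |W(y)| and the Schur bound applies with h = V. The weight is then at
    most 3^d pointwise, since the node sums of Phi are constant; this is the second factor 3^d. *)
Let sampling_tpoly_bound p q V Phi g W :
  (1 <= p)%E -> (p^-1 + q^-1 = 1)%E -> tpoly V ->
  (forall k, box (- 2^-1) 2^-1 k -> fourier V k = 1) ->
  (forall x, \sum_(k <- E) Phi (x - nd k) = 3 ^+ d * N) -> majorant V Phi (3 ^+ d) ->
  band_limited a W -> (forall k, normc (g (nd k)) <= normc (W (nd k))) ->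
  (Lp_norm p (sampling a V g) <= 2%:E * ((3 ^+ d)%:E * ((3 ^+ d)%:E * Lp_norm p W)))%E.
Proof.
move=> p1 pq tV V1 Phi_sum [mPhi Phi0 VPhi Phi_int] bW gW.
have tW := bW.1; have mW := cmeasurable_tpoly tW; have mV := cmeasurable_tpoly tV.
have q1 := conjugate_ge1 p1 pq.
have WE : convolution V W = W.
  apply: tpoly_fourier_inj => //; first by apply: tpoly_convolution => //; exact: L1_tpoly.
  move=> l; rewrite fourier_convolution//; last exact: L1_tpoly.
  have [hl|hl] := pselect (box (- 2^-1) 2^-1 l); first by rewrite V1// mul1r.
  by rewrite bW.2// mulr0.
have gb k : ((normc (g (nd k)))%:E <=
    2%:E * \int[torus]_y (normc (V (nd k - y)) * normc (W y))%:E)%E.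
  apply: (@le_trans _ _ (normc (W (nd k)))%:E); first by rewrite lee_fin.
  rewrite -[X in normc (X _)]WE /convolution.
  have mVk : cmeasurable (fun y => V (nd k - y)) by exact: cmeasurable_subl.
  apply: le_trans (normc_cintegral_le (measurable_cfunM mVk mW)) _.
  by under eq_integral do rewrite normcM.
apply: le_trans (sampled_convolution_bound a_neq0 mPhi Phi0 Phi_sum Phi_int mV
  (periodic_tpoly tV) p1 pq tV VPhi mW gb) _.
rewrite -muleA; do 2 (rewrite lee_wpmul2l ?lee_fin//).
rewrite lee_wpmul2r ?Lp_norm_ge0// -[leRHS](@torus_Lnorm_cst R d q _ q1)//.
have mA : measurable_fun [set: 'cV[R]_d] (node_average a V).
  apply: measurable_funM; first exact: measurable_cst.
  by apply: measurable_sum => k; apply: measurable_normc; exact: cmeasurable_subl.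
apply: le_torus_Lnorm => //.
- exact/measurable_EFinP.
- by move=> y; rewrite lee_fin mulr_ge0 ?invr_ge0 ?ler0n// sumr_ge0// => k _; exact: normc_ge0.
move=> y; rewrite lee_fin /node_average -/N mulrC ler_pdivrMr// -(Phi_sum (- y)).
rewrite -(@sum_residues_opp R d a a_neq0 _ (fun k => normc (V (nd k - y)))); last first.
  by move=> k r; rewrite lattice_nodeMmul// addrAC periodic_tpoly.
by apply: ler_sum => k _; rewrite lattice_nodeN addrC; exact: VPhi.
Qed.

Lemma sampling_tpoly_norm p q phi g W : (1 <= p)%E -> (p^-1 + q^-1 = 1)%E ->
  band_limited a phi -> band_limited a W ->
  (forall k, normc (g (nd k)) <= normc (W (nd k))) ->
  (Lp_norm p (sampling a phi g) <=
   sampling_const%:E * (convolution_norm phi q * ((3 ^+ d)%:E * Lp_norm p W)))%E.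
Proof.
move=> p1 pq bphi bW gW.
have [V [Phi [tV V1 Phi_sum maj]]] := @full_kernel R d a a_neq0.
apply: (convolution_sampling_bound p1 pq bphi tV V1 maj).
exact: (sampling_tpoly_bound p1 pq tV V1 Phi_sum maj bW gW).
Qed.

Lemma sampling_convolution_norm p q phi h F : (1 <= p)%E -> (p^-1 + q^-1 = 1)%E ->
  band_limited a phi -> cmeasurable h -> Defs.periodic h -> cmeasurable F ->
  (Lp_norm p (sampling a phi (convolution h F)) <=
   sampling_const%:E * (convolution_norm phi q *
     ('N[torus]_q[(fun y => (node_average a h y)%:E)] * Lp_norm p F)))%E.
Proof.
move=> p1 pq bphi mh ph mF.
have [V [Phi [tV V1 Phi_sum maj]]] := @full_kernel R d a a_neq0.
apply: (convolution_sampling_bound p1 pq bphi tV V1 maj).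
have [mPhi Phi0 VPhi Phi_int] := maj; rewrite [((3 ^+ d)%:E * _)%E]muleA.
apply: (sampled_convolution_bound a_neq0 mPhi Phi0 Phi_sum Phi_int mh ph p1 pq tV VPhi mF).
move=> k; have mhk : cmeasurable (fun y => h (nd k - y)) by exact: cmeasurable_subl.
apply: le_trans (normc_cintegral_le (measurable_cfunM mhk mF)) _.
by under eq_integral do rewrite normcM.
Qed.

End sampling_operator_norms.

Lemma dilation_exp (R : realType) (d : nat) (m : 'rV[int]_d) j :
  (dilation m : 'M[R]_d) ^+ j = dilation (map_mx (fun z => z ^+ j) m).
Proof.
elim: j => [|j IH].
  rewrite expr0; apply/matrixP => i k; rewrite !mxE expr0.
  by case: eqVneq => //= ->; rewrite mulr1n.
rewrite exprS IH [LHS]mulmx_diag; congr diag_mx.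
by apply/matrixP => i k; rewrite !mxE exprS (ord1 i) intrM.
Qed.

(** * Quasi-interpolation and its norms expressed on the lattice of nodes *)

Section quasi_interpolation.
Context {R : realType} {d : nat}.
Notation torus := (@torus_measure R d).
Variables (m : 'rV[int]_d) (j : nat).
Hypothesis m_neq0 : forall i, m 0 i != 0.
Implicit Types (k l n r : 'cV[int]_d) (x y : 'cV[R]_d) (f g phi h F : 'cV[R]_d -> R[i]).

Definition dilation_power : 'rV[int]_d := map_mx (fun z => z ^+ j) m.
Notation a := dilation_power.
Notation E := (@residues R d a).
Notation nd := (@lattice_node R d a).
Notation M := (dilation m : 'M[R]_d).
Let N : R := (size E)%:R.

Lemma dilation_power_neq0 i : a 0 i != 0.
Proof. by rewrite mxE expf_neq0. Qed.
Let a_neq0 := dilation_power_neq0.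
Let N0 : 0 < N. Proof. exact: sizeR_residues_gt0. Qed.

Lemma node_dilation k : node M j k = nd k.
Proof. by rewrite /node /scaled dilation_exp invmx_dilation. Qed.

Lemma prod_dilation_power : \prod_i `|(a 0 i)%:~R : R| = N.
Proof.
rewrite /N size_residues natr_prod; apply: eq_bigr => i _.
by rewrite -intr_norm -abszE.
Qed.

Lemma mdet_dilation : mdet M j = N.
Proof.
rewrite /mdet det_diag normr_prod -prodrXl -prod_dilation_power.
by apply: eq_bigr => i _; rewrite !mxE -normrX rmorphXn.
Qed.

Lemma quasi_interp_sampling phi g : quasi_interp M j phi g = sampling a phi g.
Proof.
apply/funext => x; rewrite /quasi_interp /sampling mdet_dilation dilation_exp.
rewrite sum_frequencies//; congr (_ * _).
by apply: eq_bigr => k _; rewrite node_dilation.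
Qed.

Lemma trig_poly_band_limited phi : trig_poly (M ^+ j) phi -> band_limited a phi.
Proof.
rewrite dilation_exp => /trig_poly_tpoly [|tphi phi0]; first exact: finite_frequencies.
split=> // k hk; apply: phi0; by rewrite frequencies_dilation.
Qed.

Lemma trig_poly_half_spectrum phi : trig_poly (2^-1 *: M ^+ j) phi -> tpoly phi /\
  forall k, ~ lattice_box a (- 4^-1 : R) 4^-1 k -> fourier phi k = 0.
Proof.
rewrite dilation_exp => /trig_poly_tpoly [|tphi phi0].
  rewrite frequencies_half//.
  apply: (sub_finite_set _ (@finite_frequencies R d a a_neq0)).
  rewrite frequencies_dilation// => k hk i; have := hk i; lra.
split=> // k hk; apply: phi0; by rewrite frequencies_half.
Qed.

Let shift_sumE h x : shift_sum M j h x = N^-1 * \sum_(k <- E) normc (h (x - nd k)).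
Proof.
rewrite /shift_sum mdet_dilation dilation_exp sum_frequencies//; congr (_ * _).
by apply: eq_bigr => k _; rewrite node_dilation.
Qed.

Let node_averageE h y : Defs.periodic h -> node_average a h y = shift_sum M j h (- y).
Proof.
move=> ph; rewrite shift_sumE /node_average; congr (_ * _).
rewrite -(@sum_residues_opp R d a a_neq0 _ (fun k => normc (h (nd k - y)))); last first.
  by move=> k r; rewrite lattice_nodeMmul// addrAC ph.
by apply: eq_bigr => k _; rewrite lattice_nodeN addrC.
Qed.

Let shift_sum_ge0 h x : 0 <= shift_sum M j h x.
Proof.
by rewrite shift_sumE mulr_ge0 ?invr_ge0 ?ler0n// sumr_ge0// => k _; exact: normc_ge0.
Qed.

Let measurable_shift_sum h : cmeasurable h ->
  measurable_fun [set: 'cV[R]_d] (shift_sum M j h).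
Proof.
move=> mh; have /funext -> := shift_sumE h.
apply: measurable_funM; first exact: measurable_cst.
apply: measurable_sum => k; apply: (measurable_normc (f := fun y => h (y - nd k))).
have := @cmeasurable_affine _ _ h (- nd k) 1 mh.
by under eq_fun do rewrite scale1r addrC.
Qed.

Let shift_sum_node h l x : Defs.periodic h ->
  shift_sum M j h (x + nd l) = shift_sum M j h x.
Proof.
move=> ph; rewrite !shift_sumE; congr (_ * _).
rewrite -(@sum_residues_shift R d a a_neq0 _ (fun n => normc (h (x + nd l - nd n))) l).
  by apply: eq_bigr => n _; rewrite lattice_nodeD opprD addrACA subrr addr0.
move=> n r; rewrite lattice_nodeMmul// opprD addrA.
by rewrite -(ph r (_ - intvec r)) subrK.
Qed.

Let scaled_cell : scaled M j @` cell =
  [set x : 'cV[R]_d | forall i, - 2^-1 <= (a 0 i)%:~R * x i 0 < 2^-1].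
Proof.
have U : (dilation a : 'M[R]_d) \in unitmx.
  rewrite unitmxE det_diag unitfE prodf_seq_neq0; apply/allP => i _ /=.
  by rewrite mxE intr_eq0.
rewrite /scaled dilation_exp; apply/seteqP; split=> [x [y yc <-] i|x xc] /=.
  by rewrite -[_ * _]/(_) -(@dilation_mulcol R d a) mulKVmx//; exact: yc.
exists (dilation a *m x); last by rewrite mulKmx.
by move=> i; rewrite dilation_mulcol; exact: xc.
Qed.

(** The node average is the reflected shift sum, which is invariant under translation by nodes, so
    m^j small cells make up the torus integral and the finite case is an equality. For q = +oo the
    norm of L_(q, j) is a genuine supremum and dominates the essential one. *)
Lemma node_average_norm_le q h : (1 <= q)%E -> cmeasurable h -> Defs.periodic h ->
  ('N[torus]_q[(fun y => (node_average a h y)%:E)] <= Lqj_norm M q j h)%E.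
Proof.
move=> q1 mh ph; have -> : (fun y => (node_average a h y)%:E) = (fun y => (shift_sum M j h (- y))%:E).
  by apply/funext => y; rewrite node_averageE.
have mS := measurable_shift_sum mh.
have mSN : measurable_fun [set: 'cV[R]_d] (fun y => shift_sum M j h (- y)).
  apply: (measurableT_comp mS); have := @measurable_affine_cV R d 0 (-1).
  by under eq_fun do rewrite scaleN1r add0r.
case: q q1 => [t| |]// q1.
  rewrite torus_LnormE; last by move=> y; exact: shift_sum_ge0.
  rewrite /Lqj_norm scaled_cell mdet_dilation -prod_dilation_power.
  pose G x := ((shift_sum M j h x) `^ t)%:E.
  have mG : measurable_fun [set: 'cV[R]_d] G.
    by apply/measurable_EFinP; exact: (measurableT_comp (measurable_powR t) mS).
  have G0 x : (0 <= G x)%E by rewrite lee_fin powR_ge0.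
  have Gper l x : G (x + nd l) = G x by rewrite /G shift_sum_node.
  have c_nat i : exists k : nat, (a 0 i)%:~R = k.+1%:R :> R \/ (a 0 i)%:~R = - k.+1%:R :> R.
    have := a_neq0 i; case: (a 0 i) => [[|n]|n]// _; exists n; first by left.
    by right; rewrite NegzE mulrNz.
  have Gshift i x : G (x + `|(a 0 i)%:~R|^-1 *: delta_mx i 0) = G x.
    have [h1|h1] := leP 0 (a 0 i).
      rewrite ger0_norm ?ler0z// -(Gper (delta_mx i 0) x); congr (G (_ + _)).
      apply/matrixP => k l; rewrite !mxE; case: eqVneq => [->|]; rewrite /= ?mulr0 ?mul0r//.
      by rewrite (ord1 l) eqxx mulr1 mul1r.
    rewrite ltr0_norm ?ltrz0// -(Gper (- delta_mx i 0) x); congr (G (_ + _)).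
    apply/matrixP => k l; rewrite !mxE; case: eqVneq => [->|]; rewrite /= ?oppr0 ?mulr0 ?mul0r//.
    by rewrite (ord1 l) eqxx mulr1 mulNr mul1r invrN.
  have Gint k x : G (x + intvec k) = G x.
    by rewrite -(lattice_node_mul (R := R) a_neq0 k) Gper.
  have tiling := @ge0_integral_torus_tiling R d G (fun i => (a 0 i)%:~R) mG G0 c_nat Gshift.
  have reflect := @ge0_integral_torus_affine R d G 0 (-1) mG G0 Gint (or_intror erefl).
  have GE : (fun x => G (0 + -1 *: x)) = (fun x => (shift_sum M j h (- x) `^ t)%:E).
    by apply/funext => x; rewrite scaleN1r add0r.
  have e := etrans (etrans (esym (congr1 (fun u => \int[torus]_x u x)%E GE)) reflect) tiling.
  rewrite [X in (X `^ _ <= _)%E]e; exact: lexx.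
have : (0 <= Lqj_norm M +oo j h)%E.
  apply: le_trans (_ : (shift_sum M j h 0)%:E <= _)%E; first by rewrite lee_fin.
  by apply: ereal_sup_ubound; exists 0.
have sup x : ((shift_sum M j h x)%:E <= Lqj_norm M +oo j h)%E.
  by apply: ereal_sup_ubound; exists x.
move: sup; case: (Lqj_norm M +oo j h) => [r|_ _|_ h0]; [|by rewrite leey|by move: h0].
move=> sup; rewrite lee_fin => r0; rewrite -[leRHS](@torus_Lnorm_cst R d +oo _ q1)//.
apply: le_torus_Lnorm => //; first exact/measurable_EFinP.
by move=> x; rewrite lee_fin.
Qed.

End quasi_interpolation.

(** * Characters as test functions *)

Section smooth_characters.
Context {R : realType} {d : nat}.
Implicit Types (k l : 'cV[int]_d) (x y : 'cV[R]_d).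

Lemma is_derive_line (f : 'cV[R]_d -> R) x (u : 'cV[R]_d) (c : R) :
  is_derive (0 : R) 1 (fun t : R => f (t *: u + x)) c -> is_derive x u f c.
Proof.
move=> [dv dc].
have e : (fun h : R => h^-1 *: (((fun t : R => f (t *: u + x)) \o shift 0) (h *: 1) - f (0 *: u + x))) =
    (fun h : R => h^-1 *: ((f \o shift x) (h *: u) - f x)).
  apply/funext => h /=; rewrite scale0r add0r addr0.
  by rewrite [h *: 1]mulr1.
by split; [move: dv; rewrite /derivable e|move: dc; rewrite /derive e].
Qed.

Definition wave k (b c : R) x : R :=
  b * cos (2 * pi * dotz k x) + c * sin (2 * pi * dotz k x).

Lemma is_derive_wave k b c x (i : 'I_d) :
  is_derive x (delta_mx i 0) (wave k b c)
    (wave k (c * (2 * pi * (k i 0)%:~R)) (- b * (2 * pi * (k i 0)%:~R)) x).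
Proof.
apply: is_derive_line; set w := 2 * pi * (k i 0)%:~R.
pose th := 2 * pi * dotz k x.
have dotzE (t : R) : 2 * pi * dotz k (t *: delta_mx i 0 + x) = w * t + th.
  rewrite /th /w /dotz.
  under eq_bigr do rewrite !mxE mulrDr.
  rewrite big_split/= (bigD1 i)//= big1 ?addr0 => [|l li]; last first.
    by rewrite (negbTE li)/= !mulr0.
  by rewrite !eqxx/= mulr1; ring.
have -> : (fun t : R => wave k b c (t *: delta_mx i 0 + x)) =
    (fun t : R => b * cos (w * t + th) + c * sin (w * t + th)).
  by apply/funext => t; rewrite /wave dotzE.
have lin : is_derive (0 : R) 1 (fun t : R => w * t + th) w.
  have h1 := @is_deriveZ R R R id w 0 1 1 (is_derive_id (0 : R) (1 : R)).
  have h2 := @is_deriveD R R R _ _ 0 1 _ _ h1 (@is_derive_cst R R R th 0 1).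
  apply: (@is_derive_eq _ _ _ _ _ _ _ _ h2).
  by rewrite addr0 [_ *: _]mulr1.
have l0 : w * 0 + th = th by rewrite mulr0 add0r.
have dc := @is_derive1_comp R (@cos R) (fun t : R => w * t + th) 0 (- sin th) w.
have ds := @is_derive1_comp R (@sin R) (fun t : R => w * t + th) 0 (cos th) w.
rewrite l0 in dc ds.
have {}dc := dc (is_derive_cos th) lin; have {}ds := ds (is_derive_sin th) lin.
have dbc := @is_deriveZ R R R _ b 0 1 _ dc; have dcs := @is_deriveZ R R R _ c 0 1 _ ds.
have := @is_deriveD R R R _ _ 0 1 _ _ dbc dcs.
suff -> : b *: (- sin th * w) + c *: (cos th * w) = wave k (c * w) (- b * w) x by [].
by rewrite /wave -/th /GRing.scale/=; ring.
Qed.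

Lemma continuous_wave k b c : continuous (wave k b c).
Proof.
have [cc cs] := @ccontinuous_character R d k.
move=> x; apply: (@continuousD R _ _ (fun x => b * cos (2 * pi * dotz k x))
  (fun x => c * sin (2 * pi * dotz k x))).
- by apply: (@continuousM R _ (fun=> b)); [exact: cst_continuous|exact: cc].
- by apply: (@continuousM R _ (fun=> c)); [exact: cst_continuous|exact: cs].
Qed.

Lemma partials_wave k s : forall b c, exists b' c', partials s (wave k b c) = wave k b' c'.
Proof.
elim: s => [|i s IH] b c; first by exists b, c.
have [b' [c' e]] := IH b c.
exists (c' * (2 * pi * (k i 0)%:~R)), (- b' * (2 * pi * (k i 0)%:~R)).
apply/funext => x; rewrite /partials /= -/(partials s (wave k b c)) e.
exact: (@derive_val _ _ _ _ _ _ _ (is_derive_wave k b' c' x i)).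
Qed.

Lemma smooth_wave k b c : smooth (wave k b c).
Proof.
move=> s; have [b' [c' ->]] := partials_wave k s b c; split.
  exact: continuous_wave.
move=> i x; exact: (@ex_derive _ _ _ _ _ _ _ (is_derive_wave k b' c' x i)).
Qed.

(** Allows a distribution given by h to be evaluated at characters, which identifies its Fourier
    coefficients with those of h. *)
Lemma test_function_character k : test_function (@character R d k).
Proof.
split; last exact: periodic_character.
split.
- rewrite (_ : (fun _ => _) = wave k 1 0); first exact: smooth_wave.
  by apply/funext => x; rewrite /wave mul1r mul0r addr0.
- rewrite (_ : (fun _ => _) = wave k 0 1); first exact: smooth_wave.
  by apply/funext => x; rewrite /wave mul1r mul0r add0r.
Qed.

Lemma dist_fourier_Lq (phit : periodic_distribution R d) q h k :
  dist_Lq phit q h -> dist_fourier phit k = fourier h k.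
Proof.
move=> [_ phitE]; rewrite /dist_fourier phitE; last exact: test_function_character.
by apply: eq_cintegral => x; rewrite mulrC.
Qed.

Lemma tpoly_convolutionC (h t : 'cV[R]_d -> R[i]) : L1 h -> Defs.periodic h -> tpoly t ->
  convolution h t = convolution t h.
Proof.
move=> Lh ph tt; apply/funext => x.
transitivity (cintegral (fun y => (fun z => t (x - z) * h z) (x + -1 *: y))).
  apply: eq_cintegral => y; rewrite scaleN1r mulrC; congr (t _ * _).
  by rewrite opprB addrC subrK.
apply: cintegral_affine.
- apply: measurable_cfunM; last by case: Lh.
  exact: cmeasurable_subl (cmeasurable_tpoly tt).
- move=> l z; rewrite ph opprD addrA; congr (_ * _).
  by rewrite -(periodic_tpoly tt l (_ - intvec l)) subrK.
- by right.
Qed.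

End smooth_characters.

(** * The inverse estimates *)

Lemma le_mul_ereal_inf (R : realType) (c : R) (A : \bar R) (S : set (\bar R)) : 0 < c ->
  (forall u, S u -> (A <= c%:E * u)%E) -> (A <= c%:E * ereal_inf S)%E.
Proof.
move=> c0 AS; rewrite -lee_pdivrMl//; apply: le_ereal_inf_tmp => u Su.
by rewrite lee_pdivrMl//; exact: AS.
Qed.

Section inverse_estimates.
Context {R : realType} {d : nat}.
Notation torus := (@torus_measure R d).
Implicit Types (k l : 'cV[int]_d) (x y : 'cV[R]_d) (f g h F X T t : 'cV[R]_d -> R[i]).

Lemma multiplier_norm_tpoly p (lam : 'cV[int]_d -> R[i]) (S : R) X h : (1 <= p)%E ->
  0 <= S -> (multiplier_norm p lam <= S%:E)%E -> tpoly X -> tpoly h ->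
  (forall k, fourier h k = lam k * fourier X k) ->
  (Lp_norm p h <= S%:E * Lp_norm p X)%E.
Proof.
move=> p1 S0 lamS tX th hX.
have XE : Lp_norm p X = (fine (Lp_norm p X))%:E.
  rewrite fineK// ge0_fin_numE ?Lp_norm_ge0//; by case: (tpoly_Lebesgue p1 tX).
have nX0 : 0 <= fine (Lp_norm p X) by rewrite fine_ge0// Lp_norm_ge0.
(* The multiplier norm tests the unit ball only. Dividing by an arbitrary positive r >= |X|_p, and
   letting r decrease to |X|_p at the end, includes the case |X|_p = 0. *)
have scaled r : 0 < r -> fine (Lp_norm p X) <= r -> (Lp_norm p h <= (S * r)%:E)%E.
  move=> r0 Xr.
  have nc : normc ((r^-1)%:C)%C = r^-1 by rewrite normc_real gtr0_norm ?invr_gt0.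
  have : (Lp_norm p (fun x => (((r^-1)%:C)%C * h x)%R) <= S%:E)%E.
    apply: le_trans lamS; apply: ereal_sup_ubound.
    exists (fun x => ((r^-1)%:C)%C * h x) => //.
    exists (fun x => ((r^-1)%:C)%C * X x); split.
    - by apply: tpoly_approx => //; exact: tpolyZ.
    - rewrite Lp_normZ//; last exact: cmeasurable_tpoly.
      by rewrite nc XE -EFinM lee_fin mulrC ler_pdivrMr// mul1r.
    split; first by apply: tpoly_approx => //; exact: tpolyZ.
    move=> k; rewrite (fourierZ _ k (L1_tpoly th)) (fourierZ _ k (L1_tpoly tX)) hX.
    exact: mulrCA.
  rewrite Lp_normZ//; last exact: cmeasurable_tpoly.
  by rewrite nc lee_pdivrMl// -EFinM mulrC.
rewrite XE -EFinM; apply/lee_addgt0Pr => e e0.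
(* S times this increment is at most e, also for S = 0. *)
have d0 : 0 < e / (S + 1) by rewrite divr_gt0// ltr_wpDl.
apply: le_trans (scaled (fine (Lp_norm p X) + e / (S + 1)) _ _) _.
- by rewrite ltr_wpDl.
- by rewrite lerDl ltW.
rewrite -EFinD lee_fin mulrDr lerD2l mulrCA ger_pMr// ler_pdivrMr ?mul1r ?lerDl//.
by rewrite ltr_wpDl.
Qed.

(** Integrability at every x, not only at almost every x: the convolution with h is going to be
    evaluated at the nodes. *)
Lemma integral_Lq_Lp p q h F x : (1 <= p)%E -> (p^-1 + q^-1 = 1)%E ->
  Lebesgue_space q h -> Lebesgue_space p F ->
  cintegrable (fun y => h (x - y) * F y).
Proof.
move=> p1 pq [mh ph hq] [mF _ Fp].
have q1 := conjugate_ge1 p1 pq.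
have hx := Lp_norm_affine x mh ph (or_intror erefl) q1.
have mhx : cmeasurable (fun y => h (x - y)) by exact: cmeasurable_subl.
have hE : (fun y => h (x + -1 *: y)) = (fun y => h (x - y)).
  by apply/funext => y; rewrite scaleN1r.
rewrite hE in hx.
apply: cintegrableP; first exact: measurable_cfunM.
under eq_integral do rewrite normcM.
have qp : (q^-1 + p^-1 = 1)%E by rewrite addeC.
apply: le_lt_trans (torus_hoelder q1 qp (measurable_normc mhx) (measurable_normc mF)
  (fun=> normc_ge0 _) (fun=> normc_ge0 _)) _.
rewrite -/(Lp_norm q (fun y => h (x - y))) -/(Lp_norm p F) hx.
by rewrite lte_mul_pinfty ?Lp_norm_ge0// ge0_fin_numE ?Lp_norm_ge0.
Qed.

Variables (m : 'rV[int]_d).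
Hypothesis m_gt1 : forall i, 1 < `|m 0 i|.
Variables (v : 'cV[R]_d -> R[i]).
Hypothesis v1 : forall x, box 4^-1 x -> v x = 1.
Variables (p q : \bar R).
Hypothesis p1 : (1 <= p)%E.
Hypothesis pq : (p^-1 + q^-1 = 1)%E.
Variables (s delta : R).
Hypothesis s0 : 0 < s.
Hypothesis delta_itv : 0 < delta < 2^-1.
Variables (j : nat) (phit : periodic_distribution R d) (phi : 'cV[R]_d -> R[i]).
Notation M := (dilation m : 'M[R]_d).
Notation a := (dilation_power m j).
Notation E := (@residues R d a).
Notation nd := (@lattice_node R d a).
Hypothesis phi_trig : trig_poly (M ^+ j) phi.
Hypothesis phi_neq1 : forall k, k != 0 -> v (delta *: node M j k) != 0 ->
  1 - fourier phi k * dist_fourier phit k != 0.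
Variable S : R.
Hypothesis S0 : 0 <= S.
Hypothesis symbolS : (multiplier_norm p (symbol M s delta v phi phit j) <= S%:E)%E.

Let m_neq0 i : m 0 i != 0.
Proof. by rewrite -normr_gt0; exact: lt_trans (m_gt1 i). Qed.
Let a_neq0 := dilation_power_neq0 j m_neq0.
Let bphi : band_limited a phi. Proof. exact: trig_poly_band_limited. Qed.
Let q1 : (1 <= q)%E. Proof. exact: conjugate_ge1 pq. Qed.

Let symbol_node k : k \in E -> k != 0 -> symbol M s delta v phi phit j k *
    (1 - fourier phi k * dist_fourier phit k) = ((euclidean_norm (node M j k)) `^ s)%:C%C.
Proof.
move=> kE k0.
have vk : v (delta *: node M j k) = 1.
  apply: v1 => i; rewrite node_dilation// mxE.
  have := (mem_residues (R := R) a_neq0 k).1 kE i; move: delta_itv.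
  by move=> /andP[? ?] /andP[? ?]; nra.
rewrite /symbol vk (negbTE k0) oner_eq0/= mulr1 mulfVK//.
by apply: phi_neq1; rewrite ?vk ?oner_eq0.
Qed.

Let K_functional_band_limited f T X : band_limited a T -> tpoly X ->
  (forall k, fourier X k = (1 - fourier phi k * dist_fourier phit k) * fourier T k) ->
  (K_functional M s j p f <= Lp_norm p (fun x => f x - T x)%R + S%:E * Lp_norm p X)%E.
Proof.
move=> bT tX XT.
pose h x := \sum_(k <- E) (((euclidean_norm (node M j k)) `^ s)%:C%C * fourier T k) * character k x.
have th : tpoly h by apply: tpoly_sumZ => k; exact: tpoly_character.
have hT k : fourier h k = ((euclidean_norm (node M j k)) `^ s)%:C%C * fourier T k.
  rewrite /h fourier_sum_character sum_eq_uniq ?residues_uniq//; case: ifPn => // kE.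
  by rewrite (band_limited_notin a_neq0 bT kE) mulr0.
have hS : (Lp_norm p h <= S%:E * Lp_norm p X)%E.
  apply: (multiplier_norm_tpoly p1 S0 symbolS tX th) => k; rewrite hT XT mulrA.
  have [kE|kE] := boolP (k \in E); last first.
    by rewrite (band_limited_notin a_neq0 bT kE) !mulr0.
  (* At k = 0 the symbol is 0 by convention, in agreement with |M^(-j) 0|^s = 0, which uses s >
     0. *)
  have [->|k0] := eqVneq k 0; last by rewrite symbol_node.
  rewrite /symbol eqxx/= !mul0r.
  suff -> : euclidean_norm (node M j 0) = 0 by rewrite powR0 ?gt_eqF// mul0r.
  rewrite /euclidean_norm big1 ?sqrtr0// => i _.
  by rewrite node_dilation// !mxE mul0r expr0n.
apply: le_trans (_ : Lp_norm p (fun x => f x - T x)%R + Lp_norm p h <= _)%E.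
  apply: ereal_inf_lbound; exists T, h; split=> //.
  - by apply: tpoly_approx => //; exact: bT.1.
  - exact: tpoly_approx.
by rewrite leeD2l.
Qed.

(** [c1] is the constant 1 + 2 * 3^d of the Lebesgue inequality for the half kernel. In [c2] the
    first summand bounds Q_j (g - t) and the second phi_j * (V * (g - t)), where two convolutions
    cost 2 * 3^d each. *)
Let c1 : R := 1 + 2 * 3 ^+ d.
Let c2 : R := @sampling_const R d * 3 ^+ d + 2 * 3 ^+ d * (2 * 3 ^+ d).
Definition inverse_const : R := c1 + c2.

Let C30 : 0 < 3 ^+ d :> R. Proof. exact: exprn_gt0. Qed.

Let half_band_limited t : trig_poly (2^-1 *: M ^+ j) t -> band_limited a t.
Proof.
move=> /(trig_poly_half_spectrum m_neq0) [tt t0]; split=> // k hk; apply: t0 => h4.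
by apply: hk => i; have := h4 i; lra.
Qed.

Section half_kernel.
Variables (V : 'cV[R]_d -> R[i]) (Phi : 'cV[R]_d -> R).
Hypothesis tV : tpoly V.
Hypothesis V1 : forall k, lattice_box a (- 4^-1 : R) 4^-1 k -> fourier V k = 1.
Hypothesis V0 : forall k, ~ lattice_box a (- 2^-1 : R) 2^-1 k -> fourier V k = 0.
Hypothesis maj : majorant V Phi (3 ^+ d).

Let convolution_id t : trig_poly (2^-1 *: M ^+ j) t -> convolution V t = t.
Proof.
move=> ht; have [tt t0] := trig_poly_half_spectrum m_neq0 ht.
apply: tpoly_fourier_inj => //; first by apply: tpoly_convolution => //; exact: L1_tpoly.
move=> l; rewrite fourier_convolution//; last exact: L1_tpoly.
have [h|h] := pselect (lattice_box a (- 4^-1 : R) 4^-1 l); first by rewrite V1// mul1r.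
by rewrite t0// mulr0.
Qed.

(** The Lebesgue inequality: V * t = t for t in the half spectrum, hence f - V * f = (f - t) - V *
    (f - t). *)
Let best_approx_ge f : approx_space p f ->
  (Lp_norm p (fun x => f x - convolution V f x)%R <=
   c1%:E * best_approx (2^-1 *: M ^+ j) p f)%E.
Proof.
move=> Af; have c10 : 0 < c1 by rewrite addr_gt0// mulr_gt0.
apply: le_mul_ereal_inf => // _ [t ht <-].
have tt := (trig_poly_half_spectrum m_neq0 ht).1.
have AF : approx_space p (fun x => f x - t x) by apply: approx_spaceB => //; exact: tpoly_approx.
have LF := approx_Lebesgue p1 AF; have [mF _ _] := LF.
have Lf := L1_Lebesgue p1 pq (approx_Lebesgue p1 Af).
have LF1 := L1_Lebesgue p1 pq LF.
pose F x := f x - t x.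
have VF : convolution V F = (fun x => convolution V f x - t x).
  rewrite /F (convolutionBr tV Lf (L1_tpoly tt)).
  by apply/funext => x; rewrite (convolution_id ht).
have tVF : tpoly (convolution V F) by exact: tpoly_convolution.
have -> : (fun x => f x - convolution V f x) = (fun x => F x - convolution V F x).
  by apply/funext => x; rewrite VF /F opprB addrA subrK.
apply: le_trans (Lp_normB p1 mF (cmeasurable_tpoly tVF)) _.
have n0 : (0 <= (2 * 3 ^+ d)%:E :> \bar R)%E by rewrite lee_fin mulr_ge0// ltW.
rewrite -/F /c1 EFinD ge0_muleDl; [|by rewrite lee_fin|exact: n0].
rewrite mul1e; apply: leeD; first exact: lexx.
by apply: (majorant_convolution_norm p1 pq (ltW C30) tV maj).
Qed.

Let onesided_approx_ge g : bounded_space g ->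
  (Lp_norm p (fun x => sampling a phi g x - convolution phi (convolution V g) x)%R <=
   c2%:E * (convolution_norm phi q * onesided_approx (2^-1 *: M ^+ j) p g))%E.
Proof.
move=> [mg pg [B gB]]; have Lg := L1_bounded mg gB.
have tphi := bphi.1.
have tVg : tpoly (convolution V g) by exact: tpoly_convolution.
have tphiVg : tpoly (convolution phi (convolution V g)).
  by apply: tpoly_convolution => //; exact: L1_tpoly.
have K0 := convolution_norm_ge0 phi p1 pq.
have triangle (u w : 'cV[R]_d -> R[i]) : tpoly u -> tpoly w ->
    (Lp_norm p (fun x => u x - w x)%R <= Lp_norm p u + Lp_norm p w)%E.
  by move=> tu tw; apply: Lp_normB => //; exact: cmeasurable_tpoly.
(* With a zero convolution norm the right-hand side is 0 even if the one-sided error is +oo. This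
   case is settled directly, since the infimum is handled below by a positive finite factor. *)
have [Kz|Kn0] := eqVneq (convolution_norm phi q) 0%E.
  apply: le_trans (triangle _ _ (tpoly_sampling a g tphi) tphiVg) _.
  rewrite (sampling_norm0 a_neq0 g p1 pq bphi Kz) add0e Kz mul0e mule0.
  apply: le_trans (convolution_norm_bound a_neq0 p1 pq bphi tVg) _.
  by rewrite Kz mule0 mul0e.
have [k [k0 KE]] : exists k : R, 0 < k /\ convolution_norm phi q = k%:E.
  exists (fine (convolution_norm phi q)).
  have Kf := convolution_norm_fin p1 pq tphi.
  split; last by rewrite fineK.
  by rewrite -lte_fin fineK// lt_neqAle eq_sym Kn0.
have c30 : 0 <= 3 ^+ d :> R by exact: ltW.
have c20 : 0 < c2.
  by apply: ltr_wpDl; rewrite ?mulr_ge0// !mulr_gt0.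
rewrite KE muleA -EFinM; apply: le_mul_ereal_inf; first exact: mulr_gt0.
move=> _ [t [T [ht hT tg gT ->]]].
have bt := half_band_limited ht; have bT := half_band_limited hT.
pose W x := T x - t x.
have tW : tpoly W by apply: tpolyB; [exact: bT.1|exact: bt.1].
have bW : band_limited a W.
  split=> // l hl; rewrite fourierB ?bT.2 ?bt.2 ?subr0//; apply: L1_tpoly.
    exact: bT.1.
  exact: bt.1.
pose w x := g x - t x.
have wW x : normc (w x) <= normc (W x).
  have [t1 g1 tg1] := tg x; have [_ T1 gT1] := gT x.
  have nreal (z : R[i]) : complex.Im z = 0 -> normc z = `|complex.Re z|.
    by move=> z0; rewrite -normc_real; congr normc; case: z z0 => /= zr zi ->.
  rewrite !nreal ?complex_ImD ?complex_ImN ?t1 ?g1 ?T1 ?subr0//.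
  rewrite /w /W !complex_ReD !complex_ReN ger0_norm ?subr_ge0// ger0_norm ?lerB//.
  by rewrite subr_ge0 (le_trans tg1).
have mw : cmeasurable w by apply: measurable_cfunB => //; exact: cmeasurable_tpoly bt.1.
have pw : Defs.periodic w.
  by move=> l x; rewrite /w pg (periodic_tpoly bt.1).
have nwW := le_Lp_norm p1 mw (cmeasurable_tpoly tW) wW.
have Lw : Lebesgue_space p w.
  split=> //; apply: le_lt_trans nwW _; by case: (tpoly_Lebesgue p1 tW).
have Vw : convolution V w = (fun x => convolution V g x - t x).
  rewrite /w (convolutionBr tV Lg (L1_tpoly bt.1)).
  by apply/funext => x; rewrite (convolution_id ht).
have tVw : tpoly (convolution V w).
  by apply: tpoly_convolution => //; apply: (L1_Lebesgue p1 pq).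
have tphiVw : tpoly (convolution phi (convolution V w)).
  by apply: tpoly_convolution => //; exact: L1_tpoly.
have -> : (fun x => sampling a phi g x - convolution phi (convolution V g) x) =
    (fun x => sampling a phi w x - convolution phi (convolution V w) x).
  rewrite Vw (convolutionBr tphi (L1_tpoly tVg) (L1_tpoly bt.1)).
  apply/funext => x; rewrite samplingB (sampling_band_limited a_neq0 bphi bt).
  by rewrite opprB addrA subrK.
apply: le_trans (triangle _ _ (tpoly_sampling a w tphi) tphiVw) _.
rewrite Lp_normBC -/W /c2 mulrDl EFinD ge0_muleDl; [|by rewrite lee_fin !mulr_ge0// ltW..].
apply: leeD.
  apply: le_trans (sampling_tpoly_norm a_neq0 p1 pq bphi bW (fun k => wW (nd k))) _.
  by rewrite KE !muleA -!EFinM mulrAC.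
apply: le_trans (convolution_norm_bound a_neq0 p1 pq bphi tVw) _.
have Vw_le : (Lp_norm p (convolution V w) <= (2 * 3 ^+ d)%:E * Lp_norm p W)%E.
  apply: le_trans (majorant_convolution_norm p1 pq c30 tV maj Lw) _.
  by rewrite lee_wpmul2l// lee_fin mulr_ge0.
have -> : ((2 * 3 ^+ d * (2 * 3 ^+ d) * k)%:E * Lp_norm p W =
    (2 * 3 ^+ d)%:E * k%:E * ((2 * 3 ^+ d)%:E * Lp_norm p W))%E.
  by rewrite muleA -!EFinM mulrAC.
by rewrite KE lee_wpmul2l// -EFinM lee_fin !mulr_ge0// ltW.
Qed.

Lemma K_functional_kernel f g : dist_convolution phit p f g ->
  (K_functional M s j p f <= c1%:E * best_approx (2^-1 *: M ^+ j) p f +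
     S%:E * (c1%:E * best_approx (2^-1 *: M ^+ j) p f +
       (Lp_norm p (fun x => f x - sampling a phi g x)%R +
        c2%:E * (convolution_norm phi q * onesided_approx (2^-1 *: M ^+ j) p g))))%E.
Proof.
move=> [Af Bg gf]; have [mg pg [B gB]] := Bg; have Lg := L1_bounded mg gB.
have [mf _ _] := approx_Lebesgue p1 Af.
have Lf := L1_Lebesgue p1 pq (approx_Lebesgue p1 Af).
have tphi := bphi.1.
have tVf : tpoly (convolution V f) by exact: tpoly_convolution.
have tVg : tpoly (convolution V g) by exact: tpoly_convolution.
have tphiVg : tpoly (convolution phi (convolution V g)).
  by apply: tpoly_convolution => //; exact: L1_tpoly.
have tQ := tpoly_sampling a g tphi.
pose X x := convolution V f x - convolution phi (convolution V g) x.
have tX : tpoly X by exact: tpolyB.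
have bVf : band_limited a (convolution V f).
  by split=> // k hk; rewrite fourier_convolution// V0// mul0r.
(* The coefficients of g are those of phit times those of f, so V * g takes the place of phit * (V *
   f) and X is V * f minus its image under phi * phit. *)
have XE k : fourier X k = (1 - fourier phi k * dist_fourier phit k) *
    fourier (convolution V f) k.
  rewrite fourierB; [|exact: L1_tpoly..].
  rewrite [fourier (convolution phi _) k]fourier_convolution//; last exact: L1_tpoly.
  by rewrite !fourier_convolution// gf; ring.
apply: le_trans (K_functional_band_limited f bVf tX XE) _.
apply: leeD; first exact: best_approx_ge.
rewrite lee_wpmul2l//.
(* X is split as (V * f - f) + (f - Q_j f) + (Q_j f - phi * (V * g)). *)
apply: le_trans (Lp_norm_triangle p1 (cmeasurable_tpoly tVf) (cmeasurable_tpoly tphiVg) mf) _.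
apply: leeD; first by rewrite Lp_normBC; exact: best_approx_ge.
apply: le_trans (Lp_norm_triangle p1 mf (cmeasurable_tpoly tphiVg) (cmeasurable_tpoly tQ)) _.
by rewrite leeD2l//; exact: onesided_approx_ge.
Qed.

End half_kernel.

Let sc0 : 0 < @sampling_const R d.
Proof. by rewrite /sampling_const !mulr_gt0. Qed.

Let c1_ge1 : 1 <= c1.
Proof. by rewrite lerDl mulr_ge0// ltW. Qed.

Let c2_ge : @sampling_const R d <= c2.
Proof.
have C31 : 1 <= 3 ^+ d :> R by apply: exprn_ege1; lra.
apply: (@le_trans _ _ (@sampling_const R d * 3 ^+ d)); first by rewrite ler_peMr// ltW.
by rewrite lerDl !mulr_ge0// ltW.
Qed.

Lemma inverse_const_gt0 : 0 < inverse_const.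
Proof. by rewrite ltr_pwDl//; [exact: lt_le_trans c1_ge1|exact: le_trans (ltW sc0) c2_ge]. Qed.

Lemma K_functional_best_approx f g : dist_convolution phit p f g ->
  (K_functional M s j p f <= ((1 + S) * inverse_const)%:E *
    (Lp_norm p (fun x => f x - quasi_interp M j phi g x)%R
     + best_approx (2^-1 *: M ^+ j) p f
     + convolution_norm phi q * onesided_approx (2^-1 *: M ^+ j) p g))%E.
Proof.
move=> fg; have [V [Phi [tV V1 V0 maj]]] := @half_kernel R d a a_neq0.
apply: le_trans (K_functional_kernel tV V1 V0 maj fg) _.
rewrite quasi_interp_sampling//.
have K0 := convolution_norm_ge0 phi p1 pq.
have A0 : (0 <= Lp_norm p (fun x => f x - sampling a phi g x)%R)%E by exact: Lp_norm_ge0.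
have B0 : (0 <= best_approx (2^-1 *: M ^+ j) p f)%E.
  by apply: le_ereal_inf_tmp => _ [t _ <-]; exact: Lp_norm_ge0.
have O0 : (0 <= onesided_approx (2^-1 *: M ^+ j) p g)%E.
  by apply: le_ereal_inf_tmp => _ [t [T [_ _ _ _ ->]]]; exact: Lp_norm_ge0.
have D0 : (0 <= convolution_norm phi q * onesided_approx (2^-1 *: M ^+ j) p g)%E.
  exact: mule_ge0.
move: (Lp_norm p _) (best_approx _ _ _) (_ * _)%E A0 B0 D0 => A B D A0 B0 D0.
have c10 : 0 <= c1 by exact: le_trans ler01 c1_ge1.
have c20 : 0 <= c2 by exact: le_trans (ltW sc0) c2_ge.
(* This bound serves twice: with factor 1 it absorbs the error f - V * f, and with factor S the norm
   of X. *)
have key : (c1%:E * B + (A + c2%:E * D) <= inverse_const%:E * (A + B + D))%E.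
  rewrite [X in (_ <= _ * X)%E](_ : _ = (B + (A + D))%E); last by rewrite [(A + B)%E]addeC addeA.
  rewrite ge0_muleDr// ?adde_ge0//; apply: leeD.
    by rewrite lee_wpmul2r// lee_fin lerDl.
  rewrite ge0_muleDr//; apply: leeD.
    rewrite -[leLHS]mul1e lee_wpmul2r// lee_fin (le_trans c1_ge1)// lerDl//.
  by rewrite lee_wpmul2r// lee_fin lerDr.
rewrite [((1 + S) * _)%:E]EFinM [(1 + S)%:E]EFinD -muleA.
rewrite [X in (_ <= X)%E]ge0_muleDl ?lee_fin// mul1e.
apply: leeD; last by rewrite lee_wpmul2l// lee_fin.
apply: le_trans key; rewrite leeDl// adde_ge0// mule_ge0//.
Qed.

Let convolutionB_Lq h f F x : Lebesgue_space q h -> Lebesgue_space p f -> Lebesgue_space p F ->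
  convolution h (fun y => f y - F y) x = convolution h f x - convolution h F x.
Proof.
move=> Lh Lf LF; rewrite -cintegralB; [|exact: (integral_Lq_Lp x p1 pq)..].
by apply: eq_cintegral => y; rewrite mulrBr.
Qed.

Lemma K_functional_quasi_interp h f : dist_Lq phit q h -> approx_space p f ->
  (K_functional M s j p f <= ((1 + S) * inverse_const)%:E *
    (1 + convolution_norm phi q * Lqj_norm M q j h)
    * Lp_norm p (fun x => f x - quasi_interp M j phi (convolution h f) x)%R)%E.
Proof.
move=> hh Af; have [Lh _] := hh; have [mh ph _] := Lh.
have tphi := bphi.1.
have qp : (q^-1 + p^-1 = 1)%E by rewrite addeC.
have L1h := L1_Lebesgue q1 qp Lh.
have Lf := approx_Lebesgue p1 Af.
rewrite quasi_interp_sampling//.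
pose T := sampling a phi (convolution h f).
have tT : tpoly T by exact: tpoly_sampling.
pose F x := f x - T x.
have AF : approx_space p F by apply: approx_spaceB => //; exact: tpoly_approx.
have LF := approx_Lebesgue p1 AF.
have bT : band_limited a T.
  by split=> // k hk; rewrite fourier_sampling// bphi.2// mul0r.
have hT := tpoly_convolutionC L1h ph tT.
have thT : tpoly (convolution T h) by exact: tpoly_convolution.
have bhT : band_limited a (convolution T h).
  by split=> // k hk; rewrite fourier_convolution// bT.2// mul0r.
pose X := sampling a phi (convolution h F).
have tX : tpoly X by exact: tpoly_sampling.
(* T * h has its spectrum in D(M^j), so sampling it is the same as convolving it with phi; the
   convolution with f - T splits at each node because the integrals converge at every point. *)
have XT : X = (fun x => T x - convolution phi (convolution T h) x).
  apply/funext => x; rewrite -(sampling_band_limited a_neq0 bphi bhT) -samplingB /X.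
  rewrite -hT; congr (_ x); apply: eq_sampling => k.
  exact: (convolutionB_Lq _ Lh Lf (tpoly_Lebesgue p1 tT)).
have XE k : fourier X k = (1 - fourier phi k * dist_fourier phit k) * fourier T k.
  rewrite XT fourierB; [|exact: L1_tpoly|].
    rewrite !fourier_convolution//; last exact: L1_tpoly.
    by rewrite (dist_fourier_Lq k hh); ring.
  by apply: L1_tpoly; apply: tpoly_convolution => //; exact: L1_tpoly.
apply: le_trans (K_functional_band_limited f bT tX XE) _.
rewrite -/(Lp_norm p F).
have K0 := convolution_norm_ge0 phi p1 pq.
have F0 := Lp_norm_ge0 p F.
have N0 := node_average_norm_le j m_neq0 q1 mh ph.
have L0 : (0 <= Lqj_norm M q j h)%E.
  by apply: le_trans N0; exact: Lnorm_ge0.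
have XF : (Lp_norm p X <= (@sampling_const R d)%:E *
    (convolution_norm phi q * (Lqj_norm M q j h * Lp_norm p F)))%E.
  have [mF _ _] := LF.
  apply: le_trans (sampling_convolution_norm a_neq0 p1 pq bphi mh ph mF) _.
  apply: lee_wpmul2l; first by rewrite lee_fin ltW.
  by apply: lee_wpmul2l => //; exact: lee_wpmul2r.
have i0 := inverse_const_gt0.
have KL0 : (0 <= convolution_norm phi q * Lqj_norm M q j h)%E by exact: mule_ge0.
rewrite -muleA ge0_muleDl// mul1e ge0_muleDr//; last exact: mule_ge0.
apply: leeD.
  rewrite -[leLHS]mul1e lee_wpmul2r// lee_fin.
  apply: (@le_trans _ _ inverse_const); last by rewrite ler_peMl ?lerDl// ltW.
  by rewrite (le_trans c1_ge1)// lerDl (le_trans (ltW sc0)).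
apply: le_trans (lee_wpmul2l _ XF) _; first by rewrite lee_fin.
rewrite !muleA -EFinM -!muleA lee_wpmul2r//; first by rewrite !mule_ge0.
rewrite lee_fin; apply: ler_pM => //; [exact: ltW|by rewrite lerDr|].
by apply: le_trans c2_ge _; rewrite lerDr; exact: le_trans c1_ge1.
Qed.

End inverse_estimates.

Theorem theorem4p4 (R : realType) (d : nat) (hd : (0 < d)%N)
  (m : 'rV[int]_d) (hm : forall i, 1 < `|m 0 i|)
  (M : 'M[R]_d) (hM : M = dilation m)
  (v : 'cV[R]_d -> R[i]) (hv : csmooth v)
  (hv1 : forall x, box 4^-1 x -> v x = 1)
  (hv0 : forall x, ~ box (3 / 8) x -> v x = 0)
  (p q : \bar R) (hp : (1 <= p)%E) (hpq : (p^-1 + q^-1 = 1)%E)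
  (s : R) (hs : 0 < s) (delta : R) (hdelta : 0 < delta < 2^-1)
  (phit : nat -> periodic_distribution R d) (phi : nat -> 'cV[R]_d -> R[i])
  (hphi : forall j, (0 < j)%N -> trig_poly (M ^+ j) (phi j))
  (hne : forall j k, (0 < j)%N -> k != 0 -> v (delta *: node M j k) != 0 ->
    1 - fourier (phi j) k * dist_fourier (phit j) k != 0)
  (hmult : forall j, (0 < j)%N ->
    fourier_multiplier p (symbol M s delta v (phi j) (phit j) j))
  (hsup : (ereal_sup
    [set multiplier_norm p (symbol M s delta v (phi j) (phit j) j) |
       j in [set j | (0 < j)%N]] < +oo)%E) :
  exists C : R, [/\ 0 < C,
    forall j, (0 < j)%N -> forall f g, dist_convolution (phit j) p f g ->
      (K_functional M s j p f <=
       C%:E * (Lp_norm p (fun x => (f x - quasi_interp M j (phi j) g x)%R)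
         + best_approx (2^-1 *: M ^+ j) p f
         + convolution_norm (phi j) q
           * onesided_approx (2^-1 *: M ^+ j) p g))%E
  & forall j, (0 < j)%N -> forall h, dist_Lq (phit j) q h ->
      forall f, approx_space p f ->
      (K_functional M s j p f <=
       C%:E * (1 + convolution_norm (phi j) q * Lqj_norm M q j h)
         * Lp_norm p (fun x =>
             (f x - quasi_interp M j (phi j) (convolution h f) x)%R))%E].
Proof.
subst M; set sup := ereal_sup _ in hsup.
have [S S0 supS] : exists2 S : R, 0 <= S & (sup <= S%:E)%E.
  move: hsup; case: sup => [r| |]// _; last by exists 0; rewrite ?leNye.
  by exists (Num.max r 0); rewrite ?le_max ?lexx ?orbT// lee_fin le_max lexx.
have symbolS j : (0 < j)%N ->
    (multiplier_norm p (symbol (dilation m) s delta v (phi j) (phit j) j) <= S%:E)%E.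
  by move=> j0; apply: le_trans supS; apply: ereal_sup_ubound; exists j.
exists ((1 + S) * @inverse_const R d); split.
- by rewrite mulr_gt0 ?inverse_const_gt0// (lt_le_trans ltr01)// lerDl.
- move=> j j0 f g fg.
  exact: (K_functional_best_approx hm hv1 hp hpq hs hdelta (hphi j j0)
    (fun k => hne j k j0) S0 (symbolS j j0) fg).
- move=> j j0 h hh f Af.
  exact: (K_functional_quasi_interp hm hv1 hp hpq hs hdelta (hphi j j0)
    (fun k => hne j k j0) S0 (symbolS j j0) hh Af).
Qed.
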